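(* Assume $k_\alpha\ge 2$ for all $\alpha\in R$. Then the trigonometric Hamiltonian $\mathcal H_T$ is essentially self-adjoint on $\mathcal P=\mathbb C[P]^W\Delta$, as an operator in the Hilbert space $L^2(T,d\mu)^W$.
   Context: Let $R$ be a reduced crystallographic root system in the Euclidean space $\mathfrak h_{\mathbb R}^*$ dual to $\mathfrak h_{\mathbb R}$, with pairing $\langle\cdot,\cdot\rangle$, Weyl-invariant inner product $(\cdot|\cdot)$, $|\alpha|^2=(\alpha|\alpha)$, positive roots $R_+$, Weyl group $W$, coroot lattice $Q^\vee$, weight lattice $P$. Let $T=\mathfrak h_{\mathbb R}/2\pi Q^\vee$, let $\mu$ be its normalized Haar measure, and let $L^2(T,d\mu)^W$ be the space of $W$-invariant square integrable functions with $(f,g)=\int_T\overline f g\,d\mu$. The coupling constants $k_\alpha$ ($\alpha\in R$) are real and $W$-invariant: $k_{w\alpha}=k_\alpha$. For $\lambda\in P$ let $e^\lambda(h)=e^{\sqrt{-1}\langle\lambda,h\rangle}$, a function on $T$; $\mathbb C[P]$ is the span of these and $\mathbb C[P]^W$ its $W$-invariants. Put $\Delta(h)=\prod_{\alpha\in R_+}|\sin(\langle\alpha,h\rangle/2)|^{k_\alpha}$ and $\mathcal P=\mathbb C[P]^W\Delta=\{f\Delta: f\in\mathbb C[P]^W\}$. With $L$ the Laplacian on $T$, the trigonometric Hamiltonian is $$\mathcal H_T=-L+\sum_{\alpha\in R_+}k_\alpha(k_\alpha-1)|\alpha|^2\Bigl(\frac1{4\sin^2(\langle\alpha,h\rangle/2)}-\frac1{12}\Bigr),$$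 defined on the $W$-invariant $C^2$ functions on $T$ lying in the $L^2$-domain of the multiplication operator by the potential. *)

(* Defs.v *)
From HB Require Import structures.
From mathcomp Require Import all_boot all_order all_algebra finmap.
From mathcomp Require Import generic_quotient ring_quotient.
From mathcomp Require Import all_classical all_reals all_analysis.
From mathcomp Require Import complex.

Set Implicit Arguments.
Unset Strict Implicit.
Unset Printing Implicit Defensive.

Import Order.TTheory GRing.Theory Num.Theory.
Import numFieldNormedType.Exports.

Local Open Scope classical_set_scope.
Local Open Scope ring_scope.
Local Open Scope complex_scope.

(* A Hilbert space is given as a subset [H] of a complex vector space [E] with
   a form [ip], conjugate-linear on the left.  The form may be degenerate:
   below, [E] consists of functions and [H] of square integrable ones, two
   functions with [hnorm (f - g) = 0] representing the same vector.  Operators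
   are handled through their graphs; [graph_closure] and [graph_adjoint] are
   saturated under this identification. *)
Section Operators.
Variables (R : realType) (E : lmodType R[i]) (ip : E -> E -> R[i]) (H : set E).

Definition hnorm (f : E) : R := Num.sqrt (complex.Re (ip f f)).

Definition densely_contained (D : set E) : Prop :=
  D `<=` H /\
  forall f, H f -> forall e : R, 0 < e -> exists2 u, D u & hnorm (f - u) < e.

Definition linear_operator_in (D : set E) (A : E -> E) : Prop :=
  [/\ D 0,
      (forall (a : R[i]) f g, D f -> D g -> D (a *: f + g)),
      (forall (a : R[i]) f g, D f -> D g -> A (a *: f + g) = a *: A f + A g) &
      (forall f, D f -> H f /\ H (A f))].

Definition symmetric_on (D : set E) (A : E -> E) : Prop :=
  forall f g, D f -> D g -> ip f (A g) = ip (A f) g.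

Definition operator_graph (D : set E) (A : E -> E) : set (E * E) :=
  [set p | D p.1 /\ p.2 = A p.1].

Definition graph_domain (G : set (E * E)) : set E :=
  [set f | exists g, G (f, g)].

Definition graph_closure (G : set (E * E)) : set (E * E) :=
  [set p | [/\ H p.1, H p.2 & forall e : R, 0 < e ->
     exists2 q, G q & hnorm (p.1 - q.1) < e /\ hnorm (p.2 - q.2) < e]].

Definition graph_adjoint (G : set (E * E)) : set (E * E) :=
  [set p | [/\ H p.1, H p.2 & forall q, G q -> ip p.1 q.2 = ip p.2 q.1]].

Definition self_adjoint_graph (G : set (E * E)) : Prop :=
  densely_contained (graph_domain G) /\ graph_adjoint G = G.

(* [A] restricted to [D] is a densely defined symmetric operator whose closure
   is self-adjoint. *)
Definition essentially_self_adjoint_on (D : set E) (A : E -> E) : Prop :=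
  [/\ linear_operator_in D A, densely_contained D, symmetric_on D A &
      self_adjoint_graph (graph_closure (operator_graph D A))].

End Operators.

(* Choosing an orthonormal basis, the Euclidean space is R^n with the dot
   product, which also identifies it with its dual: both weights and points of
   h_R are elements of ['rV[R]_n], and the pairing is [dotv]. *)
Section RootSystems.
Variables (R : realType) (n : nat).
Implicit Types (a b x y : 'rV[R]_n) (Phi Pos : {fset 'rV[R]_n}).

Definition dotv x y : R := \sum_(i < n) x 0 i * y 0 i.

Definition coroot a : 'rV[R]_n := (2 / dotv a a) *: a.

Definition reflection a x : 'rV[R]_n := x - dotv x (coroot a) *: a.

Record reduced_crystallographic_root_system Phi : Prop := {
  roots_span : (<<Phi>> = fullv)%VS;
  roots_neq0 : 0 \notin Phi;
  roots_reflection : forall a b, a \in Phi -> b \in Phi ->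
    reflection a b \in Phi;
  roots_crystallographic : forall a b, a \in Phi -> b \in Phi ->
    dotv b (coroot a) \is a Num.int;
  roots_reduced : forall a (c : R), a \in Phi -> c *: a \in Phi ->
    c = 1 \/ c = -1 }.

Definition positive_roots Phi Pos : Prop :=
  exists2 v : 'rV[R]_n, (forall a, a \in Phi -> dotv a v != 0) &
    Pos = [fset a in Phi | 0 < dotv a v]%fset.

(* Reflections being involutions, their products form a group. *)
Inductive weyl Phi : ('rV[R]_n -> 'rV[R]_n) -> Prop :=
| weyl_id : weyl Phi id
| weyl_reflection a w : a \in Phi -> weyl Phi w -> weyl Phi (reflection a \o w).

Definition coroot_lattice Phi : set 'rV[R]_n :=
  [set x | exists c : 'rV[R]_n -> int, x = \sum_(a <- Phi) coroot a *~ c a].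

Definition weight_lattice Phi : set 'rV[R]_n :=
  [set l | forall a, a \in Phi -> dotv l (coroot a) \is a Num.int].

Definition period_lattice Phi : {pred 'rV[R]_n} :=
  fun x => `[< exists2 q, coroot_lattice Phi q & x = (2 * pi) *: q >].

Lemma period_lattice_zmod_closed Phi : zmod_closed (period_lattice Phi).
Proof.
split=> [|_ _ /asboolP[q [c ->] ->] /asboolP[r [d ->] ->]]; apply/asboolP.
  exists 0; last by rewrite scaler0.
  by exists (fun=> 0); rewrite big1 // => a _; rewrite mulr0z.
exists (\sum_(a <- Phi) coroot a *~ (c a - d a)); first by exists (c \- d).
rewrite -scalerBr -sumrB; congr (_ *: _).
by apply: eq_bigr => a _; rewrite mulrzBr.
Qed.

End RootSystems.

HB.instance Definition _ (R : realType) (n : nat) (Phi : {fset 'rV[R]_n}) :=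
  GRing.isZmodClosed.Build _ (period_lattice Phi)
    (period_lattice_zmod_closed Phi).

Definition torus (R : realType) (n : nat) (Phi : {fset 'rV[R]_n}) : Type :=
  quotient_topology (Quotient.quot (period_lattice Phi)).

HB.instance Definition _ (R : realType) (n : nat) (Phi : {fset 'rV[R]_n}) :=
  PointedTopological.on (torus Phi).
HB.instance Definition _ (R : realType) (n : nat) (Phi : {fset 'rV[R]_n}) :=
  Quotient.on (torus Phi).
HB.instance Definition _ (R : realType) (n : nat) (Phi : {fset 'rV[R]_n}) :=
  GRing.Zmodule.copy (torus Phi) (Quotient.quot (period_lattice Phi)).
HB.instance Definition _ (R : realType) (n : nat) (Phi : {fset 'rV[R]_n}) :=
  @isMeasurable.Build (sigma_display (@open (torus Phi))) (torus Phi)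
    <<s @open (torus Phi) >> (@sigma_algebra0 _ setT _)
    (@sigma_algebraC _ _) (@sigma_algebra_bigcup _ setT _).

Section Hamiltonian.
Variables (R : realType) (n : nat).
Implicit Types (Phi Pos : {fset 'rV[R]_n}).

(* [repr t] is a representative of [t] in R^n; every function of [repr t] used
   below is [period_lattice Phi]-periodic. *)
Definition torus_pi Phi (x : 'rV[R]_n) : torus Phi := \pi_(torus Phi)%qT x.

Definition torus_act Phi (w : 'rV[R]_n -> 'rV[R]_n) (t : torus Phi) :
  torus Phi := torus_pi Phi (w (repr t)).

Definition W_invariant Phi (f : torus Phi -> R[i]) : Prop :=
  forall w, weyl Phi w -> forall t, f (torus_act w t) = f t.

Definition normalized_Haar Phi (mu : probability (torus Phi) R) : Prop :=
  forall (t : torus Phi) (A : set (torus Phi)), measurable A ->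
    mu (+%R t @^-1` A) = mu A.

Definition expo Phi (l : 'rV[R]_n) (t : torus Phi) : R[i] :=
  cos (dotv l (repr t)) +i* sin (dotv l (repr t)).

Definition trig_poly Phi : set (torus Phi -> R[i]) :=
  [set f | exists (s : {fset 'rV[R]_n}) (c : 'rV[R]_n -> R[i]),
     (forall l, l \in s -> weight_lattice Phi l) /\
     f = fun t => \sum_(l <- s) c l * expo l t].

Definition trig_poly_W Phi : set (torus Phi -> R[i]) :=
  [set f | trig_poly f /\ W_invariant f].

Definition Delta Phi Pos (k : 'rV[R]_n -> R) (t : torus Phi) : R :=
  \prod_(a <- Pos) `|sin (dotv a (repr t) / 2)| `^ k a.

Definition calP Phi Pos (k : 'rV[R]_n -> R) : set (torus Phi -> R[i]) :=
  [set f | exists2 g, trig_poly_W g & f = fun t => g t * (Delta Pos k t)%:C].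

Definition partial (i : 'I_n) (F : 'rV[R]_n -> R) : 'rV[R]_n -> R :=
  'D_(delta_mx 0 i) F.

Definition C2 (F : 'rV[R]_n -> R) : Prop :=
  [/\ continuous F,
      (forall i x, derivable F x (delta_mx 0 i)),
      (forall i, continuous (partial i F)),
      (forall i j x, derivable (partial i F) x (delta_mx 0 j)) &
      (forall i j, continuous (partial j (partial i F)))].

Definition laplacian (F : 'rV[R]_n -> R) (x : 'rV[R]_n) : R :=
  \sum_(i < n) partial i (partial i F) x.

Definition re_pullback Phi (f : torus Phi -> R[i]) (x : 'rV[R]_n) : R :=
  complex.Re (f (torus_pi Phi x)).

Definition im_pullback Phi (f : torus Phi -> R[i]) (x : 'rV[R]_n) : R :=
  complex.Im (f (torus_pi Phi x)).

Definition torus_C2 Phi (f : torus Phi -> R[i]) : Prop :=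
  C2 (re_pullback f) /\ C2 (im_pullback f).

Definition torus_laplacian Phi (f : torus Phi -> R[i]) (t : torus Phi) : R[i] :=
  laplacian (re_pullback f) (repr t) +i* laplacian (im_pullback f) (repr t).

Definition potential Phi Pos (k : 'rV[R]_n -> R) (t : torus Phi) : R :=
  \sum_(a <- Pos) k a * (k a - 1) * dotv a a *
    ((4 * sin (dotv a (repr t) / 2) ^+ 2)^-1 - 12^-1).

Definition hamiltonian Phi Pos (k : 'rV[R]_n -> R) (f : torus Phi -> R[i]) :
    torus Phi -> R[i] :=
  fun t => - torus_laplacian f t + (potential Pos k t)%:C * f t.

Section L2.
Variables (Phi : {fset 'rV[R]_n}) (mu : probability (torus Phi) R).

Definition L2 : set (torus Phi -> R[i]) :=
  [set f | (fun t => complex.Re (f t)) \in Lfun mu 2%:E /\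
           (fun t => complex.Im (f t)) \in Lfun mu 2%:E].

(* Elements of L^2 are classes modulo equality almost everywhere, so their
   W-invariance is meant almost everywhere. *)
Definition L2_W : set (torus Phi -> R[i]) :=
  [set f | L2 f /\ forall w, weyl Phi w ->
     {ae mu, forall t, f (torus_act w t) = f t}].

Definition integralC (f : torus Phi -> R[i]) : R[i] :=
  (\int[mu]_t complex.Re (f t))%R +i* (\int[mu]_t complex.Im (f t))%R.

Definition L2_inner (f g : torus Phi -> R[i]) : R[i] :=
  integralC (fun t => (f t)^*%C * g t).

Definition hamiltonian_domain Pos (k : 'rV[R]_n -> R) :
    set (torus Phi -> R[i]) :=
  [set f | [/\ W_invariant f, torus_C2 f, L2 f &
              L2 (fun t => (potential Pos k t)%:C * f t)]].

End L2.
End Hamiltonian.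

Arguments trig_poly {R n} Phi.
Arguments trig_poly_W {R n} Phi.
Arguments calP {R n} Phi Pos k.

(* Main.v *)
(** Off the hyperplanes [sin (<a, h> / 2) = 0] one has [H_T (g Delta) = (D g) Delta] with
    [D g = - L g - sum_a k_a cot (<a, h> / 2) d_a g + C g]: the potential cancels the squared
    cotangents, and the mixed products of cotangents add up to a constant because of the
    addition formula of the cotangent.  When [g] is W-invariant, [d_a g] is a combination of
    the [e^l - e^(r_a l)], and [cot (<a, h> / 2) (e^l - e^(r_a l))] is a sum of exponentials
    whose exponents lie on the segment from [l] to [r_a l].  So [D] preserves the
    finite-dimensional space of invariant trigonometric polynomials with exponents in a ball;
    there [H_T + i] and [H_T - i], being injective by symmetry, are onto by Cayley-Hamilton.
    Hence [H_T + i] and [H_T - i] map the dense subspace [C[P]^W Delta] onto itself up to null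
    functions, which gives essential self-adjointness.  Density follows from that of
    trigonometric polynomials in [L^2(T)], dividing by [Delta] and averaging over [W]. *)

From HB Require Import structures.
Require Import Defs.
From mathcomp Require Import all_boot all_order all_algebra finmap.
From mathcomp Require Import all_classical all_reals all_analysis.
From mathcomp Require Import complex measurable_realfun.
From mathcomp Require Import generic_quotient ring_quotient.
From mathcomp Require Import ring lra zify.

Set Implicit Arguments.
Unset Strict Implicit.
Unset Printing Implicit Defensive.

Import Order.TTheory GRing.Theory Num.Theory.
Import numFieldNormedType.Exports Normc.
Local Open Scope ring_scope.
Local Open Scope classical_set_scope.
Local Open Scope complex_scope.

(** * A criterion for essential self-adjointness *)

(** The bound [2 <= k a] is used for smoothness: then [|sin| ^ k] is of class C2 and
    [|sin| ^ k / sin ^ 2] is bounded, so [g Delta] lies in the domain although the potential is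
    singular. On the hyperplanes division by zero returns [0] and [H_T (g Delta) = (D g) Delta] may
    fail; the identity is therefore proved at regular points, the hyperplanes are shown to be null,
    and the operator theory is carried out for a degenerate form, modulo vectors of norm zero. All
    that is given about [mu] is invariance under translations: its invariance under W follows by
    comparing integrals of exponentials, and integration by parts by passing to the limit in
    difference quotients. The constant hidden in the mixed products of cotangents is found by
    grouping pairs of roots according to the rank two system that they generate, A2, B2 or G2; each
    type has its own constant. Balls serve as sets of exponents because they are stable under W,
    convex, and contain finitely many weights. *)

Lemma normc_ge0 (R : realType) (z : R[i]) : 0 <= normc z.
Proof. by case: z => x y; apply: sqrtr_ge0. Qed.

Section PreHilbert.
Variables (R : realType) (E : lmodType R[i]) (ip : E -> E -> R[i]) (H : set E).

(** The laws are required on [H] only, because the integral is additive only on integrable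
    functions, and positivity is not strict, because functions that vanish almost everywhere are
    nonzero elements of [E]. *)
Record pre_hilbert : Prop := {
  ph_0 : H 0;
  ph_lin : forall (a : R[i]) f g, H f -> H g -> H (a *: f + g);
  ph_ipr : forall (a : R[i]) f g h, H f -> H g -> H h ->
    ip h (a *: f + g) = a * ip h f + ip h g;
  ph_ipC : forall f g, H f -> H g -> ip g f = (ip f g)^*;
  ph_ge0 : forall f, H f -> 0 <= complex.Re (ip f f) }.

Hypothesis ph : pre_hilbert.

Lemma phD f g : H f -> H g -> H (f + g).
Proof. by move=> Hf Hg; rewrite -[f]scale1r; apply: ph_lin. Qed.

Lemma phZ a f : H f -> H (a *: f).
Proof. by move=> Hf; rewrite -[_ *: _]addr0; apply: ph_lin => //; apply: ph_0. Qed.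

Lemma phN f : H f -> H (- f).
Proof. by move=> Hf; rewrite -scaleN1r; apply: phZ. Qed.

Lemma phB f g : H f -> H g -> H (f - g).
Proof. by move=> Hf Hg; apply: phD => //; apply: phN. Qed.

Lemma ipDr h f g : H h -> H f -> H g -> ip h (f + g) = ip h f + ip h g.
Proof. by move=> *; rewrite -[f]scale1r ph_ipr // mul1r scale1r. Qed.

Lemma ip0r h : H h -> ip h 0 = 0.
Proof.
move=> Hh; have := ipDr Hh ph.(ph_0) ph.(ph_0).
by rewrite addr0 => /eqP; rewrite -subr_eq0 opprD addrA subrr sub0r oppr_eq0 => /eqP.
Qed.

Lemma ipZr a h f : H h -> H f -> ip h (a *: f) = a * ip h f.
Proof.
move=> Hh Hf; rewrite -[_ *: _]addr0 ph_ipr // ?ip0r ?addr0 //.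
exact: ph.(ph_0).
Qed.

Lemma ipNr h f : H h -> H f -> ip h (- f) = - ip h f.
Proof. by move=> *; rewrite -scaleN1r ipZr // mulN1r. Qed.

Lemma ipBr h f g : H h -> H f -> H g -> ip h (f - g) = ip h f - ip h g.
Proof. by move=> *; rewrite ipDr ?ipNr //; apply: phN. Qed.

Lemma ipDl h f g : H h -> H f -> H g -> ip (f + g) h = ip f h + ip g h.
Proof.
move=> Hh Hf Hg; rewrite (ph_ipC ph Hh (phD Hf Hg)) ipDr // rmorphD /=.
by rewrite -!ph_ipC.
Qed.

Lemma ipZl a h f : H h -> H f -> ip (a *: f) h = a^* * ip f h.
Proof.
move=> Hh Hf; rewrite (ph_ipC ph Hh (phZ a Hf)) ipZr // rmorphM /=.
by rewrite -ph_ipC.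
Qed.

Lemma ipNl h f : H h -> H f -> ip (- f) h = - ip f h.
Proof. by move=> *; rewrite -scaleN1r ipZl // rmorphN rmorph1 mulN1r. Qed.

Lemma ipBl h f g : H h -> H f -> H g -> ip (f - g) h = ip f h - ip g h.
Proof. by move=> *; rewrite ipDl ?ipNl //; apply: phN. Qed.

Local Notation nrm := (hnorm ip).

Lemma nrm_ge0 f : 0 <= nrm f.
Proof. exact: sqrtr_ge0. Qed.

Lemma ip_self f : H f -> ip f f = (nrm f ^+ 2)%:C.
Proof.
move=> Hf; rewrite /hnorm sqr_sqrtr ?(ph_ge0 ph) //.
have := ph_ipC ph Hf Hf; case: (ip f f) => a b /= [].
by move/eqP; rewrite -subr_eq0 opprK -mulr2n mulrn_eq0 /= => /eqP ->.
Qed.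

Lemma sqr_nrm f : H f -> nrm f ^+ 2 = complex.Re (ip f f).
Proof. by move=> Hf; rewrite ip_self. Qed.

Lemma nrmZ a f : H f -> nrm (a *: f) = normc a * nrm f.
Proof.
move=> Hf; rewrite {1}/hnorm ipZl ?ipZr //; last exact: phZ.
rewrite ip_self // mulrA.
have -> : a^* * a = (normc a ^+ 2)%:C.
  case: a => x y; rewrite /= sqr_sqrtr; first by simpc; congr (_ +i* _); ring.
  by rewrite addr_ge0 // sqr_ge0.
by rewrite -rmorphM /= -exprMn sqrtr_sqr ger0_norm // mulr_ge0 ?nrm_ge0 ?normc_ge0.
Qed.

Lemma nrmN f : H f -> nrm (- f) = nrm f.
Proof. by move=> Hf; rewrite -scaleN1r nrmZ // normcN normc1 mul1r. Qed.

Lemma Re_ip_le f g : H f -> H g -> complex.Re (ip f g) <= nrm f * nrm g.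
Proof.
move=> Hf Hg; set r := complex.Re (ip f g).
have quad (t : R) : 0 <= nrm f ^+ 2 - 2 * t * r + t ^+ 2 * nrm g ^+ 2.
  have Htg : H (t%:C *: g) by apply: phZ.
  have Hh : H (f - t%:C *: g) by apply: phB.
  have := ph_ge0 ph Hh.
  rewrite ipBl ?ipBr // ?ipZl ?ipZr // (ph_ipC ph Hf Hg) !ip_self // /r.
  case: (ip f g) => x y; simpc => /=; rewrite ?mul0r ?subr0.
  by move=> h; apply: le_trans h _; lra.
have [g0|g0] := eqVneq (nrm g) 0.
  rewrite g0 mulr0; have [//|r0] := leP r 0.
  (* As the form is degenerate, [nrm g = 0] does not give [g = 0]. The quadratic is then affine in
     [t], and this value of [t] makes it equal to [-1]. *)
  have := quad ((nrm f ^+ 2 + 1) / (2 * r)).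
  rewrite g0 expr0n mulr0 addr0.
  have -> : 2 * ((nrm f ^+ 2 + 1) / (2 * r)) * r = nrm f ^+ 2 + 1.
    by field; apply: lt0r_neq0.
  by lra.
have := quad (r / nrm g ^+ 2).
have -> : nrm f ^+ 2 - 2 * (r / nrm g ^+ 2) * r + (r / nrm g ^+ 2) ^+ 2 * nrm g ^+ 2
  = nrm f ^+ 2 - r ^+ 2 / nrm g ^+ 2 by field.
rewrite subr_ge0 ler_pdivrMr; last by rewrite exprn_even_gt0.
rewrite -exprMn => h; have [r0|r0] := leP r 0.
  by apply: (le_trans r0); rewrite mulr_ge0 ?nrm_ge0.
by rewrite -ler_sqr ?nnegrE ?mulr_ge0 ?nrm_ge0 // ltW.
Qed.

Lemma nrmD f g : H f -> H g -> nrm (f + g) <= nrm f + nrm g.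
Proof.
move=> Hf Hg; have Hfg := phD Hf Hg.
rewrite -ler_sqr ?nnegrE ?addr_ge0 ?nrm_ge0 // sqr_nrm //.
rewrite ipDl ?ipDr // (ph_ipC ph Hf Hg) !ip_self //.
have := Re_ip_le Hf Hg; case: (ip f g) => x y /=; simpc => /= h.
by rewrite sqrrD; lra.
Qed.

Lemma nrmB f g : H f -> H g -> nrm (f - g) = nrm (g - f).
Proof. by move=> *; rewrite -nrmN ?opprB //; apply: phB. Qed.

Lemma nrm_triangle f g h : H f -> H g -> H h ->
  nrm (f - h) <= nrm (f - g) + nrm (g - h).
Proof.
by move=> Hf Hg Hh; rewrite -[f - h](subrKA g); apply: nrmD; apply: phB.
Qed.

Lemma norm_ip_le f g : H f -> H g -> normc (ip f g) <= nrm f * nrm g.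
Proof.
move=> Hf Hg; have [f0|f0] := eqVneq (ip f g) 0.
  by rewrite f0 normc0 mulr_ge0 // nrm_ge0.
set z := ip f g in f0 *.
have z0 : normc z != 0 by apply: contra f0 => /eqP/eq0_normc ->.
(* The phase for which [ip f (u *: g)] is the real number [normc z]. *)
pose u := z^* * ((normc z)^-1)%:C.
have zz : z^* * z = (normc z ^+ 2)%:C.
  case: (z) => x y; rewrite /= sqr_sqrtr; first by simpc; congr (_ +i* _); ring.
  by rewrite addr_ge0 // sqr_ge0.
have u1 : normc u = 1.
  rewrite /u normcM (_ : normc z^* = normc z); last by case: (z) => x y /=; rewrite sqrrN.
  by rewrite /= expr0n addr0 sqrtr_sqr ger0_norm ?invr_ge0 ?normc_ge0 // divff.
have <- : complex.Re (ip f (u *: g)) = normc z.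
  by rewrite ipZr // /u -/z mulrAC zz -rmorphM /= expr2 mulfK.
apply: (le_trans (Re_ip_le Hf (phZ _ Hg))).
by rewrite nrmZ // u1 mul1r.
Qed.

Lemma ip_approx0 (z : R[i]) (M : R) :
  (forall e : R, 0 < e -> normc z <= e * M) -> z = 0.
Proof.
move=> h; apply: eq0_normc; apply/eqP; rewrite eq_le normc_ge0 andbT leNgt.
apply/negP => zp.
have M0 : 0 < M.
  have := h 1 ltr01; rewrite mul1r; exact: lt_le_trans.
have := h (normc z / (2 * M)) (divr_gt0 zp (mulr_gt0 (ltr0Sn _ 1) M0)).
have -> : normc z / (2 * M) * M = normc z / 2 by field; apply: lt0r_neq0.
by lra.
Qed.

Section EssentialSelfAdjoint.
Variables (D : set E) (A : E -> E).
Hypotheses (linA : linear_operator_in H D A) (denseD : densely_contained ip H D)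
  (symA : symmetric_on ip D A).

Let DH f : D f -> H f. Proof. by case: denseD => + _; apply. Qed.
Let AH f : D f -> H (A f). Proof. by case: linA => _ _ _ h /h[]. Qed.
(* As [A] is symmetric, [|(A + t i) f|^2 = |A f|^2 + t^2 |f|^2]. *)
Lemma nrm_shift f (t : R) : D f ->
  nrm (A f + (t *i) *: f) ^+ 2 = nrm (A f) ^+ 2 + t ^+ 2 * nrm f ^+ 2.
Proof.
move=> Df; have Hf := DH Df; have HA := AH Df.
have Hi : H ((t *i) *: f) by apply: phZ.
have Hs := phD HA Hi; rewrite sqr_nrm // ipDl // !ipDr // ?ipZl // ?ipZr //.
rewrite -(symA Df Df) !ip_self //.
have : (ip f (A f))^* = ip f (A f) by rewrite -ph_ipC // (symA Df Df).
case: (ip f (A f)) => x y /= [] h; simpc => /=.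
have -> : y = 0 by lra.
by ring.
Qed.

(** Bounds the inverses of [A + i] and [A - i]; in particular both shifts are injective modulo null
    vectors. *)
Lemma shift_ge f : D f -> forall t : R, t ^+ 2 = 1 ->
  nrm f <= nrm (A f + (t *i) *: f).
Proof.
move=> Df t t1; rewrite -ler_sqr ?nnegrE ?nrm_ge0 // nrm_shift //.
by rewrite t1 mul1r lerDr sqr_ge0.
Qed.

(** [t = 1] and [t = -1] encode the shifts by [i] and [- i]. Since [D] is dense, hitting the
    elements of [D] makes both ranges dense in [H]. *)
Hypothesis range : forall (t : R), t ^+ 2 = 1 -> forall u, D u ->
  exists2 f, D f & nrm (A f + (t *i) *: f - u) = 0.

Let range_dense (t : R) : t ^+ 2 = 1 -> forall u, H u -> forall e : R, 0 < e ->
  exists2 f, D f & nrm (A f + (t *i) *: f - u) < e.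
Proof.
move=> t1 u Hu e e0; case: denseD => _ /(_ u Hu e e0)[v Dv uv].
have [f Df fv] := range t1 Dv; exists f => //.
have Hv := DH Dv; have Hf := DH Df; have HA := AH Df.
have Hs : H (A f + (t *i) *: f) by apply: phD => //; apply: phZ.
by apply: le_lt_trans (nrm_triangle Hs Hv Hu) _; rewrite fv add0r nrmB.
Qed.

Let G := operator_graph D A.

Lemma graph_sub_closure q : G q -> graph_closure ip H G q.
Proof.
case: q => f g [/= Df ->]; have Hf := DH Df; have HA := AH Df.
split=> // e e0; exists (f, A f); first by split.
rewrite /= !subrr /hnorm ip0r ?sqrtr0 //; exact: ph.(ph_0).
Qed.

(** Choose [f] with [(A + i) f] close to [p.2 + i p.1]. By adjointness [p.1 - f] is then almost
    orthogonal to the range of [A - i]; as this range is dense and [A - i] is bounded below,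
    [p.1 - f] itself is small. *)
Lemma adjoint_approx p : H p.1 -> H p.2 ->
  (forall q, G q -> ip p.1 q.2 = ip p.2 q.1) ->
  forall e : R, 0 < e -> exists2 f, D f &
    nrm (p.1 - f) < e /\ nrm (p.2 - A f) < e.
Proof.
case: p => p1 p2 /= Hp1 Hp2 adj e e0.
have t1 : (1 : R) ^+ 2 = 1 by rewrite expr1n.
have t2 : (-1 : R) ^+ 2 = 1 by rewrite sqrrN expr1n.
have e2 : 0 < e / 8 by lra.
pose w := p2 + (1 *i) *: p1.
have Hw : H w by apply: phD => //; apply: phZ.
have [f Df fw] := range_dense t1 Hw e2.
have Hf := DH Df; have HAf := AH Df.
have Hr : H (A f + (1 *i) *: f - w) by apply: phB => //; apply: phD => //; apply: phZ.
(* [p2] plays the part of [A p1], and moving the shift across the form conjugates it: [A - i] on the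
   right becomes [A + i] on the left. *)
have key g : D g -> ip (p1 - f) (A g + ((-1) *i) *: g) = ip (w - (A f + (1 *i) *: f)) g.
  move=> Dg; have Hg := DH Dg; have HAg := AH Dg.
  have Hig : H (((-1) *i) *: g) by apply: phZ.
  have Hs : H (A f + (1 *i) *: f) by apply: phD => //; apply: phZ.
  rewrite ipBl //; last exact: phD.
  rewrite (ipBl Hg Hw Hs) /w !ipDr // !ipZr // !ipDl ?ipZl //; try exact: phZ.
  have -> : ip p1 (A g) = ip p2 g by apply: (adj (g, A g)); split.
  rewrite (symA Df Dg).
  by [].
have d0 := nrm_ge0 (p1 - f); set d := nrm (p1 - f) in d0 *.
have Hd : H (p1 - f) by apply: phB.
(* With [r = e / 8], testing [p1 - f] against a near solution [g] of [(A - i) g = p1 - f] yields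
   [d ^ 2 <= r (d + r) + d r], which is impossible for [d > 3 r]. *)
have dle : d <= 3 * (e / 8).
  rewrite leNgt; apply/negP => ed.
  have [g Dg gd] := range_dense t2 Hd e2.
  have Hg := DH Dg; have HAg := AH Dg.
  have Hs : H (A g + ((-1) *i) *: g) by apply: phD => //; apply: phZ.
  set s := A g + _ in gd Hs.
  have sd : nrm s <= d + nrm (s - (p1 - f)).
    by rewrite -[s in nrm s](subrK (p1 - f)) addrC; apply: nrmD => //; apply: phB.
  have gs : nrm g <= nrm s by apply: shift_ge.
  have h1 : complex.Re (ip (p1 - f) s) <= e / 8 * nrm s.
    rewrite key //; apply: le_trans (Re_ip_le _ Hg) _; first by rewrite -opprB; apply: phN.
    rewrite -opprB nrmN //; apply: ler_pM => //; try exact: nrm_ge0.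
    exact: ltW.
  have h2 : d ^+ 2 <= complex.Re (ip (p1 - f) s) + d * nrm (s - (p1 - f)).
    rewrite sqr_nrm // -{2}[p1 - f](subKr s) ipBr //; last exact: phB.
    rewrite raddfB /= lerD2l -raddfN -ipNr //; last exact: phB.
    apply: le_trans (Re_ip_le _ _) _ => //; first by apply: phN; apply: phB.
    by rewrite nrmN //; apply: phB.
  have h3 := nrm_ge0 s.
  set x := nrm (s - _) in gd sd h2; set y := nrm s in gs h1 h3 sd.
  have : d * x <= d * (e / 8) by apply: ler_wpM2l => //; apply: ltW.
  have : e / 8 * y <= e / 8 * (d + e / 8).
    by apply: ler_wpM2l; [lra | apply: (le_trans sd); lra].
  have : 0 < d * (d - 3 * (e / 8)) by apply: mulr_gt0; lra.
  have : 0 < e / 8 * (d - 3 * (e / 8)) by apply: mulr_gt0; lra.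
  have : 0 < e / 8 * (e / 8) by apply: mulr_gt0.
  rewrite expr2 in h2; move: h1 h2; set z := complex.Re _.
  lra.
have Hi : H ((1 *i) *: (p1 - f)) by apply: phZ.
exists f => //; split; first by rewrite -/d; lra.
(* The second component costs the residual of [f] plus [d], hence at most [e / 8 + 3 * (e / 8)]. *)
have -> : p2 - A f = - (A f + (1 *i) *: f - w) - (1 *i) *: (p1 - f).
  rewrite /w scalerBr; move: (_ *: p1) (_ *: f) => x y.
  by rewrite !opprB opprD [p2 + x + _]addrACA -[y - x]opprB addrK.
apply: le_lt_trans (nrmD (phN Hr) (phN Hi)) _.
rewrite !nrmN // nrmZ // /= expr0n add0r expr1n sqrtr1 mul1r -/d.
by lra.
Qed.

Lemma essentially_self_adjoint_of_range :
  essentially_self_adjoint_on ip H D A.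
Proof.
split=> //; split.
  split=> [f [g []]//|f Hf e e0]; case: denseD => _ /(_ f Hf e e0)[u Du fu].
  by exists u => //; exists (A u); apply: graph_sub_closure.
(* A pair adjoint to the closure is adjoint to [G], hence a limit of elements of [G]. Conversely,
   the symmetry of [A] passes to limits in both arguments. *)
apply/seteqP; split=> [p [Hp1 Hp2 adj]|p [Hp1 Hp2 cl]]; split=> //.
  move=> e e0; have adj' q : G q -> ip p.1 q.2 = ip p.2 q.1.
    by move=> /graph_sub_closure; apply: adj.
  by have [f Df ?] := adjoint_approx Hp1 Hp2 adj' e0; exists (f, A f).
move=> q [Hq1 Hq2 clq]; apply/eqP; rewrite -subr_eq0; apply/eqP.
(* The four differences below are multiplied by vectors of norm at most [nrm q.2], [nrm p.1 + 1],
   [nrm q.1] and [nrm p.2 + 1]. The two units come from approximating within [Num.min e 1]. *)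
apply: (@ip_approx0 _ (nrm q.1 + nrm q.2 + nrm p.1 + nrm p.2 + 2)) => e e0.
have m0 : 0 < Num.min e 1 by rewrite lt_min e0 ltr01.
have [[f1 f2] /= [Df Ef] [f1e f2e]] := cl _ m0; rewrite /= in Ef; rewrite {}Ef in f2e.
have [[g1 g2] /= [Dg Eg] [g1e g2e]] := clq _ m0; rewrite /= in Eg; rewrite {}Eg in g2e.
have Hf := DH Df; have HAf := AH Df; have Hg := DH Dg; have HAg := AH Dg.
have Hpf1 : H (p.1 - f1) by apply: phB.
have Hpf2 : H (p.2 - A f1) by apply: phB.
have Hqg1 : H (q.1 - g1) by apply: phB.
have Hqg2 : H (q.2 - A g1) by apply: phB.
have -> : ip p.1 q.2 - ip p.2 q.1 =
   ip (p.1 - f1) q.2 + ip f1 (q.2 - A g1)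
   - (ip (p.2 - A f1) q.1 + ip (A f1) (q.1 - g1)).
  rewrite !ipBl ?ipBr // (symA Df Dg); ring.
have tri (x y z t : R[i]) : normc (x + y - (z + t)) <=
   normc x + normc y + normc z + normc t.
  apply: le_trans (le_normcD _ _) _; rewrite normcN -!addrA addrA.
  by apply: lerD; apply: le_normcD.
apply: le_trans (tri _ _ _ _) _.
have i1 := norm_ip_le Hpf1 Hq2; have i2 := norm_ip_le Hf Hqg2.
have i3 := norm_ip_le Hpf2 Hq1; have i4 := norm_ip_le HAf Hqg1.
have bnd (x a y : R) : x <= a * y -> 0 <= y -> a < Num.min e 1 -> x <= e * y.
  rewrite lt_min => h y0 /andP[ae _]; apply: (le_trans h).
  by apply: ler_wpM2r => //; apply: ltW.
have f1n : nrm f1 <= nrm p.1 + 1.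
  rewrite -[f1](subKr p.1); apply: le_trans (nrmD Hp1 (phN Hpf1)) _.
  rewrite nrmN // lerD2l; move: f1e; rewrite lt_min => /andP[_]; exact: ltW.
have f2n : nrm (A f1) <= nrm p.2 + 1.
  rewrite -[A f1](subKr p.2); apply: le_trans (nrmD Hp2 (phN Hpf2)) _.
  rewrite nrmN // lerD2l; move: f2e; rewrite lt_min => /andP[_]; exact: ltW.
rewrite mulrC in i2; rewrite mulrC in i4.
have j1 := bnd _ _ _ i1 (nrm_ge0 _) f1e.
have j2 := bnd _ _ _ i2 (nrm_ge0 _) g2e.
have j3 := bnd _ _ _ i3 (nrm_ge0 _) f2e.
have j4 := bnd _ _ _ i4 (nrm_ge0 _) g1e.
have k2 : e * nrm f1 <= e * (nrm p.1 + 1) by apply: ler_wpM2l => //; apply: ltW.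
have k4 : e * nrm (A f1) <= e * (nrm p.2 + 1) by apply: ler_wpM2l => //; apply: ltW.
lra.
Qed.

End EssentialSelfAdjoint.
End PreHilbert.

(** * Root systems and the cotangent identity *)

Section Dot.
Variables (R : realType) (n : nat).
Implicit Types a b x y : 'rV[R]_n.

Lemma dotvC x y : dotv x y = dotv y x.
Proof. by apply: eq_bigr => i _; rewrite mulrC. Qed.

Lemma dotv_is_linear x : linear (dotv x : 'rV[R]_n -> R^o).
Proof.
move=> c y z; rewrite /dotv scaler_sumr -big_split /=; apply: eq_bigr => i _.
by rewrite !mxE mulrDr mulrCA.
Qed.
HB.instance Definition _ x := GRing.isLinear.Build _ _ _ _ (dotv x : 'rV[R]_n -> R^o)
    (dotv_is_linear x).

Lemma dotvDr x y z : dotv x (y + z) = dotv x y + dotv x z.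
Proof. exact: (raddfD (dotv x)). Qed.
Lemma dotvBr x y z : dotv x (y - z) = dotv x y - dotv x z.
Proof. exact: (raddfB (dotv x)). Qed.
Lemma dotvNr x y : dotv x (- y) = - dotv x y.
Proof. exact: (raddfN (dotv x)). Qed.
Lemma dotvZr c x y : dotv x (c *: y) = c * dotv x y.
Proof. by rewrite mulr_sumr; apply: eq_bigr => i _; rewrite mxE mulrCA. Qed.
Lemma dotv0r x : dotv x 0 = 0.
Proof. exact: (raddf0 (dotv x)). Qed.
Lemma dotv_sumr I (r : seq I) P (F : I -> 'rV[R]_n) x :
  dotv x (\sum_(i <- r | P i) F i) = \sum_(i <- r | P i) dotv x (F i).
Proof. exact: (raddf_sum (dotv x)). Qed.
Lemma dotvDl x y z : dotv (y + z) x = dotv y x + dotv z x.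
Proof. by rewrite !(dotvC _ x) dotvDr. Qed.
Lemma dotvBl x y z : dotv (y - z) x = dotv y x - dotv z x.
Proof. by rewrite !(dotvC _ x) dotvBr. Qed.
Lemma dotvNl x y : dotv (- y) x = - dotv y x.
Proof. by rewrite !(dotvC _ x) dotvNr. Qed.
Lemma dotvZl c x y : dotv (c *: y) x = c * dotv y x.
Proof. by rewrite !(dotvC _ x) dotvZr. Qed.
Lemma dotv0l x : dotv 0 x = 0.
Proof. by rewrite dotvC dotv0r. Qed.

Lemma dotv_ge0 x : 0 <= dotv x x.
Proof. by apply: sumr_ge0 => i _; rewrite -expr2 sqr_ge0. Qed.

Lemma dotv_eq0 x : (dotv x x == 0) = (x == 0).
Proof.
apply/eqP/eqP => [|->]; last exact: dotv0l.
move/psumr_eq0P => h; apply/rowP => i; rewrite mxE.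
have /eqP := h (fun i _ => ltac:(by rewrite -expr2 sqr_ge0)) i isT.
by rewrite mulf_eq0 orbb => /eqP.
Qed.

Lemma dotv_gt0 x : (0 < dotv x x) = (x != 0).
Proof. by rewrite lt0r dotv_ge0 andbT dotv_eq0. Qed.

Lemma dotv_CS x y : dotv x y ^+ 2 <= dotv x x * dotv y y.
Proof.
have [->|y0] := eqVneq y 0; first by rewrite !dotv0r expr0n mulr0.
have yy : 0 < dotv y y by rewrite dotv_gt0.
have := dotv_ge0 (dotv y y *: x - dotv x y *: y).
rewrite dotvBl !dotvBr !dotvZl !dotvZr (dotvC y x) => h.
rewrite -subr_ge0 -(pmulr_rge0 _ yy); apply: le_trans h _.
by rewrite le_eqVlt; apply/orP; left; apply/eqP; ring.
Qed.

Lemma dotv_CS_eq x y : y != 0 -> dotv x y ^+ 2 = dotv x x * dotv y y ->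
  x = (dotv x y / dotv y y) *: y.
Proof.
move=> y0 e; have yy : dotv y y != 0 by rewrite dotv_eq0.
apply/eqP; rewrite -subr_eq0 -dotv_eq0.
rewrite dotvBl !dotvBr !dotvZl !dotvZr (dotvC y x); apply/eqP.
have -> : dotv x x = dotv x y ^+ 2 / dotv y y by rewrite e mulfK.
by field.
Qed.

Lemma dotv_coroot b a : dotv b (coroot a) = 2 * dotv b a / dotv a a.
Proof. by rewrite dotvZr; ring. Qed.

Lemma dotv_reflection a x y : a != 0 -> dotv (reflection a x) (reflection a y) = dotv x y.
Proof.
rewrite -dotv_eq0 => a0; rewrite /reflection !dotv_coroot dotvBl !dotvBr !dotvZl !dotvZr.
by rewrite !(dotvC a); field.
Qed.

Lemma reflectionK a : a != 0 -> involutive (reflection a).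
Proof.
rewrite -dotv_eq0 => a0 x; rewrite /reflection.
rewrite dotvBl dotvZl !dotv_coroot -addrA -opprD -scalerDl.
have -> : 2 * dotv x a / dotv a a +
  (2 * dotv x a / dotv a a - 2 * dotv x a / dotv a a * (2 * dotv a a / dotv a a)) = 0.
  by field.
by rewrite scale0r subr0.
Qed.

Lemma reflection_is_linear a : linear (reflection a).
Proof.
move=> c x y; rewrite /reflection dotvDl dotvZl scalerDl scalerBr scalerA.
by rewrite opprD addrACA.
Qed.
HB.instance Definition _ a := GRing.isLinear.Build _ _ _ _ (reflection a) (reflection_is_linear a).

Lemma dotv_reflectionl a x y : a != 0 -> dotv (reflection a x) y = dotv x (reflection a y).
Proof. by move=> a0; rewrite -{2}(reflectionK a0 x) dotv_reflection. Qed.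

Lemma reflection_self a : a != 0 -> reflection a a = - a.
Proof.
rewrite -dotv_eq0 => a0; rewrite /reflection dotv_coroot mulfK //.
by rewrite scaler_nat mulr2n opprD addrA subrr sub0r.
Qed.

End Dot.

(** * Pairs of roots and sums of products of cotangents *)

Section CotangentIdentity.
Variables (R : realType) (n : nat) (Phi : {fset 'rV[R]_n}) (k : 'rV[R]_n -> R).
Hypotheses (rs : reduced_crystallographic_root_system Phi)
  (k_inv : forall w a, weyl Phi w -> a \in Phi -> k (w a) = k a).
Implicit Types a b : 'rV[R]_n.

Lemma root_neq0 a : a \in Phi -> a != 0.
Proof. by move=> aP; apply: contraNneq (roots_neq0 rs) => <-. Qed.

Lemma root_opp a : a \in Phi -> - a \in Phi.
Proof. by move=> aP; rewrite -reflection_self ?root_neq0 // roots_reflection. Qed.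

Lemma root_oppE a : (- a \in Phi) = (a \in Phi).
Proof. by apply/idP/idP => /root_opp; rewrite ?opprK. Qed.

Lemma k_reflection a b : a \in Phi -> b \in Phi -> k (reflection a b) = k b.
Proof.
move=> aP bP; rewrite -(k_inv (weyl_reflection aP (weyl_id _)) bP) //.
Qed.

Lemma k_opp a : a \in Phi -> k (- a) = k a.
Proof. by move=> aP; rewrite -(k_reflection aP aP) reflection_self ?root_neq0. Qed.

Definition cartan b a : R := dotv b (coroot a).

Lemma cartanE b a : a \in Phi -> cartan b a * dotv a a = 2 * dotv b a.
Proof.
move=> aP; rewrite /cartan dotv_coroot mulfVK // dotv_eq0; exact: root_neq0.
Qed.

Lemma cartan_int a b : a \in Phi -> b \in Phi -> exists z : int, cartan b a = z%:~R.
Proof.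
by move=> aP bP; have /intrP[z e] := roots_crystallographic rs aP bP; exists z.
Qed.

Lemma norm_root_gt0 a : a \in Phi -> 0 < dotv a a.
Proof. by move=> aP; rewrite dotv_gt0 root_neq0. Qed.

(** The product of the two Cartan integers is [4 cos ^ 2] of the angle. It is below [4], because
    equality in Cauchy-Schwarz would make the roots proportional, hence equal or opposite as [Phi]
    is reduced. The two integers vanish together and otherwise have the same sign, which leaves
    finitely many cases. *)
Lemma cartan_cases a b : a \in Phi -> b \in Phi -> b != a -> b != - a ->
  exists2 z : int * int, cartan a b = z.1%:~R /\ cartan b a = z.2%:~R &
    z \in [:: (0, 0); (1, 1); (1, 2); (1, 3); (2, 1); (3, 1);
      (-1, -1); (-1, -2); (-1, -3); (-2, -1); (-3, -1)].
Proof.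
move=> aP bP ba bNa.
have aa := norm_root_gt0 aP; have bb := norm_root_gt0 bP.
have [z1 E1] := cartan_int bP aP; have [z2 E2] := cartan_int aP bP.
have e1 := cartanE a bP; have e2 := cartanE b aP.
rewrite (dotvC b a) in e2.
have lt4 : cartan a b * cartan b a < 4.
  have : dotv a b ^+ 2 < dotv a a * dotv b b.
    rewrite lt_neqAle dotv_CS andbT; apply/eqP => /(dotv_CS_eq (root_neq0 bP)) ab.
    have := aP; rewrite ab => /(roots_reduced rs bP)[] c1; move: ab; rewrite c1.
      by rewrite scale1r => /esym/eqP; apply/negP.
    by rewrite scaleN1r => /(congr1 -%R); rewrite opprK => /esym/eqP; apply/negP.
  move=> h; rewrite -(ltr_pM2r (mulr_gt0 aa bb)).
  have -> : cartan a b * cartan b a * (dotv a a * dotv b b) =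
    (cartan a b * dotv b b) * (cartan b a * dotv a a) by ring.
  by rewrite e1 e2; lra.
have z0 : (z1 == 0) = (z2 == 0).
  rewrite -(intr_eq0 R z1) -(intr_eq0 R z2) -E1 -E2.
  rewrite -(mulIr_eq0 _ (mulIf (lt0r_neq0 bb))) -(mulIr_eq0 (cartan b a) (mulIf (lt0r_neq0 aa))).
  by rewrite e1 e2.
exists (z1, z2) => //.
have [z10|z1n0] := eqVneq z1 0.
  by move: z0; rewrite z10 eqxx => /esym/eqP ->.
have z2n0 : z2 != 0 by rewrite -z0.
have pos : 0 < z1 * z2.
  rewrite -(ltr_int R) intrM -E1 -E2 -(pmulr_lgt0 _ (mulr_gt0 aa bb)).
  have -> : cartan a b * cartan b a * (dotv a a * dotv b b) =
    (cartan a b * dotv b b) * (cartan b a * dotv a a) by ring.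
  rewrite e1 e2 -expr2 exprn_even_gt0 //= mulf_eq0 negb_or pnatr_eq0 /=.
  apply: contra z1n0 => /eqP ab; move: e1; rewrite ab E1 mulr0 => /eqP.
  by rewrite mulf_eq0 (gt_eqF bb) orbF intr_eq0.
have : z1 * z2 < 4 by rewrite -(ltr_int R) intrM -E1 -E2.
move: z1n0 z2n0 pos; clear.
case: z1 => [[|[|[|[|x]]]]|[|[|[|x]]]] //; case: z2 => [[|[|[|[|y]]]]|[|[|[|y]]]] // _ _ h1 h2.
all: exfalso; lia.
Qed.

Lemma sum_involution (T : eqType) (s : seq T) (h : T -> T) (f : T -> R) :
  uniq s -> {in s, forall x, h x \in s} -> {in s, forall x, h (h x) = x} ->
  \sum_(x <- s) f (h x) = \sum_(x <- s) f x.
Proof.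
move=> us hs hK; rewrite -(big_map h xpredT f); apply: perm_big.
have hI : {in s &, injective h} by move=> x y xs ys e; rewrite -(hK x) // e hK.
apply: uniq_perm => //; first by rewrite map_inj_in_uniq.
move=> x; apply/mapP/idP => [[y ys ->]|xs]; first exact: hs.
by exists (h x); [exact: hs|rewrite hK].
Qed.

Definition root_pairs : seq ('rV[R]_n * 'rV[R]_n) := [seq (a, b) | a <- Phi, b <- Phi].

(* Pairs at an acute angle with [|x.2|^2 = m |x.1|^2]; for [m = 1, 2, 3] they exhaust, up to
   signs and order, the pairs of roots that are neither proportional nor orthogonal. *)
Definition pairsof m := [seq x <- root_pairs | (cartan x.1 x.2 == 1) && (cartan x.2 x.1 == m%:R)].

Definition pair_weight (x : 'rV[R]_n * 'rV[R]_n) : R := k x.1 * k x.2 * dotv x.1 x.2.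

Lemma root_pairs_uniq : uniq root_pairs.
Proof. by apply: allpairs_uniq; [exact: fset_uniq|exact: fset_uniq|move=> [a b] [c d]]. Qed.

Lemma root_pairsP a b : ((a, b) \in root_pairs) = (a \in Phi) && (b \in Phi).
Proof.
apply/allpairsP/andP => [[[x y] [xP yP [-> ->]]]//|[aP bP]]; by exists (a, b).
Qed.

Lemma pairsofP m a b : reflect [/\ a \in Phi, b \in Phi, dotv b b = 2 * dotv a b &
    m%:R * dotv a a = 2 * dotv a b] ((a, b) \in pairsof m).
Proof.
rewrite mem_filter root_pairsP /=; apply: (iffP idP).
  move=> /andP[/andP[/eqP h1 /eqP h2] /andP[aP bP]]; split=> //.
    by rewrite -(cartanE a bP) h1 mul1r.
  by rewrite (dotvC a b) -(cartanE b aP) h2.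
move=> [aP bP h1 h2]; rewrite aP bP !andbT.
have aa := lt0r_neq0 (norm_root_gt0 aP); have bb := lt0r_neq0 (norm_root_gt0 bP).
apply/andP; split; apply/eqP.
  by apply: (mulIf bb); rewrite cartanE // mul1r.
by apply: (mulIf aa); rewrite cartanE // h2 (dotvC a b).
Qed.

Lemma pairs_reflection m a b : (a, b) \in pairsof m ->
  reflection b a = a - b /\ reflection a b = b - m%:R *: a.
Proof.
move=> /pairsofP[aP bP h1 h2].
have aa := lt0r_neq0 (norm_root_gt0 aP); have bb := lt0r_neq0 (norm_root_gt0 bP).
rewrite /reflection !dotv_coroot (dotvC b a) -{1}h1 -h2 !mulfK //.
by rewrite divff // scale1r.
Qed.

(** [b - a] is the opposite of the reflection of [a] in [b]: lengths, the acute angle and the values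
    of [k] are preserved. *)
Lemma pairs_invol1 m a b : (a, b) \in pairsof m ->
  (b - a, b) \in pairsof m /\ pair_weight (b - a, b) = pair_weight (a, b).
Proof.
move=> ab; have [r1 _] := pairs_reflection ab.
have /pairsofP[aP bP h1 h2] := ab.
have baE : b - a = - reflection b a by rewrite r1 opprB.
have raP : reflection b a \in Phi by apply: roots_reflection.
split.
  apply/pairsofP; split=> //; first by rewrite baE root_opp.
    by rewrite dotvBl; lra.
  have -> : dotv (b - a) (b - a) = dotv a a.
    by rewrite dotvBl !dotvBr (dotvC b a) h1; ring.
  by rewrite h2 dotvBl h1; ring.
rewrite /pair_weight /= {1}baE k_opp // k_reflection // dotvBl.
by congr (_ * _); lra.
Qed.

(** The companion involution, which fixes [a] and replaces [b] by the opposite of its reflection in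
    [a]. All relations between the sums below come from these two symmetries of the rank two system
    of [a] and [b], of type A2, B2 or G2 for [m = 1, 2, 3]. *)
Lemma pairs_invol2 m a b : (a, b) \in pairsof m ->
  (a, m%:R *: a - b) \in pairsof m /\ pair_weight (a, m%:R *: a - b) = pair_weight (a, b).
Proof.
move=> ab; have [_ r2] := pairs_reflection ab.
have /pairsofP[aP bP h1 h2] := ab.
have baE : m%:R *: a - b = - reflection a b by rewrite r2 opprB.
have raP : reflection a b \in Phi by apply: roots_reflection.
split.
  apply/pairsofP; split=> //; first by rewrite baE root_opp.
    by rewrite baE dotvNl !dotvNr dotv_reflection ?root_neq0 // opprK r2 dotvBr dotvZr; lra.
  by rewrite dotvBr dotvZr; lra.
rewrite /pair_weight /= {1}baE k_opp // k_reflection // dotvBr dotvZr.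
by congr (_ * _); lra.
Qed.

Lemma pairsof_uniq m : uniq (pairsof m).
Proof. exact/filter_uniq/root_pairs_uniq. Qed.

Lemma sum_pairs1 m (f : 'rV[R]_n -> 'rV[R]_n -> R) :
  \sum_(x <- pairsof m) pair_weight x * f (x.2 - x.1) x.2 =
  \sum_(x <- pairsof m) pair_weight x * f x.1 x.2.
Proof.
rewrite -[RHS](sum_involution (h := fun x => (x.2 - x.1, x.2))) ?pairsof_uniq //.
- by apply: eq_big_seq => -[a b] /pairs_invol1[_ ->].
- by move=> [a b] /pairs_invol1[].
- by move=> [a b] _ /=; rewrite subKr.
Qed.

Lemma sum_pairs2 m (f : 'rV[R]_n -> 'rV[R]_n -> R) :
  \sum_(x <- pairsof m) pair_weight x * f x.1 (m%:R *: x.1 - x.2) =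
  \sum_(x <- pairsof m) pair_weight x * f x.1 x.2.
Proof.
rewrite -[RHS](sum_involution (h := fun x => (x.1, m%:R *: x.1 - x.2))) ?pairsof_uniq //.
- by apply: eq_big_seq => -[a b] /pairs_invol2[_ ->].
- by move=> [a b] /pairs_invol2[].
- by move=> [a b] _ /=; rewrite subKr.
Qed.

Section Cot.
Variable c : 'rV[R]_n -> R.
Hypotheses (cN : forall a, a \in Phi -> c (- a) = - c a)
  (cD : forall a b, a \in Phi -> b \in Phi -> a + b \in Phi ->
     c a * c b - 1 = c (a + b) * (c a + c b)).

Let S m := \sum_(x <- pairsof m) pair_weight x * (c x.1 * c x.2).
Let W m := \sum_(x <- pairsof m) pair_weight x.

(** Average the summand over the first involution, which fixes [b] and exchanges [a] with [b - a].
    As these two roots add up to [b], the addition formula turns [c b * (c a + c (b - a))] into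
    [c a * c (b - a) - 1]. *)
Lemma sum_pairs_reflect m :
  2 * (S m + W m) = W m + \sum_(x <- pairsof m) pair_weight x * (c x.1 * c (x.2 - x.1)).
Proof.
have e1 : S m + W m = \sum_(x <- pairsof m) pair_weight x * (c x.1 * c x.2 + 1).
  by rewrite -big_split; apply: eq_bigr => x _ /=; ring.
have e2 : S m + W m = \sum_(x <- pairsof m) pair_weight x * (c (x.2 - x.1) * c x.2 + 1).
  by rewrite (sum_pairs1 m (fun a b => c a * c b + 1)).
rewrite mulr2n mulrDl mul1r {1}e1 e2 -!big_split /=.
apply: eq_big_seq => -[a b] ab /=.
have [/pairsofP[baP _ _ _] _] := pairs_invol1 ab.
have /pairsofP[aP bP _ _] := ab.
have := @cD a (b - a) aP baP; rewrite [a + _]addrC subrK => /(_ bP).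
set x := c a; set y := c b; set z := c (b - a) => h.
have -> : z * y = x * z - 1 - y * x by rewrite h; ring.
by ring.
Qed.

(** The second involution sends [b] to [a - b], so the sum left over in [sum_pairs_reflect] is
    [- S 1] because [c] is odd. *)
Lemma sum_pairs_1 : S 1 = - W 1 / 3.
Proof.
have := sum_pairs_reflect 1.
have -> : \sum_(x <- pairsof 1) pair_weight x * (c x.1 * c (x.2 - x.1)) = - S 1.
  rewrite /S -(sum_pairs2 1 (fun a b => c a * c b)) -sumrN; apply: eq_big_seq => -[a b] ab /=.
  have [/pairsofP[_ abP _ _] _] := pairs_invol2 ab; move: abP; rewrite scale1r => abP.
  by rewrite -opprB cN //; ring.
by lra.
Qed.

(** Here the second involution sends [b - a] to [a - b]; the sum left over is its own opposite and
    vanishes. *)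
Lemma sum_pairs_2 : S 2 = - W 2 / 2.
Proof.
have := sum_pairs_reflect 2.
set U := \sum_(x <- pairsof 2) pair_weight x * (c x.1 * c (x.2 - x.1)).
have : U = - U.
  rewrite {1}/U -(sum_pairs2 2 (fun a b => c a * c (b - a))) -sumrN; apply: eq_big_seq => -[a b] ab /=.
  have [/pairsofP[baP _ _ _] _] := pairs_invol1 ab.
  rewrite scaler_nat mulr2n addrAC addrK -opprB cN //; ring.
by lra.
Qed.

(** In G2 the short roots [a] and [b - 2 a] add up to the short root [b - a]. The addition formula
    for this second triple relates three products, and the involutions show that each of them sums
    to the same [U] up to sign; hence [3 U = - W 3]. *)
Lemma sum_pairs_3 : S 3 = - 2 / 3 * W 3.
Proof.
have := sum_pairs_reflect 3.
set U := \sum_(x <- pairsof 3) pair_weight x * (c x.1 * c (x.2 - x.1)).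
have e2 : \sum_(x <- pairsof 3) pair_weight x * (c x.1 * c (2 *: x.1 - x.2)) = U.
  rewrite /U -(sum_pairs2 3 (fun a b => c a * c (b - a))); apply: eq_big_seq => -[a b] ab /=.
  by rewrite addrAC !scaler_nat [a *+ 3]mulrSr addrK.
have e3 : \sum_(x <- pairsof 3) pair_weight x * (c (x.2 - x.1) * c (x.2 - 2 *: x.1)) = U.
  rewrite -e2 -(sum_pairs1 3 (fun a b => c a * c (2 *: a - b))); apply: eq_big_seq => -[a b] ab /=.
  by congr (_ * (_ * c _)); rewrite scalerBr !scaler_nat addrAC [b *+ 2]mulr2n addrK.
have : U + U + U = - W 3.
  rewrite -{2}e2 -{2}e3 /U /W -!big_split -sumrN /=; apply: eq_big_seq => -[a b] ab /=.
  have [ab1 _] := pairs_invol1 ab; have /pairsofP[baP _ _ _] := ab1.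
  have [ab2 _] := pairs_invol2 ab; have [ab3 _] := pairs_invol1 ab2.
  have /pairsofP[aP bP _ _] := ab; have /pairsofP[h3 _ _ _] := ab3.
  have e : 3%:R *: a - b - a = 2 *: a - b.
    by rewrite addrAC !scaler_nat [a *+ 3]mulrSr addrK.
  rewrite /= e in h3; have h4 := root_opp h3; rewrite opprB in h4.
  have := @cD a (b - 2 *: a) aP h4.
  have -> : a + (b - 2 *: a) = b - a by rewrite scaler_nat mulr2n opprD addrCA [a + _]addrA subrr sub0r.
  move=> /(_ baP); rewrite -[2 *: a - b]opprB cN //.
  set x := c a; set y := c (b - a); set z := c (_ - _ *: a) => h.
  have -> : y * z = x * z - 1 - y * x by rewrite h; ring.
  by ring.
by lra.
Qed.

(** Up to the sign of [b] and the order, every pair that is neither proportional nor orthogonal lies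
    in one of the three families, so the double sum equals [2 * (S 1 + 2 * S 2 + 2 * S 3)]. *)
Lemma sum_root_pairs :
  \sum_(a <- Phi) \sum_(b <- Phi | (b != a) && (b != - a)) k a * k b * dotv a b * (c a * c b)
  = - 2 / 3 * W 1 - 2 * W 2 - 8 / 3 * W 3.
Proof.
pose g x := pair_weight x * (c x.1 * c x.2).
pose ind m x := if x \in pairsof m then g x else 0.
(* Pairs of equal length occur in [pairsof 1] in both orders, whereas [pairsof 2] and [pairsof 3]
   list the shorter root first; hence the swapped terms. *)
pose f x := ind 1%N x + (ind 2%N x + ind 2%N (x.2, x.1) + (ind 3%N x + ind 3%N (x.2, x.1))).
have gC a b : g (b, a) = g (a, b) by rewrite /g /pair_weight /= dotvC; ring.
have gN a b : b \in Phi -> g (a, - b) = g (a, b).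
  by move=> bP; rewrite /g /pair_weight /= dotvNr k_opp // cN //; ring.
have indE m a b (z : int * int) : a \in Phi -> b \in Phi ->
    cartan a b = z.1%:~R -> cartan b a = z.2%:~R ->
    ind m (a, b) = if (z.1 == 1) && (z.2 == m%:Z) then g (a, b) else 0.
  move=> aP bP e1 e2; rewrite /ind mem_filter root_pairsP aP bP /= andbT e1 e2.
  by rewrite -(eqr_int R) -[z.2 == _](eqr_int R).
(* When [a] and [b] are not orthogonal, exactly one of [b] and [- b] makes an acute angle with [a],
   and [g] is even in [b]. Equal or opposite roots, with Cartan integers [2] or [-2], give [0]. *)
have fE a b (z : int * int) : a \in Phi -> b \in Phi ->
    cartan a b = z.1%:~R -> cartan b a = z.2%:~R ->
    f (a, b) + f (a, - b) =
     (if (z == (1, 1)) || (z == (-1, -1)) || (z \in [:: (1, 2); (2, 1); (-1, -2); (-2, -1)])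
      || (z \in [:: (1, 3); (3, 1); (-1, -3); (-3, -1)]) then g (a, b) else 0).
  move=> aP bP e1 e2; rewrite /f /=.
  rewrite !(indE _ a b z) // !(indE _ b a (z.2, z.1)) //.
  have NbP := root_opp bP.
  have e3 : cartan a (- b) = (- z.1)%:~R.
    by rewrite intrN -e1 /cartan !dotv_coroot dotvNr dotvNl dotvNr opprK; ring.
  have e4 : cartan (- b) a = (- z.2)%:~R.
    by rewrite intrN -e2 /cartan !dotv_coroot dotvNl; ring.
  rewrite !(indE _ a (- b) (- z.1, - z.2)) // !(indE _ (- b) a (- z.2, - z.1)) //=.
  rewrite !(gC a) gN //; case: z {e1 e2 e3 e4} => z1 z2 /=.
  rewrite !inE !xpair_eqE; clear.
  have H (p q : bool) x : (if p then x else 0) = x *+ p :> R by case: p.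
  by case: z1 => [[|[|[|[|x]]]]|[|[|[|x]]]]; case: z2 => [[|[|[|[|y]]]]|[|[|[|y]]]] //=;
    rewrite ?addr0 ?add0r.
have -> : \sum_(a <- Phi) \sum_(b <- Phi | (b != a) && (b != - a))
     k a * k b * dotv a b * (c a * c b) =
   \sum_(a <- Phi) \sum_(b <- Phi) (f (a, b) + f (a, - b)).
  apply: eq_big_seq => a aP; rewrite big_mkcond; apply: eq_big_seq => b bP.
  have cs : cartan a a = 2%:~R by rewrite /cartan dotv_coroot mulfK ?dotv_eq0 ?root_neq0.
  have [->|ba] /= := eqVneq b a; first by rewrite (fE a a (2, 2)).
  have [->|bNa] /= := eqVneq b (- a).
    rewrite (fE a (- a) (-2, -2)) ?root_opp // ?intrN -cs /cartan ?dotvNl //.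
    by rewrite !dotv_coroot dotvNr dotvNl dotvNr opprK; ring.
  have [z [z1 z2] zs] := cartan_cases aP bP ba bNa.
  rewrite (fE a b z) //; move: zs z1 z2; rewrite !inE.
  move=> /orP[/eqP ->|h] z1 z2.
    have : dotv a b = 0 by have := cartanE a bP; rewrite z1 mul0r; lra.
    by rewrite /g /pair_weight /= => ->; rewrite mulr0 mul0r.
  rewrite (_ : _ || _ = true) //.
  by move: h; do !(move=> /orP[/eqP -> //|]); move/eqP => ->.
have -> : \sum_(a <- Phi) \sum_(b <- Phi) (f (a, b) + f (a, - b)) =
   2 * \sum_(a <- Phi) \sum_(b <- Phi) f (a, b).
  rewrite mulr_sumr; apply: eq_bigr => a _; rewrite big_split /=.
  rewrite (sum_involution (h := -%R) (fun b => f (a, b))) ?fset_uniq ?mulr2n ?mulrDl ?mul1r //.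
    by move=> b bP; rewrite root_oppE.
  by move=> b _; rewrite opprK.
have indS m : \sum_(a <- Phi) \sum_(b <- Phi) ind m (a, b) = S m.
  have -> : S m = \sum_(x <- root_pairs) ind m x.
    rewrite /S /pairsof big_filter big_mkcond; apply: eq_big_seq => x xr.
    by rewrite /ind mem_filter xr andbT.
  by rewrite /root_pairs big_allpairs.
have indS' m : \sum_(a <- Phi) \sum_(b <- Phi) ind m (b, a) = S m.
  by rewrite exchange_big /= indS.
have -> : \sum_(a <- Phi) \sum_(b <- Phi) f (a, b) = S 1 + (S 2 + S 2 + (S 3 + S 3)).
  rewrite -{1}(indS 1%N) -{1}(indS 2%N) -{1}(indS 3%N) -(indS' 2%N) -(indS' 3%N).
  rewrite -!big_split /=; apply: eq_bigr => a _.
  by rewrite -!big_split /=.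
by rewrite sum_pairs_1 sum_pairs_2 sum_pairs_3; field.
Qed.

End Cot.

End CotangentIdentity.

(** * The Weyl group, weights in a ball and a basis of the coroot lattice *)

Section RootStructure.
Variables (R : realType) (n : nat) (Phi : {fset 'rV[R]_n}).
Hypothesis rs : reduced_crystallographic_root_system Phi.
Implicit Types a b x y : 'rV[R]_n.

Lemma ortho_roots x : (forall a, a \in Phi -> dotv x a = 0) -> x = 0.
Proof.
move=> h; apply/eqP; rewrite -dotv_eq0.
have : x \in (<<in_tuple Phi>>)%VS by rewrite (roots_span rs) memvf.
move=> /coord_span {2}->; rewrite dotv_sumr big1 // => i _.
by rewrite dotvZr h ?mulr0 //; apply: mem_nth.
Qed.

Lemma weyl_linear w : weyl Phi w -> linear w.
Proof.
elim=> [|a {}w aP _ lw] c x y //.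
by rewrite /comp lw linearP.
Qed.

Lemma weylD w x y : weyl Phi w -> w (x + y) = w x + w y.
Proof. by move=> /weyl_linear lw; have := lw 1 x y; rewrite !scale1r. Qed.

Lemma weyl0 w : weyl Phi w -> w 0 = 0.
Proof.
move=> /weylD-/(_ 0 0); rewrite addr0 => /eqP; rewrite -subr_eq0 opprD addrA.
by rewrite subrr sub0r oppr_eq0 => /eqP.
Qed.

Lemma weylZ w c x : weyl Phi w -> w (c *: x) = c *: w x.
Proof. by move=> ww; have := weyl_linear ww c x 0; rewrite (weyl0 ww) !addr0. Qed.

Lemma weylN w x : weyl Phi w -> w (- x) = - w x.
Proof. by move=> ww; rewrite -scaleN1r weylZ // scaleN1r. Qed.

Lemma weylB w x y : weyl Phi w -> w (x - y) = w x - w y.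
Proof. by move=> ww; rewrite weylD // weylN. Qed.

Lemma weyl_dotv w x y : weyl Phi w -> dotv (w x) (w y) = dotv x y.
Proof.
move=> ww; elim: ww x y => [|a {}w aP _ lw] x y //.
by rewrite /comp dotv_reflection ?lw //; apply: (root_neq0 rs).
Qed.

Lemma weyl_root w a : weyl Phi w -> a \in Phi -> w a \in Phi.
Proof.
by elim=> [|b {}w bP _ lw] // aP; apply: (roots_reflection rs) => //; exact: lw.
Qed.

Lemma weyl_comp w1 w2 : weyl Phi w1 -> weyl Phi w2 -> weyl Phi (w1 \o w2).
Proof. by elim=> [|b w bP _ lw] // ww2; exact: weyl_reflection (lw ww2). Qed.

Lemma weyl_refl a : a \in Phi -> weyl Phi (reflection a).
Proof. by move=> aP; apply: (weyl_reflection aP (weyl_id _)). Qed.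

Lemma weyl_inv w : weyl Phi w -> exists w', [/\ weyl Phi w', cancel w w' & cancel w' w].
Proof.
elim=> [|a {}w aP _ [w' [ww' c1 c2]]].
  by exists id; split=> //; exact: weyl_id.
have a0 := root_neq0 rs aP.
exists (w' \o reflection a); split.
- by apply: weyl_comp => //; exact: weyl_refl.
- by move=> x; rewrite /= reflectionK.
- by move=> x; rewrite /= c2 reflectionK.
Qed.

Lemma weyl_coroot w a : weyl Phi w -> coroot (w a) = w (coroot a).
Proof. by move=> ww; rewrite /coroot weyl_dotv // weylZ. Qed.

Lemma weyl_weight w l : weyl Phi w -> weight_lattice Phi l -> weight_lattice Phi (w l).
Proof.
move=> ww Pl a aP; have [w' [ww' c1 c2]] := weyl_inv ww.
rewrite -(c2 a) weyl_coroot // weyl_dotv //; apply: Pl; exact: weyl_root.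
Qed.

Lemma coroot_lattice_coroot a : a \in Phi -> coroot_lattice Phi (coroot a).
Proof.
move=> aP; exists (fun b => (b == a)%:Z); rewrite (big_fsetD1 a) //= eqxx mulr1z.
by rewrite big1_fset ?addr0 // => b; rewrite !inE => /andP[/negPf -> _].
Qed.

Lemma coroot_lattice_ind (P : 'rV[R]_n -> Prop) : P 0 ->
  (forall x y, P x -> P y -> P (x - y)) -> (forall a, a \in Phi -> P (coroot a)) ->
  forall x, coroot_lattice Phi x -> P x.
Proof.
move=> P0 PB Pc x [c ->].
have PN y : P y -> P (- y) by move=> Py; rewrite -sub0r; exact: PB.
have PD y z : P y -> P z -> P (y + z) by move=> Py Pz; rewrite -[z]opprK; apply: PB => //; apply: PN.
rewrite big_seq; apply: (big_ind P) => // a aP.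
have Pn m : P (coroot a *+ m).
  by elim: m => [|m IH]; rewrite ?mulr0n // mulrS; apply: PD => //; exact: Pc.
by case: (c a) => m; [exact: Pn|rewrite NegzE mulrNz; apply: PN; exact: Pn].
Qed.

Lemma coroot_latticeB x y : coroot_lattice Phi x -> coroot_lattice Phi y -> coroot_lattice Phi (x - y).
Proof.
move=> [c ->] [d ->]; exists (fun a => c a - d a).
by rewrite -sumrB; apply: eq_bigr => a _; rewrite mulrzBr.
Qed.

Lemma coroot_lattice0 : coroot_lattice Phi 0.
Proof. by exists (fun=> 0); rewrite big1 // => a _; rewrite mulr0z. Qed.

Lemma weyl_coroot_lattice w x : weyl Phi w -> coroot_lattice Phi x -> coroot_lattice Phi (w x).
Proof.
move=> ww; apply: (coroot_lattice_ind (P := fun x => coroot_lattice Phi (w x))).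
- by rewrite weyl0 //; exact: coroot_lattice0.
- by move=> y z; rewrite weylB //; exact: coroot_latticeB.
- by move=> a aP; rewrite -weyl_coroot //; apply/coroot_lattice_coroot/weyl_root.
Qed.

Lemma weight_coroot_lattice l x : weight_lattice Phi l -> coroot_lattice Phi x ->
  dotv l x \is a Num.int.
Proof.
move=> Pl; apply: (coroot_lattice_ind (P := fun x => dotv l x \is a Num.int)) => [|y z h1 h2|a aP].
- by rewrite dotv0r.
- by rewrite dotvBr rpredB.
- exact: Pl.
Qed.

Lemma weyl_ext w1 w2 : weyl Phi w1 -> weyl Phi w2 ->
  {in Phi, w1 =1 w2} -> w1 = w2.
Proof.
move=> ww1 ww2 e; apply/funext => x; apply/eqP; rewrite -subr_eq0; apply/eqP.
have [w' [ww' c1 c2]] := weyl_inv ww1.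
apply: ortho_roots => a aP; rewrite -(c2 a) dotvBl.
have w'a : w' a \in Phi by exact: weyl_root.
by rewrite weyl_dotv // e // weyl_dotv // subrr.
Qed.

(** The roots span, so an element of W is determined by the self-map of the finite set [Phi] that it
    induces. The injection [s] is right translation by a reflection, which is what averaging over W
    requires. *)
Lemma weyl_enum : exists (I : finType) (w_ : I -> 'rV[R]_n -> 'rV[R]_n),
  [/\ (0 < #|I|)%N, forall i, weyl Phi (w_ i) &
      forall a, a \in Phi -> exists2 s : I -> I, injective s &
        forall i, w_ i \o reflection a = w_ (s i)].
Proof.
pose J (f : {ffun Phi -> Phi}) w := weyl Phi w /\ forall a : Phi, w (val a) = val (f a).
pose I := {f : {ffun Phi -> Phi} | `[< exists w, J f w >]}.
have wI (i : I) : exists w, J (val i) w by apply/asboolP; exact: (valP i).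
pose w_ (i : I) := projT1 (cid (wI i)).
have w_P (i : I) : J (val i) (w_ i) by rewrite /w_; case: cid.
have mkI w : weyl Phi w -> exists i : I, w_ i = w.
  move=> ww.
  pose f := [ffun a : Phi => [` weyl_root ww (valP a)]%fset].
  have fP : `[< exists w, J f w >].
    by apply/asboolP; exists w; split=> // a; rewrite ffunE.
  exists (exist _ f fP); have [h1 h2] := w_P (exist _ f fP).
  by apply: weyl_ext => // a aP; rewrite (h2 [` aP]%fset) /= ffunE.
exists I, w_; split.
- have [i _] := mkI _ (weyl_id Phi); by apply/card_gt0P; exists i.
- by move=> i; case: (w_P i).
- move=> a aP.
  have wa (i : I) : weyl Phi (w_ i \o reflection a).
    by apply: weyl_comp (weyl_refl aP); case: (w_P i).
  pose s i := projT1 (cid (mkI _ (wa i))).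
  have sP i : w_ (s i) = w_ i \o reflection a by rewrite /s; case: cid.
  have a0 := root_neq0 rs aP.
  exists s => // i j sij; have e : w_ i = w_ j.
    apply/funext => x; have := sP i; rewrite sij sP => /(congr1 (fun f => f (reflection a x))).
    by rewrite /= reflectionK.
  apply/val_inj/ffunP => b; apply/val_inj.
  by case: (w_P i) => _ <-; case: (w_P j) => _ <-; rewrite e.
Qed.

Lemma coroot_dual x : (forall a, a \in Phi -> dotv x (coroot a) = 0) -> x = 0.
Proof.
move=> h; apply: ortho_roots => a aP.
have aa : dotv a a != 0 by rewrite dotv_eq0 (root_neq0 rs).
by have := h _ aP; rewrite dotv_coroot => /eqP; rewrite !mulf_eq0 invr_eq0 pnatr_eq0 /= (negPf aa)
    orbF => /eqP.
Qed.

(** A weight is determined by its integer pairings with the coroots, and on a ball these are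
    bounded. *)
Lemma weight_ball_finite (N : R) : exists s : {fset 'rV[R]_n},
  forall l, l \in s <-> weight_lattice Phi l /\ dotv l l <= N.
Proof.
pose A := [set l | weight_lattice Phi l /\ dotv l l <= N].
suff finA : finite_set A.
  exists (fset_set A) => l; rewrite in_fset_set //.
  by split => [/set_mem//|h]; apply/mem_set.
have [N0|N0] := ltP N 0.
  rewrite (_ : A = set0) //; apply/seteqP; split=> // l [_ /le_lt_trans/(_ N0)].
  by rewrite ltNge dotv_ge0.
(* By Cauchy-Schwarz every [dotv l (coroot a) ^ 2] is at most [T]; the summand [1] gives
   [T <= T ^ 2], so that [T] bounds the absolute values as well. The pairings are then coded in
   ['I_(M + M)] after a shift by [M]. *)
pose T := \sum_(a <- Phi) dotv (coroot a) (coroot a) * N + 1.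
have T1 : 1 <= T by rewrite lerDr sumr_ge0 // => a _; rewrite mulr_ge0 // dotv_ge0.
pose M := (Num.truncn T).+1.
have MT : T < M%:R by rewrite truncnS_gt.
pose g (f : {ffun Phi -> 'I_(M + M)}) :=
  xget 0 [set l : 'rV[R]_n | forall a : Phi, dotv l (coroot (val a)) = (f a)%:R - M%:R].
apply: (@sub_finite_set _ _ (g @` setT)); last exact/finite_image/finite_finset.
move=> l [Pl lN].
have bnd a : a \in Phi -> `|dotv l (coroot a)| < M%:R.
  move=> aP; apply: le_lt_trans MT; rewrite -ler_sqr ?nnegrE //; last exact: le_trans T1.
  rewrite real_normK ?num_real //; apply: le_trans (dotv_CS _ _) _.
  apply: le_trans (_ : T <= _); last by rewrite expr2 ler_peMl // (le_trans _ T1).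
  rewrite /T (big_fsetD1 a) //= -addrA ler_wpDr //.
    by rewrite addr_ge0 // sumr_ge0 // => b _; rewrite mulr_ge0 // dotv_ge0.
  by rewrite mulrC ler_wpM2l // dotv_ge0.
have hz (a : Phi) : exists i : 'I_(M + M), dotv l (coroot (val a)) = i%:R - M%:R.
  have /intrP[z zE] := Pl _ (valP a).
  have := bnd _ (valP a); rewrite zE -intr_norm pmulrn ltr_int => zM.
  have lt : (`|(z + M%:Z)%R| < M + M)%N by lia.
  exists (Ordinal lt) => /=; rewrite pmulrn abszE ger0_norm ?intrD ?addrK //; lia.
pose f := [ffun a : Phi => projT1 (cid (hz a))].
exists f => //; rewrite /g; case: xgetP => [y _ /= yE|/(_ l)[] a].
  apply/eqP; rewrite -subr_eq0; apply/eqP; apply: coroot_dual => a aP.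
  rewrite dotvBl (yE [` aP]%fset) ffunE /=; case: cid => i /= <-.
  by rewrite subrr.
by rewrite ffunE; case: cid.
Qed.

(** The rows of [B] are a Z-basis of the coroot lattice. The pairings of all coroots with [n]
    independent roots form an integer matrix of full rank, whose Smith normal form provides the
    basis. *)
Lemma coroot_basis : exists B : 'M[R]_n, [/\ B \in unitmx,
  forall z : 'rV[int]_n, coroot_lattice Phi (map_mx intr z *m B) &
  forall a, a \in Phi -> exists z : 'rV[int]_n, coroot a = map_mx intr z *m B].
Proof.
pose m := size Phi; pose r (i : 'I_m) := Phi`_i.
have rP i : r i \in Phi by apply: mem_nth.
have rE a : a \in Phi -> exists i, a = r i.
  move=> aP; have lt : (index a Phi < m)%N by rewrite index_mem.
  by exists (Ordinal lt); rewrite /r /= nth_index.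
have dotE x y : (x *m y^T) 0 0 = dotv x y.
  by rewrite mxE; apply: eq_bigr => i _; rewrite mxE.
pose A0 : 'M[R]_(m, n) := \matrix_i r i.
have full : row_full A0.
  rewrite /row_full -mxrank_tr -/(row_free _) -kermx_eq0; apply/eqP/row_matrixP => i.
  rewrite row0; have /sub_kermxP : (row i (kermx A0^T) <= kermx A0^T)%MS by exact: row_sub.
  set u := row i _ => uA; apply: ortho_roots => a /rE[j ->].
  by have /matrixP/(_ 0 j) := uA; rewrite !mxE => <-; apply: eq_bigr => l _; rewrite !mxE.
pose A := rowsub (fullrankfun full) A0.
have Au : A \in unitmx by exact: fullrowsub_unit.
have hz (i : 'I_m) (j : 'I_n) : exists z : int, dotv (coroot (r i)) (row j A) = z%:~R.
  have -> : row j A = r (fullrankfun full j) by rewrite row_rowsub rowK.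
  by rewrite dotvC; have /intrP := roots_crystallographic rs (rP i) (rP (fullrankfun full j)).
pose M : 'M[int]_(m, n) := \matrix_(i, j) projT1 (cid (hz i j)).
pose Cm : 'M[R]_(m, n) := \matrix_i coroot (r i).
have CA : Cm *m A^T = map_mx intr M.
  apply/matrixP => i j; rewrite !mxE; case: cid => z /= <-.
  by apply: eq_bigr => l _; rewrite !mxE.
have [L Lu [U Uu [d _ ME]]] := int_Smith_normal_form M.
have map_unit p (X : 'M[int]_p) : X \in unitmx -> (map_mx intr X : 'M[R]_p) \in unitmx.
  move=> Xu; have := mulmxV Xu => /(congr1 (map_mx (intr : int -> R))).
  by rewrite map_mxM map_mx1 => /mulmx1_unit[].
pose Pm : 'M[int]_(m, n) := \matrix_(i, j) ((i == j :> nat)%:Z).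
pose Dn : 'M[int]_n := diag_mx (\row_j d`_j).
have DE : (\matrix_(i < m, j < n) (d`_i *+ (i == j :> nat))) = Pm *m Dn.
  apply/matrixP => i j; rewrite !mxE (bigD1 j) //= !mxE eqxx mulr1n big1 ?addr0.
    by have [->|] := eqVneq (i : nat) j; rewrite ?mulr1n ?mul1r ?mulr0n ?mul0r.
  by move=> l lj; rewrite !mxE (negPf lj) mulr0n mulr0.
rewrite DE in ME.
have ATu : A^T \in unitmx by rewrite unitmx_tr.
have Uru := map_unit _ _ Uu.
(* A missing or zero invariant factor would give a nonzero vector [v] orthogonal to all coroots. *)
have nz (j : 'I_n) : (j < m)%N && (d`_j != 0).
  apply/negPn/negP => hj.
  have D0 : map_mx intr (Pm *m Dn) *m delta_mx j 0 = 0 :> 'cV[R]_m.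
    rewrite -colE; apply/matrixP => i l; rewrite -DE !mxE.
    have [ij|] := eqVneq (i : nat) j; last by rewrite mulr0n.
    by move: hj; rewrite -ij ltn_ord /= negbK => /eqP ->; rewrite mul0rn.
  pose v := A^T *m (invmx (map_mx intr U) *m delta_mx j 0) : 'cV[R]_n.
  have Cv : Cm *m v = 0.
    rewrite /v mulmxA CA ME !map_mxM -!mulmxA mulKVmx // -/(intr) in D0 *.
    by rewrite mulmxA in D0; rewrite !mulmxA -(mulmxA _ (map_mx _ Pm)) -!mulmxA (mulmxA (map_mx _
        Pm)) D0 mulmx0.
  have v0 : v^T = 0.
    apply: coroot_dual => a /rE[i ->]; rewrite dotvC -dotE trmxK.
    by have := congr1 (row i) Cv; rewrite row_mul rowK row0 => ->; rewrite mxE.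
  have : delta_mx j 0 = 0 :> 'cV[R]_n.
    have -> : delta_mx j 0 = map_mx intr U *m (invmx A^T *m v) :> 'cV[R]_n.
      by rewrite /v mulKmx // mulKVmx.
    by rewrite -[v]trmxK v0 trmx0 !mulmx0.
  by move=> /matrixP/(_ j 0); rewrite !mxE !eqxx => /eqP; rewrite oner_eq0.
(* From [Cm *m A^T = M = L *m Pm *m Dn *m U] follows [Cm = L *m Pm *m B], where [Pm] only appends
   zero rows below [B]. *)
pose B : 'M[R]_n := map_mx intr (Dn *m U) *m invmx A^T.
have CB : Cm = map_mx intr (L *m Pm) *m B.
  rewrite /B mulmxA -map_mxM -[L *m Pm *m _]mulmxA [Pm *m _]mulmxA mulmxA -ME -CA.
  by rewrite mulmxK.
have Bu : B \in unitmx.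
  rewrite unitmx_mul unitmx_inv ATu andbT map_mxM unitmx_mul Uru andbT.
  rewrite map_diag_mx unitmxE det_diag unitfE; apply/prodf_neq0 => j _.
  by rewrite !mxE intr_eq0; have /andP[] := nz j.
exists B; split=> // [z|a /rE[i ->]]; last first.
  exists (row i (L *m Pm)); rewrite map_row -row_mul -CB rowK //.
(* [L] is invertible over the integers and [Pm^T *m Pm = 1], so integer combinations of the rows of
   [B] are integer combinations of coroots. *)
pose y := z *m Pm^T *m invmx L.
have -> : map_mx intr z *m B = map_mx intr y *m Cm.
  rewrite CB mulmxA -map_mxM mulmxA mulmxKV // -mulmxA.
  have -> : Pm^T *m Pm = 1%:M.
    apply/matrixP => i j; have /andP[im _] := nz i.
    rewrite !mxE (bigD1 (Ordinal im)) //= !mxE eqxx mul1r big1 ?addr0.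
      by rewrite -[i == j]val_eqE /=; case: (_ == _).
    by move=> l; rewrite -val_eqE /= !mxE => /negPf ->; rewrite mul0r.
  by rewrite mulmx1.
exists (fun a => if (insub (index a Phi) : option 'I_m) is Some i then y 0 i else 0).
rewrite (big_nth 0) big_mkord mulmx_sum_row; apply: eq_bigr => i _.
by rewrite rowK index_uniq ?fset_uniq // (valK i) mxE scaler_int.
Qed.

End RootStructure.

(** * The torus and its Haar measure *)

Section Probability.
Context d (T : measurableType d) (R : realType) (P : probability T R).
Implicit Types f g : T -> R.

Lemma Lfun2P f : f \in Lfun P 2%:E <->
  measurable_fun setT f /\ P.-integrable setT (EFin \o (fun x => f x ^+ 2)).
Proof.
split=> [fL|[mf intf]].
  split; last exact: Lfun2_integrable_sqr.
  by move: fL; rewrite inE => /andP[/[!inE]/=].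
rewrite inE; apply/andP; rewrite !inE /=; split=> //.
rewrite /finite_norm unlock /= poweR_lty //.
move/integrableP : intf => [_]; apply: le_lt_trans.
apply: ge0_le_integral => //=.
- apply/measurable_EFinP; apply: (@measurableT_comp _ _ _ _ _ _ (fun x : R => x `^ 2)%R) => //.
  exact/measurableT_comp.
- by do 2 apply: measurableT_comp => //; exact: measurable_funX.
- by move=> x _; rewrite lee_fin powR_mulrn // normrX.
Qed.

Lemma Lfun2_measurable f : f \in Lfun P 2%:E -> measurable_fun setT f.
Proof. by move/Lfun2P => []. Qed.

Lemma bounded_integrable f (M : R) : measurable_fun setT f -> (forall x, `|f x| <= M) ->
  P.-integrable setT (EFin \o f).
Proof.
move=> mf fM; apply: (@le_integrable _ _ _ _ _ _ _ (EFin \o cst M)) => //.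
- exact/measurable_EFinP.
- by move=> x _ /=; rewrite lee_fin (le_trans (fM x)) // ler_norm.
- by apply: finite_measure_integrable_cst.
Qed.

Lemma bounded_Lfun2 f (M : R) : measurable_fun setT f -> (forall x, `|f x| <= M) ->
  f \in Lfun P 2%:E.
Proof.
move=> mf fM; apply/Lfun2P; split=> //.
apply: (bounded_integrable (M := M ^+ 2)); first exact: measurable_funX.
by move=> x; rewrite normrX lerXn2r // nnegrE // (le_trans _ (fM x)).
Qed.

Lemma Lfun2_mul_integrable f g : f \in Lfun P 2%:E -> g \in Lfun P 2%:E ->
  P.-integrable setT (EFin \o (fun x => f x * g x)).
Proof. by move=> fL gL; apply/Lfun1_integrable; exact: Lfun2_mul_Lfun1. Qed.

Lemma Rintegral_dct (f_ : nat -> T -> R) f (g : T -> R) :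
  (forall m, measurable_fun setT (f_ m)) -> measurable_fun setT f ->
  {ae P, forall x, f_ ^~ x @ \oo --> f x} ->
  P.-integrable setT (EFin \o g) -> (forall m x, `|f_ m x| <= g x) ->
  (fun m => \int[P]_x f_ m x)%R @ \oo --> (\int[P]_x f x)%R.
Proof.
move=> mf_ mf cvf ig fg.
have [] := @dominated_convergence _ _ _ P setT measurableT
  (fun m => EFin \o f_ m) (EFin \o f) (EFin \o g) => //=.
- by move=> m; apply/measurable_EFinP.
- exact/measurable_EFinP.
- by apply: filterS cvf => x cx _; apply/cvg_EFin => //=; apply: nearW.
- by apply: aeW => x m _; rewrite lee_fin.
move=> intf _ cv; apply: fine_cvg; rewrite fineK //.
exact: integrable_fin_num.
Qed.

Lemma ae_eq_Rintegral f g : measurable_fun setT f -> measurable_fun setT g ->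
  {ae P, forall x, f x = g x} -> (\int[P]_x f x)%R = (\int[P]_x g x)%R.
Proof.
move=> mf mg fg; rewrite /Rintegral; congr fine; apply: ae_eq_integral => //.
- exact/measurable_EFinP.
- exact/measurable_EFinP.
- by apply: filterS fg => x -> _.
Qed.

Section MeasurePreserving.
Variable phi : T -> T.
Hypotheses (mphi : measurable_fun setT phi)
  (phiP : forall A, measurable A -> P (phi @^-1` A) = P A).

Lemma integrable_preserving f : P.-integrable setT (EFin \o f) ->
  P.-integrable setT (EFin \o (f \o phi)).
Proof.
move=> /integrableP[/measurable_EFinP mf intf]; apply/integrableP; split.
  exact/measurable_EFinP/measurableT_comp.
move: intf; rewrite (eq_measure_integral (pushforward P phi)); last first.
  by move=> A mA _; apply/esym/phiP.
rewrite ge0_integral_pushforward //.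
by apply: measurableT_comp => //; exact/measurable_EFinP.
Qed.

Lemma Rintegral_preserving f : P.-integrable setT (EFin \o f) ->
  (\int[P]_x f (phi x) = \int[P]_x f x)%R.
Proof.
move=> intf; have /integrableP[/measurable_EFinP mf _] := intf.
rewrite /Rintegral; congr fine.
rewrite [RHS](eq_measure_integral (pushforward P phi)); last first.
  by move=> A mA _; apply/esym/phiP.
rewrite integral_pushforward //; first exact/measurable_EFinP.
exact: integrable_preserving.
Qed.

End MeasurePreserving.

End Probability.

Section ContinuousFunctions.
Context (R : realType) (S : topologicalType).

Lemma continuous_cst_fun (E : topologicalType) (a : E) : continuous (fun _ : S => a).
Proof. by move=> x; exact: cst_continuous. Qed.

Lemma continuous_add_fun (E : normedModType R) (f g : S -> E) :
  continuous f -> continuous g -> continuous (fun x => f x + g x).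
Proof. by move=> cf cg x; apply: continuousD; [exact: cf|exact: cg]. Qed.

Lemma continuous_scale_fun (E : normedModType R) (f : S -> R) (a : E) :
  continuous f -> continuous (fun x => f x *: a).
Proof. by move=> cf x; apply: cvgZr_tmp; exact: cf. Qed.

Lemma continuous_mul_fun (f g : S -> R) :
  continuous f -> continuous g -> continuous (fun x => f x * g x).
Proof. by move=> cf cg x; apply: continuousM; [exact: cf|exact: cg]. Qed.

Lemma continuous_opp_fun (E : normedModType R) (f : S -> E) :
  continuous f -> continuous (fun x => - f x).
Proof. by move=> cf x; apply: continuousN; exact: cf. Qed.

Lemma continuous_sum_fun (E : normedModType R) I (r : seq I) (f : I -> S -> E) :
  (forall i, continuous (f i)) -> continuous (fun x => \sum_(i <- r) f i x).
Proof.
move=> cf; elim: r => [|i r IH].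
  rewrite (_ : (fun _ => _) = fun=> 0); first exact: continuous_cst_fun.
  by apply/funext => x; rewrite big_nil.
rewrite (_ : (fun _ => _) = fun x => f i x + \sum_(j <- r) f j x).
  exact: continuous_add_fun.
by apply/funext => x; rewrite big_cons.
Qed.

Lemma continuous_comp_fun (E F : topologicalType) (f : S -> E) (g : E -> F) :
  continuous f -> continuous g -> continuous (fun x => g (f x)).
Proof. by move=> cf cg x; apply: continuous_comp; [exact: cf|exact: cg]. Qed.

End ContinuousFunctions.

Lemma linear_rV_continuous (R : realType) n (E : normedModType R) (L : 'rV[R]_n -> E) :
  linear L -> continuous L.
Proof.
move=> linL.
have L0 : L 0 = 0 by have := linL (-1) 0 0; rewrite scaler0 addr0 scaleN1r addNr.
have LD x y : L (x + y) = L x + L y by have := linL 1 x y; rewrite !scale1r.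
have LZ a x : L (a *: x) = a *: L x by have := linL a x 0; rewrite L0 !addr0.
have LE x : L x = \sum_i x 0 i *: L (delta_mx 0 i).
  rewrite {1}(row_sum_delta x) (big_morph L LD L0).
  by apply: eq_bigr => i _; rewrite LZ.
rewrite (_ : L = fun x => \sum_i x 0 i *: L (delta_mx 0 i)); last exact/funext.
by apply: continuous_sum_fun => i; apply: continuous_scale_fun; exact: coord_continuous.
Qed.

Lemma dotv_continuous (R : realType) n (l : 'rV[R]_n) : continuous (dotv l : 'rV[R]_n -> R).
Proof. exact: (linear_rV_continuous (E := R^o) (@dotv_is_linear R n l)). Qed.

Section TrigonometricPeriods.
Variable R : realType.
Implicit Types (x : R) (m : int).

Lemma norm_sinD_int x m : `|sin (x + m%:~R * trigo.pi)| = `|sin x|.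
Proof.
have nat_case (y : R) (k : nat) : `|sin (y + k%:R * trigo.pi)| = `|sin y|.
  elim: k => [|k IH]; first by rewrite mul0r addr0.
  by rewrite -natr1 mulrDl mul1r addrA sinDpi normrN.
case: m => k; first exact: nat_case.
by rewrite -[LHS](nat_case _ k.+1) NegzE mulrNz mulNr subrK.
Qed.

Lemma sinD_int x m : sin (x + m%:~R * (2 * trigo.pi)) = sin x.
Proof.
have nat_case (y : R) (k : nat) : sin (y + k%:R * (2 * trigo.pi)) = sin y.
  elim: k => [|k IH]; first by rewrite mul0r addr0.
  have -> : y + k.+1%:R * (2 * trigo.pi) = y + k%:R * (2 * trigo.pi) + trigo.pi + trigo.pi.
    by rewrite -natr1; ring.
  by rewrite !sinDpi opprK.
case: m => k; first exact: nat_case.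
by rewrite -[LHS](nat_case _ k.+1) NegzE mulrNz mulNr subrK.
Qed.

Lemma cosD_int x m : cos (x + m%:~R * (2 * trigo.pi)) = cos x.
Proof.
have nat_case (y : R) (k : nat) : cos (y + k%:R * (2 * trigo.pi)) = cos y.
  elim: k => [|k IH]; first by rewrite mul0r addr0.
  have -> : y + k.+1%:R * (2 * trigo.pi) = y + k%:R * (2 * trigo.pi) + trigo.pi + trigo.pi.
    by rewrite -natr1; ring.
  by rewrite !cosDpi opprK.
case: m => k; first exact: nat_case.
by rewrite -[LHS](nat_case _ k.+1) NegzE mulrNz mulNr subrK.
Qed.

Lemma norm_sin_powR_le1 (p x : R) : 0 <= p -> `|sin x| `^ p <= 1.
Proof.
move=> p0; have h : `|sin x| `^ p <= 1 `^ p.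
  by apply: ge0_ler_powR; rewrite ?nnegrE ?ler01 // ler_norml sin_geN1 sin_le1.
by apply: le_trans h _; rewrite powR1.
Qed.

End TrigonometricPeriods.

(** * Periodic functions, integration by parts and null sets on the torus *)

Section Torus.
Variables (R : realType) (n : nat) (Phi : {fset 'rV[R]_n}).
Local Notation V := 'rV[R]_n.
Local Notation T := (torus Phi).
Local Notation tpi := (@torus_pi R n Phi).

Definition torus_periodic A (F : V -> A) : Prop :=
  forall x q, coroot_lattice Phi q -> F (x + (2 * trigo.pi) *: q) = F x.

Lemma torus_piP x y : tpi x = tpi y <-> x - y \in period_lattice Phi.
Proof.
have h := @eqmodP V (Quotient.equiv_equiv (period_lattice Phi)) x y.
by rewrite -Quotient.equivE; split=> [e|]; [exact: (introT h)|move/(elimT h)].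
Qed.

Lemma torus_piK t : tpi (repr t) = t.
Proof. exact: reprK. Qed.

Lemma torus_piD x y : tpi (x + y) = tpi x + tpi y.
Proof. exact: (raddfD (@pi _ (Quotient.quot (period_lattice Phi)))). Qed.

Lemma periodicP A (F : V -> A) x y : torus_periodic F -> tpi x = tpi y -> F x = F y.
Proof.
move=> perF /torus_piP /asboolP[q qL e].
by rewrite -(perF y q qL) -e addrC subrK.
Qed.

Lemma periodic_repr A (F : V -> A) x : torus_periodic F -> F (repr (tpi x)) = F x.
Proof. by move=> perF; apply: periodicP => //; rewrite torus_piK. Qed.

Lemma periodic_tpi A (f : T -> A) : torus_periodic (f \o tpi).
Proof.
move=> x q qL /=; congr f; apply/torus_piP; rewrite addrAC subrr add0r.
by apply/asboolP; exists q.
Qed.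

(** [repr] is an arbitrary section of the projection; continuity comes from the quotient topology,
    since a periodic [F] factors through it. *)
Lemma torus_continuous (F : V -> R) : torus_periodic F -> continuous F ->
  continuous (fun t : T => F (repr t)).
Proof.
move=> perF cF; apply/quotient_continuous.
rewrite (_ : _ \o _ = F) //; apply/funext => x /=; exact: periodic_repr.
Qed.

Lemma torus_continuous_measurable (f : T -> R) : continuous f -> measurable_fun setT f.
Proof.
move=> /continuousP cf; apply: (measurability _ (RGenOpens.measurableE R)).
move=> _ [_ [a [b ->] <-]]; rewrite setTI; apply: sub_sigma_algebra.
exact/cf/interval_open.
Qed.

Lemma torus_measurable (F : V -> R) : torus_periodic F -> continuous F ->
  measurable_fun setT (fun t : T => F (repr t)).
Proof. by move=> pF cF; apply: torus_continuous_measurable; exact: torus_continuous. Qed.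

Lemma torus_shift_measurable (s : T) : measurable_fun setT (fun t : T => s + t).
Proof.
apply: (measurability (@open T)) => // _ [A oA <-].
rewrite setTI; apply: sub_sigma_algebra.
suff : continuous (fun t : T => s + t) by move/continuousP; exact.
apply/quotient_continuous.
have -> : (fun t : T => s + t) \o \pi_T%qT = tpi \o (fun x : V => repr s + x).
  by apply/funext => x /=; rewrite torus_piD torus_piK.
apply: (continuous_comp_fun (f := fun x : V => repr s + x)); last exact: pi_continuous.
by apply: continuous_add_fun; [exact: continuous_cst_fun|move=> x; exact: cvg_id].
Qed.

Lemma weight_period l q : weight_lattice Phi l -> coroot_lattice Phi q ->
  exists m : int, forall x, dotv l (x + (2 * trigo.pi) *: q) = dotv l x + m%:~R * (2 * trigo.pi).
Proof.
move=> lP qL; have /intrP[m e] := weight_coroot_lattice lP qL.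
by exists m => x; rewrite dotvDr dotvZr e mulrC.
Qed.

Lemma periodic_cos l : weight_lattice Phi l -> torus_periodic (fun x => cos (dotv l x)).
Proof. by move=> lP x q /(weight_period lP)[m ->]; rewrite cosD_int. Qed.

Lemma periodic_sin l : weight_lattice Phi l -> torus_periodic (fun x => sin (dotv l x)).
Proof. by move=> lP x q /(weight_period lP)[m ->]; rewrite sinD_int. Qed.

(** Half of a multiple of [2 pi] shifts the sine by a multiple of [pi] and may change its sign; only
    the absolute value descends to the torus. *)
Lemma periodic_norm_sin l : weight_lattice Phi l -> torus_periodic (fun x => `|sin (dotv l x / 2)|).
Proof.
move=> lP x q /(weight_period lP)[m ->].
by rewrite mulrDl (_ : m%:~R * (2 * trigo.pi) / 2 = m%:~R * trigo.pi) ?norm_sinD_int //; field.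
Qed.

Lemma continuous_norm_sin l : continuous (fun x : V => `|sin (dotv l x / 2)|).
Proof.
apply: (continuous_comp_fun (f := fun x => sin (dotv l x / 2))); last exact: norm_continuous.
apply: (continuous_comp_fun (f := fun x => dotv l x / 2)); last exact: continuous_sin.
by apply: continuous_mul_fun; [exact: dotv_continuous|exact: continuous_cst_fun].
Qed.

Variable mu : probability T R.
Hypothesis mu_Haar : normalized_Haar mu.

Lemma Haar_shift (s : T) (f : T -> R) : measurable_fun setT f ->
  mu.-integrable setT (EFin \o f) ->
  (\int[mu]_t f (s + t) = \int[mu]_t f t)%R.
Proof.
move=> mf intf; apply: Rintegral_preserving => //; first exact: torus_shift_measurable.
by move=> A mA; exact: mu_Haar.
Qed.

Lemma Haar_shift_real (F : V -> R) x0 : torus_periodic F -> continuous F ->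
  mu.-integrable setT (EFin \o (fun t : T => F (repr t))) ->
  (\int[mu]_t F (repr t + x0) = \int[mu]_t F (repr t))%R.
Proof.
move=> perF cF intF.
rewrite -(Haar_shift (tpi x0) (torus_measurable perF cF) intF).
apply: eq_Rintegral => t _; apply: (periodicP perF).
by rewrite torus_piD !torus_piK addrC.
Qed.

Hypothesis rs : reduced_crystallographic_root_system Phi.

Lemma root_weight a : a \in Phi -> weight_lattice Phi a.
Proof. by move=> aP b bP; apply: (roots_crystallographic rs). Qed.

(** In the coordinates of a Z-basis of the coroot lattice, subtracting integer parts moves every
    point into a compact cube without changing [F]. *)
Lemma periodic_bounded (F : V -> R) : torus_periodic F -> continuous F ->
  exists M : R, forall x, `|F x| <= M.
Proof.
move=> perF cF; have [B [Bu Blat _]] := coroot_basis rs.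
pose K : set V := [set y : V | forall i, `[0, 2 * trigo.pi]%classic (y ord0 i)].
have cK : compact K by apply: (@rV_compact R n (fun=> `[0, 2 * trigo.pi]%classic)) => i; exact:
    segment_compact.
have cF' : continuous (fun y : V => F (y *m B)).
  apply: (continuous_comp_fun (f := fun y : V => y *m B)) => //.
  apply: linear_rV_continuous => c x y; by rewrite mulmxDl scalemxAl.
have : compact ((fun y : V => F (y *m B)) @` K).
  by apply: continuous_compact => //; exact: continuous_subspaceT.
move=> /compact_bounded[M [_ MP]]; exists (M + 1) => x.
have pi0 : 0 < 2 * trigo.pi :> R by rewrite mulr_gt0 // trigo.pi_gt0.
pose y := x *m invmx B.
pose z : 'rV[int]_n := \row_i Num.floor (y 0 i / (2 * trigo.pi)).
pose y' := y - (2 * trigo.pi) *: map_mx intr z.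
have -> : F x = F (y' *m B).
  rewrite /y' mulmxBl -scalemxAl /y mulmxKV //.
  by rewrite -[LHS](perF _ _ (Blat (- z))) map_mxN mulNmx scalerN.
apply: (MP (M + 1)); first by rewrite ltrDl.
exists y' => // i /=; rewrite in_itv /=.
have -> : y' ord0 i = y 0 i - 2 * trigo.pi * (Num.floor (y 0 i / (2 * trigo.pi)))%:~R.
  by rewrite /y' /z !mxE.
have /andP[] := floor_itv (y 0 i / (2 * trigo.pi)).
rewrite ler_pdivlMr // ltr_pdivrMr // intrD1 => u1 u2.
by apply/andP; split; lra.
Qed.

Lemma periodic_derive (F : V -> R) v : torus_periodic F -> torus_periodic ('D_v F).
Proof.
move=> perF x q qL; rewrite /derive.
set f1 := (X in lim (X @ _)); set f2 := (X in _ = lim (X @ _)).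
suff -> : f1 = f2 by [].
by apply/funext => h; rewrite /f1 /f2 /= addrA !perF.
Qed.

Lemma periodic_laplacian (F : V -> R) : torus_periodic F -> torus_periodic (laplacian F).
Proof.
move=> pF x q qL; apply: eq_bigr => i _.
exact: (periodic_derive _ (periodic_derive _ pF) x qL).
Qed.

Lemma periodic_integrable (F : V -> R) : torus_periodic F -> continuous F ->
  mu.-integrable setT (EFin \o (fun t : T => F (repr t))).
Proof.
move=> perF cF; have [M FM] := periodic_bounded perF cF.
by apply: (@bounded_integrable _ _ _ _ _ M) => //; exact: torus_measurable.
Qed.

(** The difference quotients integrate to zero by translation invariance. By the mean value theorem
    they are bounded by a bound of the derivative, so dominated convergence applies. *)
Lemma integral_derive0 (F : V -> R) v : torus_periodic F -> continuous F ->
  (forall x, derivable F x v) -> continuous ('D_v F) ->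
  (\int[mu]_t 'D_v F (repr t) = 0)%R.
Proof.
move=> perF cF dF cdF; have perdF := periodic_derive v perF.
have [M FM] := periodic_bounded perdF cdF.
pose h m : R := m.+1%:R^-1.
pose g m (x : V) := (h m)^-1 * (F (x + h m *: v) - F x).
have h0 m : 0 < h m by rewrite invr_gt0.
have perg m : torus_periodic (g m).
  by move=> x q qL; rewrite /g addrAC !perF.
have cg m : continuous (g m).
  apply: continuous_mul_fun; first exact: continuous_cst_fun.
  apply: continuous_add_fun; last exact: continuous_opp_fun.
  apply: (continuous_comp_fun (f := fun x : V => x + h m *: v)) => //.
  by apply: continuous_add_fun; [move=> x; exact: cvg_id|exact: continuous_cst_fun].
have csh m : continuous (fun x : V => F (x + h m *: v)).
  apply: (continuous_comp_fun (f := fun x : V => x + h m *: v)) => //.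
  by apply: continuous_add_fun; [move=> x; exact: cvg_id|exact: continuous_cst_fun].
have psh m : torus_periodic (fun x : V => F (x + h m *: v)).
  by move=> x q qL; rewrite addrAC perF.
have ig m : (\int[mu]_t g m (repr t) = 0)%R.
  have i1 := periodic_integrable perF cF.
  have i2 := periodic_integrable (psh m) (csh m).
  rewrite /g RintegralZl //; last first.
    exact: (integrableB measurableT i2 i1).
  rewrite RintegralB //.
  by rewrite Haar_shift_real // subrr mulr0.
have lineE x (s : R) : (fun h => h^-1 *: (((fun s => F (x + s *: v)) \o shift s) (h *: (1 : R)) - F
    (x + s *: v)))
    = (fun h => h^-1 *: ((F \o shift (x + s *: v)) (h *: v) - F (x + s *: v))).
  apply/funext => e /=; rewrite /shift /=; congr (_ *: (F _ - _)).
  by rewrite scalerDl [_ *: 1]mulr1 addrCA.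
have line x (s : R) : is_derive s (1 : R) (fun s => F (x + s *: v)) ('D_v F (x + s *: v)).
  apply: DeriveDef; first by rewrite /derivable lineE; exact: dF.
  by rewrite /derive lineE.
have gD m x : exists c, g m x = 'D_v F (x + c *: v).
  have hm : 0 <= h m by exact: ltW.
  have cl : {within `[0, h m], continuous (fun s : R => F (x + s *: v))}.
    by apply: derivable_within_continuous => s _; have [] := line x s.
  have [c c0 e] := MVT_segment hm (fun s _ => line x s) cl.
  exists c.
  have e2 : F (x + h m *: v) - F x = 'D_v F (x + c *: v) * h m.
    by move: e; rewrite subr0 scale0r addr0.
  by rewrite /g e2 mulrC mulfK // gt_eqF.
have cv : (fun m => \int[mu]_t g m (repr t))%R @ \oo --> (\int[mu]_t 'D_v F (repr t))%R.
  apply: (@Rintegral_dct _ _ _ mu _ _ (cst M)) => [m||||].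
  - exact: torus_measurable.
  - exact: (torus_measurable perdF cdF).
  - apply: aeW => t /=; set x := repr t.
    have hcv : h @ \oo --> (0 : R) by exact: cvg_harmonic.
    have := dF x => /cvg_ex[l lP].
    have -> : 'D_v F x = l by apply/cvg_lim.
    have hcv' : h @ \oo --> (0 : R)^'.
      move=> A [e e0 eA]; have := hcv (ball 0 e) (nbhsx_ballx _ _ e0) => ?.
      apply: (@filterS _ \oo _ (h @^-1` ball 0 e)) => // m mB.
      by apply: eA => //=; rewrite gt_eqF.
    have := cvg_comp _ _ hcv' lP; apply: cvg_trans; apply: near_eq_cvg.
    by apply: nearW => m; rewrite /g /= [h m *: v + x]addrC.
  - exact: finite_measure_integrable_cst.
  - by move=> m t /=; have [c ->] := gD m (repr t).
have : (fun m => \int[mu]_t g m (repr t))%R @ \oo --> (0 : R).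
  by under eq_fun do rewrite ig; exact: cvg_cst.
by move/cvg_unique => /(_ (@Rhausdorff R) _ cv).
Qed.

(* The disjoint translates of [A] all have the same measure. *)
Lemma Haar_disjoint_null (A : set T) (v : V) : measurable A ->
  (forall (s s' : R) t, 0 < s < 1 -> 0 < s' < 1 -> A (tpi (s *: v) + t) ->
    A (tpi (s' *: v) + t) -> s = s') ->
  mu A = 0.
Proof.
move=> mA dis.
(* [m.+2] keeps the parameter of the translation strictly below [1]. *)
pose B (m : nat) := ((fun x => tpi ((m.+2%:R^-1 : R) *: v) + x) @^-1` A).
have mB m : measurable (B m).
  have := torus_shift_measurable (tpi ((m.+2%:R^-1 : R) *: v)) measurableT mA.
  by rewrite setTI.
have muB m : mu (B m) = mu A by exact: mu_Haar.
have tB : trivIset setT B.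
  apply/trivIsetP => i j _ _ ij.
  have io (k : nat) : 0 < (k.+2%:R^-1 : R) < 1.
    by rewrite invr_gt0 ltr0n /= invf_lt1 ?ltr0n // ltr1n.
  apply/seteqP; split=> // t [h1 h2]; move: ij.
  have /invr_inj/eqP := dis _ _ _ (io i) (io j) h1 h2.
  by rewrite eqr_nat !eqSS => ->.
have le1 : (mu (\bigcup_m B m) <= 1)%E by apply: probability_le1; exact: bigcup_measurable.
rewrite measure_bigcup // (eq_eseriesl (Q := xpredT)) in le1; last by move=> m; rewrite in_setT.
have muA : mu A = (fine (mu A))%:E by rewrite fineK // fin_num_measure.
apply/eqP; rewrite eq_le measure_ge0 andbT muA lee_fin leNgt; apply/negP => A0.
have B0 k : (0 <= k)%N -> true -> (0 <= mu (B k))%E by [].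
have := le_trans (nneseries_lim_ge (Num.truncn (fine (mu A))^-1).+1 B0) le1.
rewrite big_mkord; under eq_bigr do rewrite muB muA.
rewrite sumEFin sumr_const card_ord lee_fin -mulr_natl -ler_pdivlMr // mul1r leNgt.
by rewrite truncnS_gt.
Qed.

Lemma hyperplane_measurable a : a \in Phi -> measurable [set t : T | sin (dotv a (repr t) / 2) = 0].
Proof.
move=> aP.
have -> : [set t : T | sin (dotv a (repr t) / 2) = 0] =
    setT `&` (fun t : T => `|sin (dotv a (repr t) / 2)|) @^-1` [set 0].
  rewrite setTI; apply/seteqP; split=> t /= => [->|/eqP]; first exact: normr0.
  by rewrite normr_eq0 => /eqP.
have pF := periodic_norm_sin (root_weight aP).
by apply: (torus_measurable pF) => //; exact: continuous_norm_sin.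
Qed.

Lemma hyperplane_null a : a \in Phi -> mu [set t : T | sin (dotv a (repr t) / 2) = 0] = 0.
Proof.
move=> aP; set A := [set t | _].
have aa : dotv a a != 0 by rewrite dotv_eq0 (root_neq0 rs).
pose F (x : V) := `|sin (dotv a x / 2)|.
have pF : torus_periodic F by apply: periodic_norm_sin; exact: root_weight.
have mA : measurable A by exact: hyperplane_measurable.
have AE x : A (tpi x) -> sin (dotv a x / 2) = 0.
  rewrite /A /= => h; have := periodic_repr x pF; rewrite /F h normr0 => /esym/eqP.
  by rewrite normr_eq0 => /eqP.
(* Translation by [s] times this vector adds [s] to [dotv a x], whereas consecutive zeros of
   [sin (y / 2)] are [2 pi] apart. *)
apply: (@Haar_disjoint_null _ ((dotv a a)^-1 *: a)) => // s s' t s0 s1.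
rewrite -(torus_piK t) -!torus_piD => /AE + /AE.
rewrite !dotvDr !dotvZr mulVf // !mulr1; set y := dotv a (repr t).
move=> h1 h2.
have : sin ((s - s') / 2) = 0.
  have -> : (s - s') / 2 = (s + y) / 2 - (s' + y) / 2 by ring.
  by rewrite sinB h1 h2 mul0r mulr0 subrr.
have sgt (u : R) : 0 < u < 1 -> 0 < sin (u / 2).
  move=> u01; apply: sin_gt0_pi; have := trigo.pi_ge2 R; lra.
have [ss'|ss'|//] := ltgtP s s'.
  have -> : (s - s') / 2 = - ((s' - s) / 2) by ring.
  by rewrite sinN => /eqP; rewrite oppr_eq0 gt_eqF // sgt //; lra.
by move/eqP; rewrite gt_eqF // sgt //; lra.
Qed.

End Torus.

(** * Functions of class C2 *)

Section AbsPower.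
Variable R : realType.
Implicit Types x r k : R.

Lemma norm_powR_mul2 r x : x != 0 -> `|x| `^ (r - 2) * x * x = `|x| `^ r.
Proof.
move=> x0; rewrite -mulrA -expr2 -real_normK ?num_real // -powR_mulrn //.
rewrite -powRD; last by rewrite normr_eq0 x0 implybT.
by congr powR; ring.
Qed.

Lemma is_derive_norm_powR r x : x != 0 ->
  is_derive x (1 : R) (fun y : R => `|y| `^ r) (r * `|x| `^ (r - 2) * x).
Proof.
move=> x0; pose s := Num.sg x.
have sx : s * x = `|x| by rewrite /s -normrEsg.
have px : 0 < s * x by rewrite sx normr_gt0.
have D : is_derive x (1 : R) (fun y : R => (s * y) `^ r) (r * `|x| `^ (r - 2) * x).
  have D1 : is_derive x (1 : R) (fun y : R => s * y) s.
    have := @is_deriveZ _ _ _ id s x (1 : R) (1 : R) _.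
    rewrite /= => /(_ (is_derive_id _ _)); rewrite [_ *: _]mulr1; exact.
  have D2 := is_derive1_powR r px.
  have := @is_derive1_comp R (fun y => y `^ r) (fun y => s * y) x _ _ D2 D1.
  move=> D3; apply: (is_derive_eq D3); rewrite sx -mulrA -[in RHS]mulrA; congr (_ * _).
  have -> : r - 1 = (r - 2) + 1 by ring.
  rewrite powRD ?normr_eq0 ?x0 ?implybT // powRr1 // -mulrA; congr (_ * _).
  by rewrite -sx mulrAC -expr2 sqr_sg x0 mul1r.
apply: near_eq_is_derive D; near=> y.
suff <- : s * y = `|y| by [].
rewrite /s; have : `|y - x| < `|x|.
  near: y; apply/nbhs_ballP; exists `|x|; first by rewrite /= normr_gt0.
  by move=> z; rewrite /ball /= distrC.
have [xp|xn] := ltP 0 x.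
  rewrite gtr0_sg // mul1r (gtr0_norm xp) ltr_norml => /andP[h _].
  by rewrite gtr0_norm //; lra.
have {}xn : x < 0 by rewrite lt_neqAle x0.
rewrite ltr0_sg // mulN1r (ltr0_norm xn) ltr_norml => /andP[_ h].
by rewrite ltr0_norm //; lra.
Unshelve. all: by end_near. Qed.

Lemma continuous_norm_powR r : 0 <= r -> continuous (fun y : R => `|y| `^ r).
Proof.
move=> r0 x; have [->|x0] := eqVneq x 0; last first.
  by apply/differentiable_continuous/derivable1_diffP; case: (is_derive_norm_powR r x0).
have [->|rn0] := eqVneq r 0.
  rewrite (_ : (fun _ => _) = fun=> 1); first exact: cst_continuous.
  by apply/funext => y; rewrite powRr0.
have rp : 0 < r by rewrite lt0r rn0.
apply/cvgrPdist_lt => e e0; near=> y.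
rewrite normr0 powR0 // sub0r normrN ger0_norm ?powR_ge0 //.
have -> : e = (e `^ r^-1) `^ r by rewrite -powRrM mulVf // powRr1 // ltW.
apply: gt0_ltr_powR => //; rewrite ?nnegrE ?powR_ge0 //.
near: y; apply/nbhs_ballP; exists (e `^ r^-1); first exact: powR_gt0.
by move=> z; rewrite /ball /= sub0r normrN.
Unshelve. all: by end_near. Qed.

(** Reads off derivatives at [0], where the absolute value is not differentiable and the chain rule
    does not apply. *)
Lemma is_derive_at0 (f g : R -> R) l : (forall h, f h = g h * h) -> continuous g ->
  g 0 = l -> is_derive (0 : R) (1 : R) f l.
Proof.
move=> fg cg <-.
have cv : (fun h : R => h^-1 *: ((f \o shift 0) (h *: (1 : R)) - f 0)) @ 0^' --> g 0.
  have : g @ 0^' --> g 0 by apply: cvg_within_filter; exact: cg.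
  apply: cvg_trans; apply: near_eq_cvg; near=> h.
  have h0 : h != 0 by near: h; exact: nbhs_dnbhs_neq.
  rewrite /= addr0 [h *: 1]mulr1 !fg mulr0 subr0 [_ *: _]mulrC mulfK //.
by apply: DeriveDef; [apply/cvg_ex; exists (g 0)|apply/cvg_lim].
Unshelve. all: by end_near. Qed.

(** At [0], [|h| ^ k] is [h] times [|h| ^ (k - 2) * h], which is continuous because [k - 2 >= 0];
    [k = 2] is covered, as a power with exponent [0] is [1]. *)
Lemma is_derive_norm_powR_ge2 k x : 2 <= k ->
  is_derive x (1 : R) (fun y : R => `|y| `^ k) (k * `|x| `^ (k - 2) * x).
Proof.
move=> k2; have [->|x0] := eqVneq x 0; last exact: is_derive_norm_powR.
apply: (@is_derive_at0 _ (fun h => `|h| `^ (k - 2) * h)).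
- move=> h; have [->|h0] := eqVneq h 0; first by rewrite normr0 powR0 ?mulr0 //; lra.
  by rewrite norm_powR_mul2.
- apply: continuous_mul_fun; first by apply: continuous_norm_powR; lra.
  by move=> h; exact: cvg_id.
- by rewrite !mulr0.
Qed.

Lemma is_derive_norm_powR_mul r x : 0 <= r ->
  is_derive x (1 : R) (fun y : R => `|y| `^ r * y) ((r + 1) * `|x| `^ r).
Proof.
move=> r0; have [->|x0] := eqVneq x 0.
  apply: (@is_derive_at0 _ (fun h => `|h| `^ r)) => //; first exact: continuous_norm_powR.
  have [->|rn0] := eqVneq r 0; first by rewrite powRr0 add0r mulr1.
  by rewrite normr0 powR0 // mulr0.
have D := @is_deriveM _ _ _ id x (1 : R) _ _ (is_derive_norm_powR r x0) (is_derive_id _ _).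
apply: (is_derive_eq D); rewrite /= -(norm_powR_mul2 r x0).
rewrite [_ *: (1 : R)]mulr1 [x *: _]mulrC; ring.
Qed.

Lemma is_derive_scaled (phi : R -> R) (c y l : R) :
  is_derive y (1 : R) phi l -> is_derive y c phi (l * c).
Proof.
move=> [/derivable1_diffP dphi e]; have E : 'd phi y (1 : R) = l by rewrite -deriveE.
apply: DeriveDef; first exact: diff_derivable.
by rewrite deriveE // -{1}[c]mulr1 -[c * 1]/(c *: (1 : R)) linearZ /= E [_ *: _]mulrC.
Qed.

End AbsPower.

Section Jets.
Variables (R : realType) (n : nat).
Local Notation V := 'rV[R]_n.

Lemma is_derive_mul_fun (A B : V -> R) x u a b : is_derive x u A a -> is_derive x u B b ->
  is_derive x u (fun x => A x * B x) (a * B x + A x * b).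
Proof.
move=> dA dB; have D := @is_deriveM _ _ _ _ _ _ _ _ dA dB.
by apply: (is_derive_eq D); rewrite addrC [B x *: a]mulrC.
Qed.

(** A function with its first two derivatives as explicit functions of the directions. Directions
    are arbitrary because derivatives along roots and along Weyl images of basis vectors occur;
    linearity in each direction reduces them to coordinates. *)
Record jet2 (F : V -> R) (F1 : V -> V -> R) (F2 : V -> V -> V -> R) : Prop := {
  jet_c0 : continuous F;
  jet_c1 : forall v, continuous (F1 v);
  jet_c2 : forall v u, continuous (F2 v u);
  jet_d1 : forall v x, is_derive x v F (F1 v x);
  jet_d2 : forall v u x, is_derive x u (F1 v) (F2 v u x);
  jet_lin1 : forall (c : R) v v' x, F1 (c *: v + v') x = c * F1 v x + F1 v' x;
  jet_lin2 : forall (c : R) v v' u x, F2 (c *: v + v') u x = c * F2 v u x + F2 v' u x;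
  jet_lin2r : forall (c : R) v u u' x, F2 v (c *: u + u') x = c * F2 v u x + F2 v u' x }.

Lemma jet2_C2 F F1 F2 : jet2 F F1 F2 -> C2 F /\
  forall x, laplacian F x = \sum_(i < n) F2 (delta_mx 0 i) (delta_mx 0 i) x.
Proof.
move=> J.
have p1 i : partial i F = F1 (delta_mx 0 i).
  by apply/funext => x; rewrite /partial; apply: derive_val; exact: jet_d1 J _ _.
have p2 i j : partial j (partial i F) = F2 (delta_mx 0 i) (delta_mx 0 j).
  by rewrite p1; apply/funext => x; rewrite /partial; apply: derive_val; exact: jet_d2 J _ _ _.
split.
  split.
  - exact: jet_c0 J.
  - by move=> i x; case: (jet_d1 J (delta_mx 0 i) x).
  - by move=> i; rewrite p1; exact: jet_c1 J _.
  - by move=> i j x; rewrite p1; case: (jet_d2 J (delta_mx 0 i) (delta_mx 0 j) x).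
  - by move=> i j; rewrite p2; exact: jet_c2 J _ _.
by move=> x; apply: eq_bigr => i _; rewrite p2.
Qed.

Lemma jet2_cst (a : R) : jet2 (fun=> a) (fun _ _ => 0) (fun _ _ _ => 0).
Proof.
by split=> *; first [exact: continuous_cst_fun | exact: (is_derive_cst _ _ _) | rewrite mulr0 addr0].
Qed.

Lemma jet2D F F1 F2 G G1 G2 : jet2 F F1 F2 -> jet2 G G1 G2 ->
  jet2 (fun x => F x + G x) (fun v x => F1 v x + G1 v x) (fun v u x => F2 v u x + G2 v u x).
Proof.
move=> [c0 c1 c2 d1 d2 l1 l2 l3] [c0' c1' c2' d1' d2' l1' l2' l3'].
by split=> *; first [exact: continuous_add_fun | exact: (@is_deriveD _ _ _ _ _ _ _ _ _ (d1 _ _) (d1'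
    _ _)) | exact: (@is_deriveD _ _ _ _ _ _ _ _ _ (d2 _ _ _) (d2' _ _ _)) | rewrite ?l1 ?l1' ?l2
    ?l2' ?l3 ?l3'; ring].
Qed.

Lemma jet2M F F1 F2 G G1 G2 : jet2 F F1 F2 -> jet2 G G1 G2 ->
  jet2 (fun x => F x * G x) (fun v x => F1 v x * G x + F x * G1 v x)
    (fun v u x => F2 v u x * G x + F1 v x * G1 u x + (F1 u x * G1 v x + F x * G2 v u x)).
Proof.
move=> [c0 c1 c2 d1 d2 l1 l2 l3] [c0' c1' c2' d1' d2' l1' l2' l3'].
split=> [||v u|v x|v u x|c v v' x|c v v' u x|c v u u' x].
- exact: continuous_mul_fun.
- by move=> v; apply: continuous_add_fun; exact: continuous_mul_fun.
- by apply: continuous_add_fun; apply: continuous_add_fun; exact: continuous_mul_fun.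
- exact: is_derive_mul_fun.
- apply: (@is_deriveD _ _ _ (fun x => F1 v x * G x) (fun x => F x * G1 v x)); exact: is_derive_mul_fun.
- by rewrite l1 l1'; ring.
- by rewrite l1 l2 l1' l2'; ring.
- by rewrite l1 l3 l1' l3'; ring.
Qed.

Lemma jet2_scale (a : R) F F1 F2 : jet2 F F1 F2 ->
  jet2 (fun x => a * F x) (fun v x => a * F1 v x) (fun v u x => a * F2 v u x).
Proof.
move=> J; have := jet2M (jet2_cst a) J.
congr jet2; first by apply/funext => v; apply/funext => x; ring.
by apply/funext => v; apply/funext => u; apply/funext => x; ring.
Qed.

Lemma jet2_comp_dotv (phi phi1 phi2 : R -> R) (a : V) :
  continuous phi2 -> (forall y, is_derive y (1 : R) phi (phi1 y)) ->
  (forall y, is_derive y (1 : R) phi1 (phi2 y)) ->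
  jet2 (fun x => phi (dotv a x)) (fun v x => phi1 (dotv a x) * dotv a v)
    (fun v u x => phi2 (dotv a x) * dotv a v * dotv a u).
Proof.
move=> c2 d1 d2.
have dc (f g : R -> R) : (forall y, is_derive y (1 : R) f (g y)) -> continuous f.
  by move=> d y; apply/differentiable_continuous/derivable1_diffP; case: (d y).
have cd := @dotv_continuous R n a.
have cc (f : R -> R) : continuous f -> continuous (fun x : V => f (dotv a x)).
  by move=> cf; apply: (continuous_comp_fun cd cf).
have D (f g : R -> R) x v : (forall y, is_derive y (1 : R) f (g y)) ->
   is_derive x v (fun x => f (dotv a x)) (g (dotv a x) * dotv a v).
  move=> d; have [h1 h2] := is_derive_scaled (dotv a v) (d (dotv a x)).
  have E : (fun h : R => h^-1 *: (((fun x => f (dotv a x)) \o shift x) (h *: v) - f (dotv a x))) =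
     (fun h : R => h^-1 *: ((f \o shift (dotv a x)) (h *: dotv a v) - f (dotv a x))).
    by apply/funext => h /=; rewrite dotvDr dotvZr.
  apply: DeriveDef; first by rewrite /derivable E; exact: h1.
  by rewrite /derive E; exact: h2.
split=> [||v u|v x|v u x|c v v' x|c v v' u x|c v u u' x].
- exact: cc (dc _ _ d1).
- by move=> v; apply: continuous_mul_fun; [exact: cc (dc _ _ d2)|exact: continuous_cst_fun].
- by apply: continuous_mul_fun; [apply: continuous_mul_fun; [exact: cc c2|exact:
    continuous_cst_fun]|exact: continuous_cst_fun].
- exact: D.
- have := D (fun y => phi1 y * dotv a v) (fun y => phi2 y * dotv a v) x u.
  apply => y.
  have DD := @is_deriveM _ _ _ _ _ _ _ _ (d2 y) (is_derive_cst (dotv a v) y (1 : R)).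
  by apply: (is_derive_eq DD); rewrite scaler0 add0r [_ *: _]mulrC.
- by rewrite dotvDr dotvZr; ring.
- by rewrite dotvDr dotvZr; ring.
- by rewrite dotvDr dotvZr; ring.
Qed.

Lemma jet2_cos (a : V) : jet2 (fun x => cos (dotv a x))
  (fun v x => - sin (dotv a x) * dotv a v) (fun v u x => - cos (dotv a x) * dotv a v * dotv a u).
Proof.
apply: (jet2_comp_dotv (phi := cos) (phi1 := fun y => - sin y) (phi2 := fun y => - cos y)).
by apply: continuous_opp_fun; exact: continuous_cos.
Qed.

Lemma jet2_sin (a : V) : jet2 (fun x => sin (dotv a x))
  (fun v x => cos (dotv a x) * dotv a v) (fun v u x => - sin (dotv a x) * dotv a v * dotv a u).
Proof.
apply: (jet2_comp_dotv (phi := sin) (phi1 := cos) (phi2 := fun y => - sin y)).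
by apply: continuous_opp_fun; exact: continuous_sin.
Qed.

Section SinPower.
Variables (k : R) (k2 : 2 <= k).
Let s (y : R) := sin (y / 2).
Let c (y : R) := cos (y / 2).
(** [q1] and [q2] are the first two derivatives of [|sin (y / 2)| ^ k], written without division by
    the sine so that they are continuous at its zeros too. *)
Let q1 (y : R) := k / 2 * (`|s y| `^ (k - 2) * s y) * c y.
Let q2 (y : R) := k / 4 * `|s y| `^ (k - 2) * ((k - 1) * c y ^+ 2 - s y ^+ 2).

Let ds y : is_derive y (1 : R) s (c y / 2).
Proof.
have D := @is_deriveM _ _ id (cst 2^-1) y (1 : R) _ _ (is_derive_id _ _) (is_derive_cst _ _ _).
have D1 := @is_derive1_comp R sin (fun y => y / 2) y _ _ (is_derive_sin _) D.
by apply: (is_derive_eq D1); rewrite scaler0 add0r [_ *: _]mulr1.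
Qed.

Let dc y : is_derive y (1 : R) c (- s y / 2).
Proof.
have D := @is_deriveM _ _ id (cst 2^-1) y (1 : R) _ _ (is_derive_id _ _) (is_derive_cst _ _ _).
have D1 := @is_derive1_comp R cos (fun y => y / 2) y _ _ (is_derive_cos _) D.
by apply: (is_derive_eq D1); rewrite scaler0 add0r [_ *: _]mulr1.
Qed.

Let cs : continuous s.
Proof. by move=> y; apply/differentiable_continuous/derivable1_diffP; case: (ds y). Qed.

Let cc : continuous c.
Proof. by move=> y; apply/differentiable_continuous/derivable1_diffP; case: (dc y). Qed.

Lemma jet2_sin_power (a : V) : jet2 (fun x => `|s (dotv a x)| `^ k)
  (fun v x => q1 (dotv a x) * dotv a v) (fun v u x => q2 (dotv a x) * dotv a v * dotv a u).
Proof.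
apply: (jet2_comp_dotv (phi := fun y => `|s y| `^ k)).
- have cp : continuous (fun y => `|s y| `^ (k - 2)).
    have k20 : 0 <= k - 2 by rewrite subr_ge0.
    exact: (continuous_comp_fun cs (continuous_norm_powR k20)).
  apply: continuous_mul_fun; first by apply: continuous_mul_fun => //; exact: continuous_cst_fun.
  apply: continuous_add_fun.
    apply: continuous_mul_fun; first exact: continuous_cst_fun.
    exact: continuous_mul_fun.
  by apply: continuous_opp_fun; exact: continuous_mul_fun.
- move=> y; have D := @is_derive1_comp R (fun z => `|z| `^ k) s y _ _ (is_derive_norm_powR_ge2 (s y)
    k2) (ds y).
  by apply: (is_derive_eq D); rewrite /q1; ring.
- move=> y; have k20 : 0 <= k - 2 by rewrite subr_ge0.
  have D1 := @is_derive1_comp R (fun z => `|z| `^ (k - 2) * z) s y _ _ (is_derive_norm_powR_mul (s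
      y) k20) (ds y).
  have D2 := @is_deriveM _ _ _ _ _ _ _ _ D1 (dc y).
  have D3 := @is_deriveM _ _ (cst (k / 2)) _ _ _ _ _ (is_derive_cst _ y (1 : R)) D2.
  have -> : q1 = cst (k / 2) * (((fun z => `|z| `^ (k - 2) * z) \o s) * c).
    by apply/funext => z; rewrite /q1 -mulrA.
  apply: (is_derive_eq D3).
  change (k / 2 * ((`|s y| `^ (k - 2) * s y) * (- s y / 2) + c y * ((k - 2 + 1) * `|s y| `^ (k -
      2) * (c y / 2)))
   + (`|s y| `^ (k - 2) * s y * c y) * 0 = q2 y).
  by rewrite /q2; field.
Qed.

Lemma jet2_sin_power_regular y : s y != 0 ->
  q1 y = `|s y| `^ k * (k / 2 * (c y / s y)) /\
  q2 y = `|s y| `^ k * ((k / 2 * (c y / s y)) ^+ 2 - k / 4 / s y ^+ 2).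
Proof.
move=> sy; rewrite /q1 /q2 -(norm_powR_mul2 k sy); split; first by field.
have cE : c y ^+ 2 = 1 - s y ^+ 2 by rewrite /c cos2sin2.
have -> : (k / 2 * (c y / s y)) ^+ 2 = k ^+ 2 / 4 * c y ^+ 2 / s y ^+ 2 by field.
by rewrite cE; field.
Qed.

End SinPower.

(** The jet is global; where no sine vanishes it is expressed by the logarithmic derivative [l]. The
    second derivative is [F] times the sum of [l v * l u] and the derivative of [l v] along [u], and
    [k / 2 * cot (y / 2)] has derivative [- k / 4 / sin (y / 2) ^ 2]. *)
Lemma jet2_sin_product (r : seq V) (k : V -> R) : (forall a, a \in r -> 2 <= k a) ->
  exists F1 F2, jet2 (fun x => \prod_(a <- r) `|sin (dotv a x / 2)| `^ k a) F1 F2 /\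
  forall x, (forall a, a \in r -> sin (dotv a x / 2) != 0) ->
    let F := \prod_(a <- r) `|sin (dotv a x / 2)| `^ k a in
    let l v := \sum_(a <- r) k a / 2 * (cos (dotv a x / 2) / sin (dotv a x / 2)) * dotv a v in
    (forall v, F1 v x = F * l v) /\
    (forall v u, F2 v u x = F * (l v * l u - \sum_(a <- r) k a / 4 / sin (dotv a x / 2) ^+ 2 * dotv
        a v * dotv a u)).
Proof.
elim: r => [_|a r IH kr].
  exists (fun _ _ => 0), (fun _ _ _ => 0); split.
    rewrite (_ : (fun x => _) = fun=> 1); first exact: jet2_cst.
    by apply/funext => x; rewrite big_nil.
  move=> x _ /=; split=> [v|v u]; first by rewrite !big_nil mulr0.
  by rewrite !big_nil mulr0 subr0 mulr0.
have sub b : b \in r -> b \in a :: r by rewrite in_cons => ->; rewrite orbT.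
have [F1 [F2 [J E]]] := IH (fun b br => kr b (sub b br)).
have ka : 2 <= k a by apply: kr; rewrite mem_head.
have Ja := jet2_sin_power ka a.
have JM := jet2M Ja J.
eexists; eexists; split.
  rewrite (_ : (fun x => \prod_(_ <- _) _) = fun x => `|sin (dotv a x / 2)| `^ k a * \prod_(a0 <- r)
      `|sin (dotv a0 x / 2)| `^ k a0).
    exact: JM.
  by apply/funext => x; rewrite big_cons.
move=> x xr /=.
have [] := E x (fun b br => xr b (sub b br)).
have [/= -> ->] := jet2_sin_power_regular (k a) (xr a (mem_head _ _)).
set G := \prod_(_ <- r) _ => e1 e2; split=> [v|v u]; rewrite !big_cons -/G !e1 ?e2.
  by ring.
by ring.
Qed.

End Jets.

(** * Trigonometric polynomials *)

Lemma Rintegral_sum d (T : measurableType d) (R : realType) (P : probability T R)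
  (I : eqType) (r : seq I) (F : I -> T -> R) :
  (forall i, i \in r -> P.-integrable setT (EFin \o F i)) ->
  P.-integrable setT (EFin \o (fun t => \sum_(i <- r) F i t)) /\
  (\int[P]_t (\sum_(i <- r) F i t) = \sum_(i <- r) \int[P]_t F i t)%R.
Proof.
elim: r => [_|i r IH iF].
  have -> : (fun t => \sum_(i <- [::]) F i t) = cst 0 by apply/funext => t; rewrite big_nil.
  rewrite big_nil Rintegral_cst // mul0r; split=> //.
  exact: finite_measure_integrable_cst.
have [|i1 i2] := IH; first by move=> j jr; apply: iF; rewrite in_cons jr orbT.
have ii := iF i (mem_head _ _).
have -> : (fun t => \sum_(j <- i :: r) F j t) = (fun t => F i t + \sum_(j <- r) F j t).
  by apply/funext => t; rewrite big_cons.
rewrite big_cons RintegralD // i2; split=> //.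
exact: (integrableD measurableT ii i1).
Qed.

Section TrigPoly.
Variables (R : realType) (n : nat) (Phi : {fset 'rV[R]_n}).
Local Notation V := 'rV[R]_n.
Local Notation T := (torus Phi).
Local Notation tpi := (@torus_pi R n Phi).
Hypothesis rs : reduced_crystallographic_root_system Phi.

Lemma weight0 : weight_lattice Phi (0 : V).
Proof. by move=> a aP; rewrite dotv0l. Qed.

Lemma weightD (l m : V) : weight_lattice Phi l -> weight_lattice Phi m -> weight_lattice Phi (l + m).
Proof. by move=> lP mP a aP; rewrite dotvDl rpredD // ?lP ?mP. Qed.

Lemma weightN (l : V) : weight_lattice Phi l -> weight_lattice Phi (- l).
Proof. by move=> lP a aP; rewrite dotvNl rpredN // lP. Qed.

Lemma expo_tpi l x : weight_lattice Phi l -> expo l (tpi x) = cos (dotv l x) +i* sin (dotv l x).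
Proof.
move=> lP; rewrite /expo.
rewrite (periodic_repr (F := fun x => cos (dotv l x))) //; last exact: periodic_cos.
by rewrite (periodic_repr (F := fun x => sin (dotv l x))) //; exact: periodic_sin.
Qed.

Lemma expoD l m (t : T) : expo (l + m) t = expo l t * expo m t.
Proof.
rewrite /expo dotvDl cosD sinD; simpc; congr (_ +i* _).
by rewrite addrC.
Qed.

Lemma expo0 (t : T) : expo 0 t = 1.
Proof. by rewrite /expo dotv0l cos0 sin0. Qed.

Lemma expoN l (t : T) : expo (- l) t = (expo l t)^*.
Proof. by rewrite /expo dotvNl cosN sinN. Qed.

Lemma trig_polyD_expo (f : T -> R[i]) c l : trig_poly Phi f -> weight_lattice Phi l ->
  trig_poly Phi (fun t => f t + c * expo l t).
Proof.
move=> [s [d [sP ->]]] lP; exists (l |` s)%fset.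
(* The values of [d] outside [s] are arbitrary and must not be picked up at [l] when [l] is new. *)
exists (fun m => (if m \in s then d m else 0) + (if m == l then c else 0)); split.
  by move=> m; rewrite !inE => /orP[/eqP ->//|]; exact: sP.
apply/funext => t; under [RHS]eq_bigr do rewrite mulrDl.
rewrite big_split /=; congr (_ + _).
  rewrite [RHS](big_fsetID _ (mem s)) /= [X in _ = _ + X]big1_fset ?addr0.
    rewrite (_ : [fset x in (l |` s)%fset | x \in s]%fset = s).
      by apply: eq_big_seq => m ->.
    by apply/fsetP => m; rewrite !inE /= andbC; case: (m \in s); rewrite ?orbT.
  by move=> m; rewrite !inE /= => /andP[_ /negPf ->]; rewrite mul0r.
rewrite (big_fsetD1 l) /= ?fset1U1 // eqxx big1_fset ?addr0 // => m.
by rewrite !inE => /andP[/negPf -> _]; rewrite mul0r.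
Qed.

Lemma trig_poly0 : trig_poly Phi (fun=> 0).
Proof.
exists fset0, (fun=> 0); split=> [l|]; first by rewrite inE.
by apply/funext => t; rewrite big_seq_fset0.
Qed.

Lemma trig_polyD (f g : T -> R[i]) : trig_poly Phi f -> trig_poly Phi g ->
  trig_poly Phi (fun t => f t + g t).
Proof.
move=> fT [s [d [sP ->]]].
have H (r : seq V) : {subset r <= s} -> trig_poly Phi (fun t => f t + \sum_(l <- r) d l * expo l t).
  elim: r => [_|l r IH rs'].
    by under eq_fun do rewrite big_nil addr0.
  under eq_fun do rewrite big_cons addrA addrAC.
  apply: trig_polyD_expo; first by apply: IH => m mr; apply: rs'; rewrite in_cons mr orbT.
  by apply: sP; apply: rs'; rewrite mem_head.
exact: (H s).
Qed.

Lemma trig_poly_sum I (r : seq I) (F : I -> T -> R[i]) : (forall i, trig_poly Phi (F i)) ->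
  trig_poly Phi (fun t => \sum_(i <- r) F i t).
Proof.
move=> FT; elim: r => [|i r IH].
  by under eq_fun do rewrite big_nil; exact: trig_poly0.
by under eq_fun do rewrite big_cons; exact: trig_polyD.
Qed.

Lemma trig_poly_sum_seq (I : eqType) (r : seq I) (F : I -> T -> R[i]) :
  (forall i, i \in r -> trig_poly Phi (F i)) ->
  trig_poly Phi (fun t => \sum_(i <- r) F i t).
Proof.
elim: r => [_|i r IH FT].
  by under eq_fun do rewrite big_nil; exact: trig_poly0.
under eq_fun do rewrite big_cons; apply: trig_polyD; first by apply: FT; rewrite mem_head.
by apply: IH => j jr; apply: FT; rewrite in_cons jr orbT.
Qed.

Lemma trig_poly_expo c l : weight_lattice Phi l -> trig_poly Phi (fun t => c * expo l t).
Proof.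
move=> lP; have := trig_polyD_expo c trig_poly0 lP.
by under eq_fun do rewrite add0r.
Qed.

Lemma trig_polyM (f g : T -> R[i]) : trig_poly Phi f -> trig_poly Phi g ->
  trig_poly Phi (fun t => f t * g t).
Proof.
move=> [s [d [sP ->]]] [s' [d' [sP' ->]]].
under eq_fun do rewrite big_distrlr /=.
apply: trig_poly_sum_seq => l ls; apply: trig_poly_sum_seq => m ms.
rewrite (_ : (fun _ => _) = fun t => (d l * d' m) * expo (l + m) t).
  by apply/trig_poly_expo/weightD; [exact: sP|exact: sP'].
by apply/funext => t; rewrite expoD mulrACA.
Qed.

Lemma trig_poly_cst c : trig_poly Phi (fun=> c).
Proof.
have := trig_poly_expo c weight0.
by under eq_fun do rewrite expo0 mulr1.
Qed.

Lemma trig_poly_conj (f : T -> R[i]) : trig_poly Phi f -> trig_poly Phi (fun t => (f t)^*).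
Proof.
move=> [s [d [sP ->]]]; under eq_fun do rewrite rmorph_sum.
apply: trig_poly_sum_seq => l ls.
rewrite (_ : (fun _ => _) = fun t => (d l)^* * expo (- l) t).
  by apply/trig_poly_expo/weightN/sP.
by apply/funext => t; rewrite rmorphM expoN.
Qed.

Definition real_trig_poly (p : T -> R) : Prop := trig_poly Phi (fun t => (p t)%:C).

Lemma real_trig_polyD p q : real_trig_poly p -> real_trig_poly q ->
  real_trig_poly (fun t => p t + q t).
Proof.
by rewrite /real_trig_poly => pT qT; under eq_fun do rewrite rmorphD; exact: trig_polyD.
Qed.

Lemma real_trig_polyM p q : real_trig_poly p -> real_trig_poly q ->
  real_trig_poly (fun t => p t * q t).
Proof.
by rewrite /real_trig_poly => pT qT; under eq_fun do rewrite rmorphM; exact: trig_polyM.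
Qed.

Lemma real_trig_poly_cst c : real_trig_poly (fun=> c).
Proof. exact: trig_poly_cst. Qed.

Lemma real_trig_polyX p m : real_trig_poly p -> real_trig_poly (fun t => p t ^+ m).
Proof.
move=> pT; elim: m => [|m IH]; first exact: real_trig_poly_cst.
by under eq_fun do rewrite exprS; exact: real_trig_polyM.
Qed.

Lemma real_trig_poly_sum I (r : seq I) (F : I -> T -> R) : (forall i, real_trig_poly (F i)) ->
  real_trig_poly (fun t => \sum_(i <- r) F i t).
Proof.
rewrite /real_trig_poly => FT; under eq_fun do rewrite rmorph_sum.
exact: trig_poly_sum.
Qed.

Lemma trig_poly_Re (f : T -> R[i]) : trig_poly Phi f -> real_trig_poly (fun t => complex.Re (f t)).
Proof.
move=> fT; rewrite /real_trig_poly.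
rewrite (_ : (fun _ => _) = fun t => (2^-1)%:C * (f t + (f t)^*)).
  by apply: trig_polyM; [exact: trig_poly_cst|apply: trig_polyD => //; exact: trig_poly_conj].
apply/funext => t; case: (f t) => x y; simpc.
by have -> : 2^-1 * (x + x) = x by field.
Qed.

Lemma trig_poly_Im (f : T -> R[i]) : trig_poly Phi f -> real_trig_poly (fun t => complex.Im (f t)).
Proof.
move=> fT; have := trig_poly_Re (trig_polyM (trig_poly_cst (0 -i* 1)) fT).
rewrite /real_trig_poly; under eq_fun => t.
  have -> : complex.Re ((0 -i* 1) * f t) = complex.Im (f t).
    by case: (f t) => x y; simpc => /=.
  over.
by [].
Qed.

Lemma real_trig_poly_cos l : weight_lattice Phi l -> real_trig_poly (fun t => cos (dotv l (repr t))).
Proof. by move=> /(trig_poly_expo 1)/trig_poly_Re; under eq_fun do rewrite mul1r. Qed.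

Lemma real_trig_poly_sin l : weight_lattice Phi l -> real_trig_poly (fun t => sin (dotv l (repr t))).
Proof. by move=> /(trig_poly_expo 1)/trig_poly_Im; under eq_fun do rewrite mul1r. Qed.

Lemma real_trig_polyE p : real_trig_poly p -> exists (s : {fset V}) (c d : V -> R),
  (forall l, l \in s -> weight_lattice Phi l) /\
  p = fun t => \sum_(l <- s) (c l * cos (dotv l (repr t)) + d l * sin (dotv l (repr t))).
Proof.
move=> [s [c [sP e]]]; exists s, (fun l => complex.Re (c l)), (fun l => - complex.Im (c l)).
split=> //; apply/funext => t; have := congr1 (fun f => complex.Re (f t)) e.
rewrite /= => ->; rewrite raddf_sum /=; apply: eq_bigr => l _.
by rewrite /expo; case: (c l) => x y /=; rewrite mulNr.
Qed.

Lemma torus_act_tpi w x : weyl Phi w -> torus_act w (tpi x) = tpi (w x).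
Proof.
move=> ww; apply/torus_piP; rewrite -(weylB _ _ ww).
have /torus_piP/asboolP[q qL ->] := torus_piK (tpi x).
rewrite (weylZ _ _ ww); apply/asboolP; exists (w q) => //.
exact: weyl_coroot_lattice.
Qed.

Lemma expo_act w w' l (t : T) : weyl Phi w -> weyl Phi w' -> cancel w' w ->
  weight_lattice Phi l -> expo l (torus_act w t) = expo (w' l) t.
Proof.
move=> ww ww' c2 lP; have wlP : weight_lattice Phi (w' l) by exact: weyl_weight.
rewrite -(torus_piK t) torus_act_tpi // !expo_tpi //.
by rewrite -{1 2}(c2 l) !(weyl_dotv rs).
Qed.

Lemma trig_poly_act w (f : T -> R[i]) : weyl Phi w -> trig_poly Phi f ->
  trig_poly Phi (fun t => f (torus_act w t)).
Proof.
move=> ww [s [d [sP ->]]]; apply: trig_poly_sum_seq => l ls.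
have [w' [ww' c1 c2]] := weyl_inv rs ww.
rewrite (_ : (fun t => _) = fun t => d l * expo (w' l) t).
  by apply/trig_poly_expo/weyl_weight => //; exact: sP.
by apply/funext => t; congr (_ * _); apply: expo_act => //; exact: sP.
Qed.

Lemma real_trig_poly_continuous p : real_trig_poly p ->
  exists F : V -> R, [/\ continuous F, torus_periodic Phi F & p = fun t => F (repr t)].
Proof.
move=> /real_trig_polyE[s [c [d [sP ->]]]].
pose G l x := c l * cos (dotv l x) + d l * sin (dotv l x).
exists (fun x => \sum_(l <- s) G l x); split=> //.
  apply: continuous_sum_fun => l; apply: continuous_add_fun; apply: continuous_mul_fun;
    try exact: continuous_cst_fun.
    exact: (continuous_comp_fun (@dotv_continuous R n l) (@continuous_cos R)).
  exact: (continuous_comp_fun (@dotv_continuous R n l) (@continuous_sin R)).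
move=> x q qL; apply: eq_big_seq => l /sP lP; rewrite /G.
by rewrite (periodic_cos lP x qL) (periodic_sin lP x qL).
Qed.

Lemma real_trig_poly_measurable p : real_trig_poly p -> measurable_fun setT p.
Proof. by move=> /real_trig_poly_continuous[F [cF pF ->]]; exact: torus_measurable. Qed.

Lemma real_trig_poly_bounded p : real_trig_poly p -> exists M : R, forall t, `|p t| <= M.
Proof.
move=> /real_trig_poly_continuous[F [cF pF ->]].
by have [M FM] := periodic_bounded rs pF cF; exists M.
Qed.

Lemma torus_act_measurable w : weyl Phi w -> measurable_fun setT (torus_act w : T -> T).
Proof.
move=> ww; apply: (measurability (@open T)) => // _ [A oA <-].
rewrite setTI; apply: sub_sigma_algebra.
suff : continuous (torus_act w : T -> T) by move/continuousP; exact.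
apply/quotient_continuous.
have -> : torus_act w \o \pi_T%qT = tpi \o w.
  by apply/funext => x /=; rewrite -torus_act_tpi.
apply: (continuous_comp_fun (f := w)); last exact: pi_continuous.
exact: linear_rV_continuous (weyl_linear ww).
Qed.

Section Haar.
Variable mu : probability T R.
Hypothesis mu_Haar : normalized_Haar mu.

Lemma real_trig_poly_integrable p : real_trig_poly p -> mu.-integrable setT (EFin \o p).
Proof.
move=> pT; have [M pM] := real_trig_poly_bounded pT.
exact: bounded_integrable (real_trig_poly_measurable pT) pM.
Qed.

(** Translation by a multiple of [l] shifts [dotv l x] by [pi], which changes the sign of both
    functions and leaves their integrals unchanged. *)
Lemma integral_cos_sin l : weight_lattice Phi l -> l != 0 ->
  (\int[mu]_t cos (dotv l (repr t)) = 0)%R /\ (\int[mu]_t sin (dotv l (repr t)) = 0)%R.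
Proof.
move=> lP l0; have ll : dotv l l != 0 by rewrite dotv_eq0.
pose v := (trigo.pi / dotv l l) *: l.
have lv x : dotv l (x + v) = dotv l x + trigo.pi by rewrite dotvDr dotvZr mulfVK.
have cdot := @dotv_continuous R n l.
have cc := continuous_comp_fun cdot (@continuous_cos R).
have cs := continuous_comp_fun cdot (@continuous_sin R).
have ic := periodic_integrable mu rs (periodic_cos lP) cc.
have is_ := periodic_integrable mu rs (periodic_sin lP) cs.
have hc := Haar_shift_real mu_Haar v (periodic_cos lP) cc ic.
have hs := Haar_shift_real mu_Haar v (periodic_sin lP) cs is_.
split.
  move: hc; under eq_Rintegral => t _ do rewrite lv cosDpi -mulN1r.
  by rewrite RintegralZl //; lra.
move: hs; under eq_Rintegral => t _ do rewrite lv sinDpi -mulN1r.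
by rewrite RintegralZl //; lra.
Qed.

Lemma integral_real_trig_poly_act p w : real_trig_poly p -> weyl Phi w ->
  (\int[mu]_t p (torus_act w t) = \int[mu]_t p t)%R.
Proof.
move=> /real_trig_polyE[s [c [d [sP ->]]]] ww.
have [w' [ww' c1 c2]] := weyl_inv rs ww.
have act l (t : T) : l \in s -> cos (dotv l (repr (torus_act w t))) = cos (dotv (w' l) (repr t))
   /\ sin (dotv l (repr (torus_act w t))) = sin (dotv (w' l) (repr t)).
  by move=> ls; have := expo_act t ww ww' c2 (sP _ ls); rewrite /expo => -[-> ->].
have I l : weight_lattice Phi l ->
   [/\ mu.-integrable setT (EFin \o (fun t : T => cos (dotv l (repr t)))) ,
   mu.-integrable setT (EFin \o (fun t : T => sin (dotv l (repr t)))) &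
   forall a b, (\int[mu]_t (a * cos (dotv l (repr t)) + b * sin (dotv l (repr t))) = a *+ (l == 0))%R].
  move=> lP.
  have i1 := real_trig_poly_integrable (real_trig_poly_cos lP).
  have i2 := real_trig_poly_integrable (real_trig_poly_sin lP).
  split=> // a b.
  have [->|l0] := eqVneq l 0.
    under eq_Rintegral do rewrite dotv0l cos0 sin0 mulr0 addr0 mulr1.
    rewrite Rintegral_cst //.
    by rewrite [X in fine X](_ : _ = 1%E) ?mulr1 //; exact: probability_setT.
  have [e1 e2] := integral_cos_sin lP l0.
  rewrite RintegralD //; last 2 first.
  - exact: (integrableZl measurableT a i1).
  - exact: (integrableZl measurableT b i2).
  by rewrite !RintegralZl // e1 e2 !mulr0 addr0 mulr0n.
(* Only the terms with [G l = 0] survive. This is used with [id] and with [w'], which vanish at the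
   same [l]. *)
have S (G : V -> V) : (forall l, l \in s -> weight_lattice Phi (G l)) ->
  (\int[mu]_t (\sum_(l <- s) (c l * cos (dotv (G l) (repr t)) + d l * sin (dotv (G l) (repr t)))) =
   \sum_(l <- s) c l *+ (G l == 0))%R.
  move=> GP; rewrite (Rintegral_sum _).2.
    by apply: eq_big_seq => l /GP/I[_ _ ->].
  move=> l /GP/I[i1 i2 _].
  apply: (@integrableD _ _ _ mu _ measurableT (EFin \o (fun t => c l * cos (dotv (G l) (repr t))))
      (EFin \o (fun t => d l * sin (dotv (G l) (repr t))))).
    exact: (integrableZl measurableT (c l) i1).
  exact: (integrableZl measurableT (d l) i2).
rewrite (S id sP).
transitivity (\int[mu]_t (\sum_(l <- s) (c l * cos (dotv (w' l) (repr t)) + d l * sin (dotv (w' l)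
    (repr t))))).
  by apply: eq_Rintegral => t _; apply: eq_big_seq => l /(act l t)[-> ->].
rewrite (S w'); last by move=> l ls; apply: weyl_weight => //; exact: sP.
apply: eq_bigr => l _; congr (_ *+ _); congr nat_of_bool.
apply/eqP/eqP => [h|->]; last exact: weyl0 ww'.
by rewrite -(c2 l) h (weyl0 ww).
Qed.

End Haar.
End TrigPoly.

(** * Density of trigonometric polynomials *)

Section Gate.
Variable R : realType.
Implicit Types (p y : R) (m : nat).

Lemma sqr_sub_triangle (a b c : R) : (a - c) ^+ 2 <= 2 * (a - b) ^+ 2 + 2 * (b - c) ^+ 2.
Proof. by have := sqr_ge0 ((a - b) - (b - c)); rewrite !expr2; lra. Qed.

Lemma lt_double_quarters (a b e : R) : a < e / 4 -> b < e / 4 -> 2 * a + 2 * b < e.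
Proof. lra. Qed.

Lemma norm_parts (a : R) : a = 2^-1 * (`|a| + a) + (- 2^-1) * (`|a| - a).
Proof. by field. Qed.

Lemma norm_parts_ge0 (a : R) : 0 <= `|a| + a /\ 0 <= `|a| - a.
Proof. by have := ler_norm a; have := ler_norm (- a); rewrite normrN; lra. Qed.

Lemma bernoulli_ge y m : -1 <= y -> 1 + m%:R * y <= (1 + y) ^+ m.
Proof.
move=> y1; elim: m => [|m IH]; first by rewrite mul0r addr0 expr0.
have : (1 + y) * (1 + m%:R * y) <= (1 + y) ^+ m.+1.
  by rewrite exprS ler_wpM2l //; lra.
apply: le_trans; rewrite -natr1.
have : 0 <= m%:R * y ^+ 2 by rewrite mulr_ge0 // sqr_ge0.
by rewrite expr2; lra.
Qed.

(* For [m] large this is close to [1] when [p < 1/2] and to [0] when [p >= 1/2]; composing it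
   with a polynomial turns trigonometric polynomials into approximate indicator functions. *)
Definition gate m p := (1 - p ^+ m) ^+ (m * 2 ^ m).

Lemma gate01 m p : 0 <= p <= 1 -> 0 <= gate m p <= 1.
Proof.
move=> /andP[p0 p1]; have h0 : 0 <= p ^+ m by rewrite exprn_ge0.
have h1 : p ^+ m <= 1 by rewrite exprn_ile1.
by rewrite exprn_ge0 ?exprn_ile1 //; lra.
Qed.

(** With [y = sqrt z], [m y ^ m] is at most the geometric sum of the [y ^ i], hence at most
    [1 / (1 - y)], and the second factor [y ^ m] tends to zero. *)
Lemma cvg_nat_expr_lt1 (z : R) : 0 <= z < 1 -> (fun m => m%:R * z ^+ m) @ \oo --> (0 : R).
Proof.
move=> /andP[z0 z1]; pose y := Num.sqrt z.
have y0 : 0 <= y by exact: sqrtr_ge0.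
have yz : y ^+ 2 = z by rewrite sqr_sqrtr.
have y1 : y < 1 by rewrite -(@sqrtr1 R) ltr_sqrt.
have bnd m : m%:R * z ^+ m <= (1 - y)^-1 * y ^+ m.
  rewrite -yz -exprM mul2n -addnn exprD mulrA ler_wpM2r ?exprn_ge0 //.
  rewrite -[X in _ <= X]mul1r ler_pdivlMr; last lra.
  have : (1 - y) * \sum_(i < m) y ^+ i <= 1.
    have := subrX1 y m; have : 0 <= y ^+ m by rewrite exprn_ge0.
    set S := \sum_(_ < _) _; lra.
  apply: le_trans; rewrite mulrC ler_wpM2l; first by []. by lra.
  have -> : m%:R * y ^+ m = \sum_(i < m) y ^+ m by rewrite sumr_const card_ord mulr_natl.
  apply: ler_sum => i _; apply: ler_wiXn2l => //; [exact: ltW|exact: ltnW].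
have cv : (fun m => (1 - y)^-1 * y ^+ m) @ \oo --> (0 : R).
  rewrite -(mulr0 (1 - y)^-1); apply: cvgM; [exact: cvg_cst|apply: cvg_expr].
  by rewrite ger0_norm.
have h : \forall m \near \oo, (0 : R) <= m%:R * z ^+ m <= (1 - y)^-1 * y ^+ m.
  by apply: nearW => m; rewrite bnd mulr_ge0 ?exprn_ge0.
have c0 : (fun _ : nat => (0 : R)) @ \oo --> (0 : R) by exact: cvg_cst.
exact: (squeeze_cvgr h c0 cv).
Qed.

(** Bernoulli's inequality bounds the gate below by [1 - m 2 ^ m p ^ m = 1 - m (2 p) ^ m]. *)
Lemma cvg_gate_lt p : 0 <= p < 2^-1 -> (fun m => gate m p) @ \oo --> (1 : R).
Proof.
move=> /andP[p0 p1].
have z01 : 0 <= 2 * p < 1 by lra.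
have cv : (fun m => 1 - m%:R * (2 * p) ^+ m) @ \oo --> (1 : R).
  rewrite -[X in _ --> X]subr0; apply: cvgB; first exact: cvg_cst.
  exact: cvg_nat_expr_lt1.
suff h : \forall m \near \oo, 1 - m%:R * (2 * p) ^+ m <= gate m p <= 1.
  have c1 : (fun _ : nat => (1 : R)) @ \oo --> (1 : R) by exact: cvg_cst.
  exact: (squeeze_cvgr h cv c1).
apply: nearW => m.
have p01 : 0 <= p <= 1 by lra.
have /andP[_ ->] := gate01 m p01; rewrite andbT /gate.
have := @bernoulli_ge (- p ^+ m) (m * 2 ^ m)%N _.
rewrite mulrN natrM natrX -mulrA -exprMn; apply.
by rewrite lerN2 exprn_ile1 //; lra.
Qed.

(** Since [(1 - y) ^ N (1 + y) ^ N <= 1], Bernoulli's inequality for [1 + y] bounds the gate by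
    [1 / (m + 1)]. The factor [m] in the exponent provides this decay at [p = 1/2], where
    [2 ^ m p ^ m = 1]. *)
Lemma cvg_gate_ge p : 2^-1 <= p <= 1 -> (fun m => gate m p) @ \oo --> (0 : R).
Proof.
move=> /andP[p0 p1].
suff h : \forall m \near \oo, 0 <= gate m p <= harmonic m.
  have c0 : (fun _ : nat => (0 : R)) @ \oo --> (0 : R) by exact: cvg_cst.
  exact: (squeeze_cvgr h c0 cvg_harmonic).
apply: nearW => m.
have p01 : 0 <= p <= 1 by lra.
have /andP[-> _] := gate01 m p01; rewrite /= /gate /harmonic.
set N := (m * 2 ^ m)%N; set y := p ^+ m.
have y0 : 0 <= y by rewrite exprn_ge0 //; lra.
have y1 : y <= 1 by rewrite exprn_ile1 //; lra.
have h1 : (1 - y) ^+ N * (1 + y) ^+ N <= 1.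
  rewrite -exprMn exprn_ile1 //; first by rewrite mulr_ge0; lra.
  by have := sqr_ge0 y; rewrite expr2; lra.
have h2 : m%:R + 1 <= (1 + y) ^+ N.
  apply: le_trans (@bernoulli_ge y N _); last lra.
  rewrite addrC lerD2l /N natrM natrX -mulrA ler_peMr // -exprMn exprn_ege1 //; lra.
rewrite -[X in _ <= X]mul1r ler_pdivlMr ?ltr0n // -natr1.
apply: le_trans h1; rewrite ler_wpM2l // exprn_ge0 //; lra.
Qed.

End Gate.

(** * Indicator functions as limits of trigonometric polynomials, and approximation in mean
    square *)

Section Density.
Variables (R : realType) (n : nat) (Phi : {fset 'rV[R]_n}).
Local Notation V := 'rV[R]_n.
Local Notation T := (torus Phi).
Local Notation tpi := (@torus_pi R n Phi).
Hypothesis rs : reduced_crystallographic_root_system Phi.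
Local Notation rtp := (@real_trig_poly R n Phi).

(** The uniform bound is there for dominated convergence; products of the approximating polynomials
    give intersections. *)
Definition bounded_limit (A : set T) : Prop := measurable A /\
  exists (M : R) (p : nat -> T -> R), [/\ forall j, rtp (p j), forall j t, `|p j t| <= M &
    forall t, p ^~ t @ \oo --> (\1_A t : R)].

Lemma bounded_limitI A B : bounded_limit A -> bounded_limit B -> bounded_limit (A `&` B).
Proof.
move=> [mA [M [p [pT pM pA]]]] [mB [N [q [qT qN qB]]]]; split; first exact: measurableI.
exists (M * N), (fun j t => p j t * q j t); split.
- by move=> j; exact: real_trig_polyM.
- by move=> j t; rewrite normrM ler_pM.
- by move=> t; rewrite indicI; apply: cvgM; [exact: pA|exact: qB].
Qed.

Lemma bounded_limit_lt0 g : rtp g -> bounded_limit [set t | g t < 0].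
Proof.
move=> gT; have mg := real_trig_poly_measurable gT.
split.
  rewrite (_ : [set t | _] = setT `&` g @^-1` `]-oo, 0[); first exact: mg.
  by rewrite setTI; apply/seteqP; split=> t /=; rewrite in_itv.
have [M gM] := real_trig_poly_bounded rs gT.
pose M' : R := `|M| + 1; have M0 : 0 < M' by rewrite /M'; have := normr_ge0 M; lra.
have gM' t : `|g t| <= M' by apply: le_trans (gM t) _; rewrite /M'; have := ler_norm M; lra.
(* An affine rescaling of [g] into the unit interval for which [g t < 0] means [p t < 1/2], the
   threshold of the gate. *)
pose p t := 2^-1 * (1 + g t / M').
have p01 t : 0 <= p t <= 1.
  have : `|g t / M'| <= 1 by rewrite normrM normfV (gtr0_norm M0) ler_pdivrMr // mul1r.
  by rewrite /p ler_norml => /andP[h1 h2]; lra.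
exists 1, (fun j t => gate j (p t)); split.
- move=> j; rewrite /gate /p.
  apply/real_trig_polyX; under eq_fun do rewrite -mulN1r.
  apply: real_trig_polyD; first exact: real_trig_poly_cst.
  apply: real_trig_polyM; first exact: real_trig_poly_cst.
  apply/real_trig_polyX/real_trig_polyM; first exact: real_trig_poly_cst.
  apply: real_trig_polyD; first exact: real_trig_poly_cst.
  by apply: real_trig_polyM => //; exact: real_trig_poly_cst.
- by move=> j t; have /andP[h1 h2] := gate01 j (p01 t); rewrite ger0_norm.
- move=> t; have /andP[h1 h2] := p01 t; rewrite indicE.
  have [g0|g0] := ltP (g t) 0.
    rewrite mem_set //; apply: cvg_gate_lt; rewrite h1 /p /=.
    have : g t / M' < 0 by rewrite pmulr_llt0 // invr_gt0.
    by lra.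
  rewrite memNset /=; last by move/lt_geF; rewrite g0.
  apply: cvg_gate_ge; rewrite h2 andbT /p.
  have : 0 <= g t / M' by rewrite divr_ge0 // ltW.
  by lra.
Qed.

(** Reduce [u] to the interval from [- pi] to [pi], on which the cosine decreases with the absolute
    value. *)
Lemma cos_near_period (d u : R) : 0 < d <= trigo.pi -> cos d < cos u ->
  exists k : int, `|u - k%:~R * (2 * trigo.pi)| < d.
Proof.
move=> /andP[d0 dpi] du.
have pi0 := trigo.pi_gt0 R.
pose k := Num.floor ((u + trigo.pi) / (2 * trigo.pi)); exists k.
have pp : 0 < 2 * trigo.pi :> R by lra.
have := floor_itv ((u + trigo.pi) / (2 * trigo.pi)); rewrite -/k => /andP[].
rewrite ler_pdivlMr // ltr_pdivrMr // intrD1 => h1 h2.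
set v := u - _.
have vE : cos `|v| = cos u.
  rewrite /v -[RHS](cosD_int u (- k)) intrN mulNr.
  by have [_|_] := ger0P (u - _) ; rewrite ?cosN.
have vb : `|v| <= trigo.pi by rewrite ler_norml /v; apply/andP; split; lra.
rewrite -vE ltr_cos // in du.
- by rewrite in_itv /= normr_ge0.
- by rewrite in_itv /= (ltW d0).
Qed.

(** The coordinates with respect to [B] are pairings with the dual basis, which consists of weights
    because coroots have integer coordinates. Cosines and sines of coordinates are therefore
    functions on the torus. *)
Lemma dual_basis : exists B : 'M[R]_n, [/\ B \in unitmx,
  forall z : 'rV[int]_n, coroot_lattice Phi (map_mx intr z *m B) &
  forall i, exists l, weight_lattice Phi l /\ forall y : V, dotv l (y *m B) = y 0 i].
Proof.
have [B [Bu BL BP]] := coroot_basis rs; exists B; split=> // i.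
pose l : V := row i (invmx B)^T.
have lE (y : V) : dotv l (y *m B) = y 0 i.
  have -> : dotv l (y *m B) = (y *m B *m invmx B) 0 i.
    by rewrite [RHS]mxE /dotv; apply: eq_bigr => j _; rewrite !mxE mulrC.
  by rewrite mulmxK.
by exists l; split=> // a /BP[z ->]; rewrite lE mxE.
Qed.

(** The condition [g (q, m) t < 0] says that the sum of the [1 - cos (y_i - q_i)] is below
    [1 / (m + 1)], so it keeps all coordinates near the rational point [q] modulo [2 pi]. There are
    countably many such neighbourhoods, and every open set is a union of some of them. *)
Lemma borel_bounded_limit : @measurable _ T = <<s bounded_limit >>.
Proof.
apply/seteqP; split; last first.
  apply: smallest_sub; first exact: sigma_algebra_measurable.
  by move=> A [].
apply: smallest_sub; first exact: smallest_sigma_algebra.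
move=> U oU.
have [B [Bu BL BP]] := dual_basis.
pose l i := projT1 (cid (BP i)).
have lP i : weight_lattice Phi (l i) by rewrite /l; case: cid => ? [].
have lE i (y : V) : dotv (l i) (y *m B) = y 0 i by rewrite /l; case: cid => ? [].
pose g (qm : 'rV[rat]_n * nat) (t : T) := \sum_(i < n)
  (1 - (cos (ratr (qm.1 0 i)) * cos (dotv (l i) (repr t)) + sin (ratr (qm.1 0 i)) * sin (dotv (l i)
      (repr t))))
  - qm.2.+1%:R^-1.
have gT qm : rtp (g qm).
  apply: real_trig_polyD; last exact: real_trig_poly_cst.
  apply: real_trig_poly_sum => i; apply: real_trig_polyD; first exact: real_trig_poly_cst.
  under eq_fun do rewrite -mulN1r.
  apply: real_trig_polyM; first exact: real_trig_poly_cst.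
  by apply: real_trig_polyD; apply: real_trig_polyM; try exact: real_trig_poly_cst;
    [exact: real_trig_poly_cos|exact: real_trig_poly_sin].
have gE qm (y : V) : g qm (tpi (y *m B)) = \sum_(i < n) (1 - cos (y 0 i - ratr (qm.1 0 i))) -
    qm.2.+1%:R^-1.
  congr (_ - _); apply: eq_bigr => i _.
  have := expo_tpi (y *m B) (lP i); rewrite /expo lE => -[-> ->].
  by rewrite cosB; ring.
pose W qm := [set t | g qm t < 0].
(* [unpickle] enumerates the pairs of a centre and a radius; those whose neighbourhood leaves [U]
   contribute the empty set. *)
pose F (k : nat) := if choice.unpickle k is Some qm then (if `[< W qm `<=` U >] then W qm else set0)
    else set0.
have FP k : <<s bounded_limit >> (F k).
  rewrite /F; case: choice.unpickle => [qm|]; last exact: sigma_algebra0.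
  case: ifP => _; last exact: sigma_algebra0.
  by apply: sub_gen_smallest; exact: bounded_limit_lt0.
suff -> : U = \bigcup_k F k by exact: sigma_algebra_bigcup.
apply/seteqP; split=> [t Ut|t [k _]]; last first.
  by rewrite /F; case: choice.unpickle => // qm; case: asboolP => // WU /WU.
pose y0 := repr t *m invmx B.
have ty0 : tpi (y0 *m B) = t by rewrite mulmxKV // torus_piK.
have : nbhs y0 [set y : V | U (tpi (y *m B))].
  have c : continuous (fun y : V => tpi (y *m B) : T).
    apply: (continuous_comp_fun (f := fun y : V => y *m B)); last exact: pi_continuous.
    by apply: linear_rV_continuous => c x y; rewrite mulmxDl scalemxAl.
  by apply: c; rewrite ty0; apply: open_nbhs_nbhs.
move=> /nbhs_ballP[d0 /= d00 dU].
(* Halved so that the distances from a point to the rational centre and from the centre to [y0] add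
   up to less than [d0], and at most [pi] because the cosine is monotone up to [pi]. *)
pose d := Num.min d0 trigo.pi / 2.
have pi0 := trigo.pi_gt0 R.
have dd0 : 0 < d by rewrite divr_gt0 // lt_min d00.
have dpi : d <= trigo.pi.
  have : Num.min d0 trigo.pi <= trigo.pi by rewrite ge_min lexx orbT.
  by rewrite /d; lra.
have dd : d + d <= d0.
  have : Num.min d0 trigo.pi <= d0 by rewrite ge_min lexx.
  by rewrite /d; lra.
have cd : 0 < 1 - cos d.
  rewrite subr_gt0 -(cos0 R) ltr_cos ?in_itv /= ?lexx ?(ltW dd0) ?(ltW pi0) //.
have [m mP] : exists m : nat, m.+1%:R^-1 < 1 - cos d.
  exists (Num.truncn (1 - cos d)^-1); rewrite -[X in _ < X]invrK ltf_pV2 ?posrE ?invr_gt0 ?ltr0n //.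
  exact: truncnS_gt.
have : nbhs y0 [set y : V | \sum_(i < n) (1 - cos (y0 0 i - y 0 i)) < m.+1%:R^-1].
  have cf : continuous (fun y : V => \sum_(i < n) (1 - cos (y0 0 i - y 0 i))).
    apply: continuous_sum_fun => i; apply: continuous_add_fun; first exact: continuous_cst_fun.
    apply: continuous_opp_fun.
    apply: (continuous_comp_fun (f := fun y : V => y0 0 i - y 0 i)); last exact: continuous_cos.
    apply: continuous_add_fun; first exact: continuous_cst_fun.
    by apply: continuous_opp_fun; exact: coord_continuous.
  apply: (cf y0 [set z | z < m.+1%:R^-1]); apply: open_nbhs_nbhs; split; first exact: open_lt.
  rewrite /= big1 ?invr_gt0 // => i _; by rewrite subrr cos0 subrr.
move=> /nbhs_ballP[e0 /= e00 eU].
pose e := Num.min e0 d.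
have e_gt0 : 0 < e by rewrite lt_min e00.
have hq i : exists q : rat, `|y0 0 i - ratr q| < e.
  have : y0 0 i - e < y0 0 i + e by lra.
  move=> /rat_in_itvoo[q]; rewrite in_itv /= => /andP[h1 h2]; exists q.
  by rewrite ltr_norml; apply/andP; split; lra.
pose q : 'rV[rat]_n := \row_i projT1 (cid (hq i)).
have qP i : `|y0 0 i - ratr (q 0 i)| < e.
  by rewrite [q 0 i]mxE; case: cid.
have tW : W (q, m) t.
  rewrite /W /= -{1}ty0 gE /= subr_lt0.
  have /= := eU (map_mx ratr q); under eq_bigr do rewrite [map_mx _ _ _ _]mxE.
  apply; split=> // a i; rewrite (ord1 a) /= [map_mx _ _ _ _]mxE.
  by rewrite /ball /=; apply: lt_le_trans (qP i) _; rewrite ge_min lexx.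
have WU : W (q, m) `<=` U.
  move=> s; rewrite -(torus_piK s) -(mulmxKV Bu (repr s)); set y := repr s *m _.
  rewrite /W /= gE /= subr_lt0 => h.
  have hi i : cos d < cos (y 0 i - ratr (q 0 i)).
    have : 1 - cos (y 0 i - ratr (q 0 i)) < 1 - cos d.
      apply: le_lt_trans mP; apply/ltW; apply: le_lt_trans h.
      by rewrite (bigD1 i) //= lerDl sumr_ge0 // => j _; rewrite subr_ge0 cos_le1.
    by lra.
  have dpi' : 0 < d <= trigo.pi by rewrite dd0.
  pose z : 'rV[int]_n := \row_i projT1 (cid (cos_near_period dpi' (hi i))).
  pose y' := y - (2 * trigo.pi) *: map_mx intr z.
  have -> : tpi (y *m B) = tpi (y' *m B).
    apply/torus_piP/asboolP; exists (map_mx intr z *m B); first exact: BL.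
    by rewrite -mulmxBl /y' opprB addrCA subrr addr0 scalemxAl.
  apply: dU; split=> // a i; rewrite (ord1 a) /ball /=.
  have -> : y' 0 i = y 0 i - 2 * trigo.pi * (projT1 (cid (cos_near_period dpi' (hi i))))%:~R.
    have En (x x' : V) c : (x - c *: x') 0 i = x 0 i - c * x' 0 i by rewrite !mxE.
    by rewrite /y' En; congr (_ - _ * _); rewrite !mxE.
  case: cid => k /= hk.
  have := qP i; rewrite lt_min => /andP[_ hq'].
  rewrite -[y0 0 i](subrK (ratr (q 0 i))).
  set u := y0 0 i - _ in hq' *; set r := ratr _ in hk *.
  have -> : u + r - (y 0 i - 2 * trigo.pi * k%:~R) = u - (y 0 i - r - k%:~R * (2 * trigo.pi)) by ring.
  apply: le_lt_trans (ler_normB _ _) _; apply: lt_le_trans dd.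
  exact: ltrD.
exists (choice.pickle (q, m)) => //; rewrite /F choice.pickleK.
by case: asboolP.
Qed.

Variable mu : probability T R.
Hypothesis mu_Haar : normalized_Haar mu.

Lemma Rintegral_indic A : measurable A -> (\int[mu]_t \1_A t = fine (mu A))%R.
Proof. by move=> mA; rewrite /Rintegral integral_indic // setIT. Qed.

(* The integral of a trigonometric polynomial is its constant term, so it is W-invariant;
   the bounded limits of such polynomials are a pi-system generating the Borel sets. *)
Lemma Haar_act A w : measurable A -> weyl Phi w -> mu (torus_act w @^-1` A) = mu A.
Proof.
move=> mA ww; have mw := torus_act_measurable rs ww.
have mpre B : measurable B -> measurable (torus_act w @^-1` B : set T).
  by move=> mB; have := mw measurableT B mB; rewrite setTI.
have fin B : measurable B -> mu B \is a fin_num by move=> mB; exact: fin_num_measure.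
move: A mA; rewrite {1}borel_bounded_limit.
apply: (dynkin_induction (P := fun A => mu (torus_act w @^-1` A) = mu A)).
- exact: borel_bounded_limit.
- exact: bounded_limitI.
- by rewrite preimage_setT.
- move=> A [mA [M [p [pT pM pA]]]].
  have pA' t : (fun j => p j (torus_act w t)) @ \oo --> (\1_A (torus_act w t) : R) by exact: pA.
  have mp j := real_trig_poly_measurable (pT j).
  have iM : mu.-integrable setT (EFin \o cst M) by exact: finite_measure_integrable_cst.
  have mI : measurable_fun setT (\1_A : T -> R) by exact: measurable_indic.
  have c1 := Rintegral_dct mp mI (aeW _ pA) iM pM.
  have mpw j : measurable_fun setT (fun t => p j (torus_act w t)) by exact: measurableT_comp.
  have mIw : measurable_fun setT (fun t => \1_A (torus_act w t) : R) by exact: measurableT_comp.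
  have c2 := Rintegral_dct mpw mIw (aeW _ pA') iM (fun j t => pM j (torus_act w t)).
  have e : (fun j => \int[mu]_t p j (torus_act w t))%R = (fun j => \int[mu]_t p j t)%R.
    by apply/funext => j; exact: integral_real_trig_poly_act.
  rewrite e in c2; have := cvg_unique (@Rhausdorff R) c1 c2.
  rewrite Rintegral_indic //.
  have -> : (fun t => \1_A (torus_act w t)) = \1_(torus_act w @^-1` A) :> (T -> R).
    by apply/funext => t; rewrite !indicE.
  rewrite (Rintegral_indic (mpre _ mA)) => h.
  by rewrite -[LHS]fineK ?fin //; [rewrite -h fineK ?fin|exact: mpre].
- move=> A mA IH; rewrite preimage_setC !probability_setC //; last exact: mpre.
  by congr (_ - _)%E.
- move=> F mF tF IH; rewrite preimage_bigcup !measure_bigcup //.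
  + by apply: eq_eseriesr => k _; exact: IH.
  + by move=> k _; exact: mpre.
  + apply/trivIsetP => i j _ _ ij; rewrite -preimage_setI.
    by have /trivIsetP/(_ _ _ I I ij) -> := tF; rewrite preimage_set0.
Qed.

Local Notation L2r := (Lfun mu 2%:E).

Lemma L2rD f g : f \in L2r -> g \in L2r -> (fun t => f t + g t) \in L2r.
Proof. by move=> fL gL; apply: (Lfun_addr_closed mu (lee1n 2)).2. Qed.

Lemma L2rZ a f : f \in L2r -> (fun t => a * f t) \in L2r.
Proof.
move=> /Lfun2P[mf intf]; apply/Lfun2P; split; first exact: measurable_funM.
under eq_fun do rewrite exprMn.
exact: (integrableZl measurableT (a ^+ 2) intf).
Qed.

Lemma L2rN f : f \in L2r -> (fun t => - f t) \in L2r.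
Proof. by move=> fL; under eq_fun do rewrite -mulN1r; exact: L2rZ. Qed.

Lemma L2rB f g : f \in L2r -> g \in L2r -> (fun t => f t - g t) \in L2r.
Proof. by move=> fL gL; apply: L2rD => //; exact: L2rN. Qed.

Lemma L2r_sqr_integrable f : f \in L2r -> mu.-integrable setT (EFin \o (fun t => f t ^+ 2)).
Proof. by move=> /Lfun2P[]. Qed.

Lemma L2r_rtp p : rtp p -> p \in L2r.
Proof.
move=> pT; have [M pM] := real_trig_poly_bounded rs pT.
exact: bounded_Lfun2 (real_trig_poly_measurable pT) pM.
Qed.

(** The square of the distance, a single integral. Its triangle inequality costs a factor [2], which
    is why errors are cut in quarters. *)
Definition sqdist (f g : T -> R) : R := (\int[mu]_t (f t - g t) ^+ 2)%R.

Lemma sqdist_triangle f g h : f \in L2r -> g \in L2r -> h \in L2r ->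
  sqdist f h <= 2 * sqdist f g + 2 * sqdist g h.
Proof.
move=> fL gL hL.
have i1 := L2r_sqr_integrable (L2rB fL gL).
have i2 := L2r_sqr_integrable (L2rB gL hL).
have i1' := integrableZl measurableT 2 i1.
have i2' := integrableZl measurableT 2 i2.
rewrite /sqdist -!RintegralZl // -RintegralD //.
apply: le_Rintegral => //.
- exact: L2r_sqr_integrable (L2rB fL hL).
- exact: (integrableD measurableT i1' i2').
- by move=> t _; exact: sqr_sub_triangle.
Qed.

Lemma sqdist_le f g : f \in L2r -> g \in L2r -> forall u v, u \in L2r -> v \in L2r ->
  (forall t, `|f t - g t| <= `|u t - v t|) -> sqdist f g <= sqdist u v.
Proof.
move=> fL gL u v uL vL h; apply: le_Rintegral => //.
- exact: L2r_sqr_integrable (L2rB fL gL).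
- exact: L2r_sqr_integrable (L2rB uL vL).
- by move=> t _; rewrite -(real_normK (num_real (f t - g t))) -(real_normK (num_real (u t - v t)))
    lerXn2r ?nnegrE.
Qed.

Definition approximable f := forall e : R, 0 < e -> exists2 p, rtp p & sqdist f p < e.

Lemma approximable_lim f : f \in L2r ->
  (forall e : R, 0 < e -> exists g, [/\ g \in L2r, approximable g & sqdist f g < e]) -> approximable f.
Proof.
move=> fL h e e0; have e4 : 0 < e / 4 by lra.
have [g [gL ga fg]] := h _ e4; have [p pT gp] := ga _ e4.
exists p => //; apply: le_lt_trans (sqdist_triangle fL gL (L2r_rtp pT)) _.
exact: lt_double_quarters.
Qed.

Lemma approximableD f g : f \in L2r -> g \in L2r -> approximable f -> approximable g ->
  approximable (fun t => f t + g t).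
Proof.
move=> fL gL fa ga e e0; have e4 : 0 < e / 4 by lra.
have [p pT fp] := fa _ e4; have [q qT gq] := ga _ e4.
exists (fun t => p t + q t); first exact: real_trig_polyD.
have pL := L2r_rtp pT; have qL := L2r_rtp qT.
apply: le_lt_trans (sqdist_triangle (L2rD fL gL) (L2rD pL gL) (L2rD pL qL)) _.
have -> : sqdist (fun t => f t + g t) (fun t => p t + g t) = sqdist f p.
  by apply: eq_Rintegral => t _; congr (_ ^+ 2); ring.
have -> : sqdist (fun t => p t + g t) (fun t => p t + q t) = sqdist g q.
  by apply: eq_Rintegral => t _; congr (_ ^+ 2); ring.
exact: lt_double_quarters.
Qed.

Lemma approximableZ a f : f \in L2r -> approximable f -> approximable (fun t => a * f t).
Proof.
move=> fL fa e e0.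
have a0 : 0 < a ^+ 2 + 1 by have := sqr_ge0 a; lra.
have [p pT fp] := fa (e / (a ^+ 2 + 1)) (divr_gt0 e0 a0).
exists (fun t => a * p t); first by apply: real_trig_polyM => //; exact: real_trig_poly_cst.
have -> : sqdist (fun t => a * f t) (fun t => a * p t) = a ^+ 2 * sqdist f p.
  rewrite /sqdist -RintegralZl //; last exact: L2r_sqr_integrable (L2rB fL (L2r_rtp pT)).
  by apply: eq_Rintegral => t _; rewrite -mulrBr exprMn.
have d0 : 0 <= sqdist f p by apply: Rintegral_ge0 => t _; exact: sqr_ge0.
rewrite ltr_pdivlMr // in fp; apply: le_lt_trans fp.
by rewrite mulrC ler_wpM2l // lerDl.
Qed.

Lemma approximable_cvg (f : T -> R) (f_ : nat -> T -> R) (h : T -> R) :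
  f \in L2r -> h \in L2r -> (forall m, f_ m \in L2r) -> (forall m, approximable (f_ m)) ->
  (forall m t, `|f t - f_ m t| <= h t) -> {ae mu, forall t, f_ ^~ t @ \oo --> f t} -> approximable f.
Proof.
move=> fL hL f_L f_a fh cvf; apply: approximable_lim => // e e0.
have : (fun m => sqdist f (f_ m)) @ \oo --> (0 : R).
  have -> : (0 : R) = (\int[mu]_t cst 0 t)%R by rewrite Rintegral_cst // mul0r.
  apply: (Rintegral_dct (g := fun t => h t ^+ 2)) => //.
  - by move=> m; apply: measurable_funX; apply: Lfun2_measurable; exact: L2rB.
  - apply: filterS cvf => t ct; rewrite /cst.
    have : (fun m => (f t - f_ m t) ^+ 2) @ \oo --> ((f t - f t) ^+ 2 : R).
      by apply: cvgM; apply: cvgB => //; exact: cvg_cst.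
    by rewrite subrr expr0n.
  - exact: L2r_sqr_integrable.
  - by move=> m t; rewrite normrX lerXn2r ?nnegrE // (le_trans _ (fh m t)).
move=> /cvgrPdist_lt/(_ e e0)[N _ /(_ N (leqnn N))].
rewrite sub0r normrN ger0_norm => [lt|]; first by exists (f_ N).
by apply: Rintegral_ge0 => t _; exact: sqr_ge0.
Qed.

Lemma indic_L2r A : measurable A -> (\1_A : T -> R) \in L2r.
Proof.
move=> mA; apply: (@bounded_Lfun2 _ _ _ _ _ 1); first exact: measurable_indic.
by move=> t; rewrite indicE; case: (_ \in _); rewrite ?normr0 ?normr1.
Qed.

(** Dynkin induction on the sets generated by [bounded_limit]: for these the approximation is built
    in, and complements and disjoint unions follow by linearity and dominated convergence. *)
Lemma approximable_indic A : measurable A -> approximable (\1_A : T -> R).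
Proof.
move: A; rewrite {1}borel_bounded_limit.
apply: (dynkin_induction (P := fun A => approximable (\1_A : T -> R))).
- exact: borel_bounded_limit.
- exact: bounded_limitI.
- move=> e e0; exists (fun=> 1); first exact: real_trig_poly_cst.
  rewrite /sqdist; under eq_Rintegral do rewrite indicT subrr expr0n.
  by rewrite Rintegral_cst // mul0r.
- move=> A [mA [M [p [pT pM pA]]]].
  apply: (@approximable_cvg _ p (cst (1 + M))).
  + exact: indic_L2r.
  + by apply: (@bounded_Lfun2 _ _ _ _ _ `|1 + M|).
  + by move=> m; exact: L2r_rtp.
  + move=> m e e0; exists (p m) => //.
    rewrite /sqdist; under eq_Rintegral do rewrite subrr expr0n.
    by rewrite Rintegral_cst // mul0r.
  + move=> m t; apply: le_trans (ler_normB _ _) _; apply: lerD => //.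
    by rewrite indicE; case: (_ \in _); rewrite ?normr0 ?normr1.
  + exact: aeW.
- move=> A mA IH.
  have -> : \1_(~` A) = (fun t => 1 + (-1) * \1_A t) :> (T -> R).
    apply/funext => t; rewrite !indicE in_setC; case: (_ \in _) => /=; ring.
  apply: approximableD.
  + by apply: (@bounded_Lfun2 _ _ _ _ _ `|1|).
  + exact: L2rZ (indic_L2r mA).
  + move=> e e0; exists (fun=> 1); first exact: real_trig_poly_cst.
    rewrite /sqdist; under eq_Rintegral do rewrite subrr expr0n.
    by rewrite Rintegral_cst // mul0r.
  + exact: approximableZ (indic_L2r mA) IH.
- move=> F mF tF IH.
  pose f_ m (t : T) := \1_(\big[setU/set0]_(k < m) F k) t : R.
  apply: (@approximable_cvg _ f_ (cst 2)).
  + by apply: indic_L2r; exact: bigcup_measurable.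
  + by apply: (@bounded_Lfun2 _ _ _ _ _ `|2|).
  + by move=> m; apply: indic_L2r; exact: bigsetU_measurable.
  + move=> m; elim: m => [|m IHm].
      move=> e e0; exists (fun=> 0); first exact: real_trig_poly_cst.
      rewrite /sqdist /f_; under eq_Rintegral do rewrite big_ord0 indic0 subrr expr0n.
      by rewrite Rintegral_cst // mul0r.
    have -> : f_ m.+1 = fun t => f_ m t + \1_(F m) t.
      apply/funext => t; rewrite /f_ big_ord_recr /=.
      have dis : (\big[setU/set0]_(k < m) F k) `&` F m = set0.
        rewrite -bigcup_mkord; apply/seteqP; split=> // s [[k /= km Fk] Fm].
        have /trivIsetP/(_ k m I I) := tF; rewrite neq_ltn km => /(_ isT) E0.
        by have : set0 s by rewrite -E0; split.
      rewrite !indicE in_setU; case: (boolP (t \in F m)) => h; last by rewrite orbF addr0.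
      have -> : (t \in \big[setU/set0]_(k < m) F k) = false.
        apply/negbTE/negP => h'; have : set0 t by rewrite -dis; split; exact: set_mem.
        by [].
      by rewrite add0r.
    apply: approximableD => //; apply: indic_L2r => //; exact: bigsetU_measurable.
  + move=> m t; apply: le_trans (ler_normB _ _) _.
    have b (B : set T) : `|\1_B t : R| <= 1.
      by rewrite indicE; case: (_ \in _); rewrite ?normr0 ?normr1.
    by have := b (\bigcup_k F k); have := b (\big[setU/set0]_(k < m) F k); rewrite /f_ /cst; lra.
  + apply: aeW => t; rewrite /f_; case: (pselect ((\bigcup_k F k) t)) => [[N _ FN]|nF].
      apply: cvg_near_cst; exists N.+1 => // m /= Nm; rewrite !indicE !mem_set //; first by exists N.
      by rewrite -bigcup_mkord; exists N.
    apply: cvg_near_cst; apply: nearW => m; rewrite !indicE !memNset // -bigcup_mkord => -[j _ Fj].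
    by apply: nF; exists j.
Qed.

Lemma approximable_sum (I : Type) (r : seq I) (c : I -> R) (F : I -> T -> R) :
  (forall i, F i \in L2r) -> (forall i, approximable (F i)) ->
  (fun t => \sum_(i <- r) c i * F i t) \in L2r /\ approximable (fun t => \sum_(i <- r) c i * F i t).
Proof.
move=> FL Fa; elim: r => [|i r [IH1 IH2]].
  under eq_fun do rewrite big_nil; split; first by apply: L2r_rtp; exact: real_trig_poly_cst.
  move=> e e0; exists (fun=> 0); first exact: real_trig_poly_cst.
  by rewrite /sqdist; under eq_Rintegral do rewrite subrr expr0n; rewrite Rintegral_cst // mul0r.
under eq_fun do rewrite big_cons; split; first by apply: L2rD => //; exact: L2rZ.
by apply: approximableD => //; [exact: L2rZ|exact: approximableZ].
Qed.

Import HBNNSimple.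

Lemma approximable_ge0 f : f \in L2r -> (forall t, 0 <= f t) -> approximable f.
Proof.
move=> fL f0; have mf := Lfun2_measurable fL.
have mfE : measurable_fun setT (EFin \o f) by exact/measurable_EFinP.
have f0' t : setT t -> (0 <= (EFin \o f) t)%E by rewrite /= lee_fin.
pose g m := nnsfun_approx measurableT mfE m.
have gf m t : g m t <= f t.
  by rewrite -lee_fin /g nnsfun_approxE; exact: (le_approx m f0').
have gL m : (g m : T -> R) \in L2r /\ approximable (g m).
  have -> : (g m : T -> R) = fun t => \sum_(i < #|` fset_set (range (g m))|)
      (fset_set (range (g m)))`_i * \1_(g m @^-1` [set (fset_set (range (g m)))`_i]) t.
    by apply/funext => t; rewrite {1}fimfunEord.
  have mi y : measurable (g m @^-1` [set y]) by [].
  by apply: approximable_sum => i; [exact: indic_L2r|exact: approximable_indic].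
apply: (@approximable_cvg f g f) => //; try by move=> m; have [] := gL m.
  by move=> m t; rewrite ger0_norm ?subr_ge0 // gerBl.
apply: aeW => t; have := cvg_nnsfun_approx measurableT mfE f0' I (x := t).
by move/fine_cvg.
Qed.

Lemma approximable_L2 f : f \in L2r -> approximable f.
Proof.
move=> fL; have mf := Lfun2_measurable fL.
have nL : (fun t => `|f t|) \in L2r.
  apply/Lfun2P; split; first exact: measurableT_comp.
  by under eq_fun do rewrite real_normK ?num_real //; exact: L2r_sqr_integrable.
have -> : f = fun t => 2^-1 * (`|f t| + f t) + (- 2^-1) * (`|f t| - f t).
  by apply/funext => t; exact: norm_parts.
have pL := L2rD nL fL; have mL := L2rB nL fL.
apply: approximableD; [exact: L2rZ|exact: L2rZ| |]; apply: approximableZ => //;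
  by apply: approximable_ge0 => // t; have [] := norm_parts_ge0 (f t).
Qed.

End Density.

(** * Square integrable functions *)

Section HilbertStructure.
Variables (R : realType) (n : nat) (Phi : {fset 'rV[R]_n}).
Local Notation V := 'rV[R]_n.
Local Notation T := (torus Phi).
Local Notation tpi := (@torus_pi R n Phi).
Local Notation rtp := (real_trig_poly (Phi := Phi)).
Hypothesis rs : reduced_crystallographic_root_system Phi.
Variable mu : probability T R.
Hypothesis mu_Haar : normalized_Haar mu.
Local Notation L2r := (Lfun mu 2%:E).
Local Notation ip := (L2_inner mu).
Implicit Types (f g h : T -> R[i]) (u v w : T -> R).

Definition real_ip u v : R := (\int[mu]_t (u t * v t))%R.

Lemma real_ipC u v : real_ip u v = real_ip v u.
Proof. by apply: eq_Rintegral => t _; rewrite mulrC. Qed.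

Lemma real_ip_lin u v1 v2 v3 (x y : R) : u \in L2r -> v1 \in L2r -> v2 \in L2r -> v3 \in L2r ->
  real_ip u (fun t => x * v1 t - y * v2 t + v3 t) = x * real_ip u v1 - y * real_ip u v2 + real_ip u v3.
Proof.
move=> uL v1L v2L v3L.
have i1 := Lfun2_mul_integrable uL v1L; have i2 := Lfun2_mul_integrable uL v2L.
have i3 := Lfun2_mul_integrable uL v3L.
have i1' := integrableZl measurableT x i1; have i2' := integrableZl measurableT y i2.
rewrite /real_ip -!RintegralZl // -RintegralB // -RintegralD //; last exact: (integrableB
    measurableT i1' i2').
by apply: eq_Rintegral => t _; ring.
Qed.

Lemma L2_lin (a : R[i]) f g : L2 mu f -> L2 mu g -> L2 mu (a *: f + g).
Proof.
case: a => x y [fr fi] [gr gi]; split.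
  rewrite (_ : (fun t => _) = fun t => x * complex.Re (f t) - y * complex.Im (f t) + complex.Re (g t)).
    by apply: L2rD => //; apply: L2rB; exact: L2rZ.
  by apply/funext => t; rewrite !fctE /=; case: (f t) => ? ?; case: (g t).
rewrite (_ : (fun t => _) = fun t => x * complex.Im (f t) - (- y) * complex.Re (f t) + complex.Im (g
    t)).
  by apply: L2rD => //; apply: L2rB; exact: L2rZ.
by apply/funext => t; rewrite !fctE /= ; case: (f t) => c d; case: (g t) => c' d' /=; ring.
Qed.

Lemma L2_0 : L2 mu 0.
Proof. by split; apply: L2r_rtp => //; exact: real_trig_poly_cst. Qed.

Lemma L2_innerE f g : L2 mu f -> L2 mu g ->
  let re (h : T -> R[i]) t := complex.Re (h t) in let im (h : T -> R[i]) t := complex.Im (h t) in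
  ip f g = (real_ip (re f) (re g) + real_ip (im f) (im g)) +i*
           (real_ip (re f) (im g) - real_ip (im f) (re g)).
Proof.
move=> [fr fi] [gr gi] re im; rewrite /L2_inner /integralC.
have i1 := Lfun2_mul_integrable fr gr; have i2 := Lfun2_mul_integrable fi gi.
have i3 := Lfun2_mul_integrable fr gi; have i4 := Lfun2_mul_integrable fi gr.
rewrite /real_ip -RintegralD // -RintegralB //.
congr (_ +i* _); apply: eq_Rintegral => t _; rewrite /re /im;
  by case: (f t) => c d; case: (g t) => c' d' /=; ring.
Qed.

Lemma L2_sub_pre_hilbert (H : set (T -> R[i])) : H `<=` L2 mu -> H 0 ->
  (forall (a : R[i]) f g, H f -> H g -> H (a *: f + g)) -> pre_hilbert ip H.
Proof.
move=> HL H0 Hlin; split=> //.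
- move=> a f g h Hf Hg Hh.
  have Lf := HL _ Hf; have Lg := HL _ Hg; have Lh := HL _ Hh.
  have Ls := L2_lin a Lf Lg.
  rewrite !L2_innerE //; case: a Ls => x y Ls.
  case: Lf Lg Lh => fr fi [gr gi] [hr hi].
  have eR : (fun t => complex.Re (((x +i* y) *: f + g) t)) =
      fun t => x * complex.Re (f t) - y * complex.Im (f t) + complex.Re (g t).
    by apply/funext => t; rewrite !fctE /=; case: (f t) => ? ?; case: (g t).
  have eI : (fun t => complex.Im (((x +i* y) *: f + g) t)) =
      fun t => x * complex.Im (f t) - (- y) * complex.Re (f t) + complex.Im (g t).
    by apply/funext => t; rewrite !fctE /=; case: (f t) => c d; case: (g t) => c' d' /=; ring.
  rewrite eR eI !real_ip_lin //.
  by apply/eqP; rewrite eq_complex /=; apply/andP; split; apply/eqP; ring.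
- move=> f g Hf Hg; rewrite !L2_innerE; [|exact: HL..].
  rewrite ![real_ip (fun t => complex.Re (g t)) _]real_ipC ![real_ip (fun t => complex.Im (g t))
      _]real_ipC.
  by apply/eqP; rewrite eq_complex /=; apply/andP; split; apply/eqP; ring.
- move=> f Hf; rewrite L2_innerE /=; [|exact: HL..].
  by rewrite addr_ge0 // Rintegral_ge0 // => t _; rewrite -expr2 sqr_ge0.
Qed.

Lemma L2_pre_hilbert : pre_hilbert ip (L2 mu).
Proof. by apply: L2_sub_pre_hilbert => //; [exact: L2_0|exact: L2_lin]. Qed.

Lemma L2_W_lin (a : R[i]) f g : L2_W mu f -> L2_W mu g -> L2_W mu (a *: f + g).
Proof.
move=> [Lf Wf] [Lg Wg]; split=> [|w ww]; first exact: L2_lin.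
by apply: filterS2 (Wf w ww) (Wg w ww) => t ef eg; rewrite !fctE ef eg.
Qed.

Lemma L2_W_pre_hilbert : pre_hilbert ip (L2_W mu).
Proof.
apply: L2_sub_pre_hilbert; [by move=> f []| |exact: L2_W_lin].
by split=> [|w ww]; [exact: L2_0|exact: aeW].
Qed.

Lemma hnorm_L2E f : L2 mu f -> hnorm ip f =
  Num.sqrt (\int[mu]_t complex.Re (f t) ^+ 2 + \int[mu]_t complex.Im (f t) ^+ 2)%R.
Proof. by move=> Lf; rewrite /hnorm L2_innerE. Qed.

Lemma L2_measurable f : L2 mu f -> measurable_fun setT (fun t => complex.Re (f t)) /\
  measurable_fun setT (fun t => complex.Im (f t)).
Proof. by move=> [/Lfun2_measurable h1 /Lfun2_measurable h2]. Qed.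

Lemma hnorm_ae_eq f g : L2 mu f -> L2 mu g -> {ae mu, forall t, f t = g t} -> hnorm ip f = hnorm ip g.
Proof.
move=> Lf Lg fg; rewrite !hnorm_L2E //; congr (Num.sqrt (_ + _)); apply: ae_eq_Rintegral.
- by apply: measurable_funX; exact: (L2_measurable Lf).1.
- by apply: measurable_funX; exact: (L2_measurable Lg).1.
- by apply: filterS fg => t ->.
- by apply: measurable_funX; exact: (L2_measurable Lf).2.
- by apply: measurable_funX; exact: (L2_measurable Lg).2.
- by apply: filterS fg => t ->.
Qed.

Lemma hnorm_ae0 f : L2 mu f -> {ae mu, forall t, f t = 0} -> hnorm ip f = 0.
Proof.
move=> Lf f0; rewrite (hnorm_ae_eq Lf L2_0 f0) hnorm_L2E; last exact: L2_0.
by rewrite /= expr0n /= Rintegral_cst // mul0r addr0 sqrtr0.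
Qed.

Lemma hnorm_subE f g : L2 mu f -> L2 mu g ->
  hnorm ip (f - g) = Num.sqrt (sqdist mu (fun t => complex.Re (f t)) (fun t => complex.Re (g t)) +
                               sqdist mu (fun t => complex.Im (f t)) (fun t => complex.Im (g t))).
Proof.
move=> Lf Lg; have Lfg : L2 mu (f - g) by rewrite addrC -scaleN1r; exact: L2_lin.
rewrite hnorm_L2E //; congr (Num.sqrt (_ + _)); apply: eq_Rintegral => t _; congr (_ ^+ 2);
  by rewrite !fctE; case: (f t) => ? ?; case: (g t).
Qed.

Lemma L2_sum (I : Type) (s : seq I) (F : I -> T -> R[i]) (c : R) :
  (forall i, L2 mu (F i) /\ hnorm ip (F i) <= c) ->
  L2 mu (fun t => \sum_(i <- s) F i t) /\ hnorm ip (fun t => \sum_(i <- s) F i t) <= \sum_(i <- s) c.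
Proof.
move=> FL; elim: s => [|i s [IH1 IH2]].
  under eq_fun do rewrite big_nil; rewrite big_nil; split; first exact: L2_0.
  by rewrite (hnorm_ae0 L2_0) //; exact: aeW.
under eq_fun do rewrite big_cons; rewrite big_cons.
split; first exact: (phD L2_pre_hilbert (FL i).1 IH1).
by apply: le_trans (nrmD L2_pre_hilbert (FL i).1 IH1) _; apply: lerD => //; exact: (FL i).2.
Qed.

Lemma L2_act f x : weyl Phi x -> L2 mu f -> L2 mu (fun t => f (torus_act x t)) /\
  hnorm ip (fun t => f (torus_act x t)) = hnorm ip f.
Proof.
move=> wx Lf; have mx := torus_act_measurable rs wx.
have px A : measurable A -> mu (torus_act x @^-1` A) = mu A by move=> mA; exact: Haar_act.
have act u : u \in L2r -> (fun t => u (torus_act x t)) \in L2r.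
  move=> /Lfun2P[mu' iu]; apply/Lfun2P; split; first exact: measurableT_comp.
  exact: (integrable_preserving mx px iu).
have act2 u : u \in L2r -> (\int[mu]_t u (torus_act x t) ^+ 2 = \int[mu]_t u t ^+ 2)%R.
  by move=> /Lfun2P[mu' iu]; exact: (Rintegral_preserving mx px iu).
case: Lf => fr fi; have Lf' : L2 mu (fun t => f (torus_act x t)) by split; [exact: act fr|exact: act
    fi].
by split=> //; rewrite !hnorm_L2E // (act2 _ fr) (act2 _ fi).
Qed.

Lemma L2r_mul_bounded u (b : T -> R) (M : R) : u \in L2r -> measurable_fun setT b -> (forall t, `|b
    t| <= M) ->
  (fun t => b t * u t) \in L2r.
Proof.
move=> /Lfun2P[mU iU] mb bM; apply/Lfun2P; split; first exact: measurable_funM.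
apply: (le_integrable measurableT _ _ (integrableZl measurableT (M ^+ 2) iU)).
  by apply/measurable_EFinP; apply: measurable_funX; exact: measurable_funM.
move=> t _; change ((`|(b t * u t) ^+ 2|)%:E <= (`|M ^+ 2 * u t ^+ 2|)%:E)%E.
rewrite lee_fin exprMn (normrM (b t ^+ 2)) (normrM (M ^+ 2)) ler_wpM2r // !normrX lerXn2r ?nnegrE //.
exact: le_trans (bM t) (ler_norm _).
Qed.

(* [d * \sum_(i < m) (1 - d) ^+ i = 1 - (1 - d) ^+ m] tends to [1] where [d != 0], so that
   [v] is the limit of the multiples by [d] of [v * \sum_(i < m) (1 - d) ^+ i]. *)
Lemma weighted_trig_poly_dense (d : T -> R) v : measurable_fun setT d -> (forall t, 0 <= d t <= 1) ->
  {ae mu, forall t, d t != 0} -> v \in L2r -> forall e : R, 0 < e ->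
  exists2 p, rtp p & sqdist mu v (fun t => p t * d t) < e.
Proof.
move=> md d01 d0 vL e e0; have e4 : 0 < e / 4 by lra.
pose b m t := \sum_(i < m) (1 - d t) ^+ i.
have nd t : 0 <= 1 - d t <= 1 by have /andP[] := d01 t; lra.
have mb m : measurable_fun setT (b m).
  apply: measurable_sum => i; apply: measurable_funX; exact: measurable_funB.
have bm m t : `|b m t| <= m%:R.
  rewrite ger0_norm; last by apply: sumr_ge0 => i _; rewrite exprn_ge0 //; have /andP[] := nd t.
  rewrite -[X in _ <= X%:R]card_ord -sumr_const; apply: ler_sum => i _.
  by have /andP[? ?] := nd t; rewrite exprn_ile1.
have dB t : `|d t| <= 1 by rewrite ger0_norm; have /andP[] := d01 t.
pose w m t := b m t * v t; have wL m : w m \in L2r by exact: L2r_mul_bounded (mb m) (bm m).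
have wdL p : p \in L2r -> (fun t => p t * d t) \in L2r.
  by move=> pL; under eq_fun do rewrite mulrC; apply: L2r_mul_bounded pL md dB.
have wE m t : w m t * d t = v t - v t * (1 - d t) ^+ m.
  have := subrX1 (1 - d t) m; rewrite -/(b m t) /w => h.
  by rewrite [_ ^+ m](_ : _ = 1 - d t * b m t); [ring|rewrite -[LHS](subrK 1) h; ring].
have : (fun m => sqdist mu v (fun t => w m t * d t)) @ \oo --> (0 : R).
  have -> : (0 : R) = (\int[mu]_t cst 0 t)%R by rewrite Rintegral_cst // mul0r.
  apply: (Rintegral_dct (g := fun t => v t ^+ 2)) => //.
  - by move=> m; apply: measurable_funX; exact: Lfun2_measurable (L2rB vL (wdL _ (wL m))).
  - apply: filterS d0 => t dt; rewrite /cst.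
    under eq_fun do rewrite wE opprB addrCA subrr addr0 exprMn.
    have c1 : (fun m => (1 - d t) ^+ m) @ \oo --> (0 : R).
      apply: cvg_expr; have /andP[? ?] := nd t; rewrite ger0_norm //.
      have : 0 < d t by rewrite lt0r dt; have /andP[] := d01 t.
      by lra.
    have c2 : (fun m => v t ^+ 2 * ((1 - d t) ^+ m * (1 - d t) ^+ m)) @ \oo --> (v t ^+ 2 * (0 * 0)
        : R).
      by apply: cvgM; [exact: cvg_cst|exact: cvgM].
    by rewrite !mulr0 in c2.
  - exact: L2r_sqr_integrable.
  - move=> m t; rewrite wE opprB addrCA subrr addr0 ger0_norm ?sqr_ge0 // exprMn ler_piMr ?sqr_ge0 //.
    by have /andP[? ?] := nd t; rewrite exprn_ile1 ?exprn_ge0 ?exprn_ile1.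
move=> /cvgrPdist_lt/(_ _ e4)[N _ /(_ N (leqnn N))].
rewrite sub0r normrN ger0_norm => [lt|]; last by apply: Rintegral_ge0 => t _; exact: sqr_ge0.
(* [w N] is square integrable because [b N] is bounded. As [d <= 1], multiplication by [d] does not
   increase the error of its approximation. *)
have [p pT wp] := approximable_L2 rs (wL N) e4.
have pL := L2r_rtp rs mu pT.
exists p => //; apply: le_lt_trans (sqdist_triangle vL (wdL _ (wL N)) (wdL _ pL)) _.
apply: lt_double_quarters => //; apply: le_lt_trans wp.
apply: sqdist_le => //; try exact: wdL.
by move=> t; rewrite -mulrBl normrM ler_piMr // dB.
Qed.

End HilbertStructure.

(** * The weight function Delta *)

Section PositiveRoots.
Variables (R : realType) (n : nat) (Phi Pos : {fset 'rV[R]_n}).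
Local Notation V := 'rV[R]_n.
Hypothesis rs : reduced_crystallographic_root_system Phi.
Hypothesis Pos_positive : positive_roots Phi Pos.

Lemma Pos_root a : a \in Pos -> a \in Phi.
Proof. by case: Pos_positive => v _ ->; rewrite !inE => /andP[]. Qed.

Section BigLaw.
Variables (S : Type) (idx : S) (op : Monoid.com_law idx).

Lemma big_weyl w (F : V -> S) : weyl Phi w ->
  \big[op/idx]_(a <- Phi) F (w a) = \big[op/idx]_(a <- Phi) F a.
Proof.
move=> ww; have [w' [ww' c1 c2]] := weyl_inv rs ww.
rewrite -(big_map w xpredT F); apply: perm_big; apply: uniq_perm.
- by rewrite map_inj_uniq ?fset_uniq //; exact: can_inj c1.
- exact: fset_uniq.
- move=> a; apply/mapP/idP => [[b bP ->]|aP]; first exact: (weyl_root rs).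
  by exists (w' a); rewrite ?c2 //; exact: (weyl_root rs).
Qed.

Lemma big_Phi_opp (P : pred V) (F : V -> S) :
  \big[op/idx]_(a <- Phi | P a) F a = \big[op/idx]_(a <- Phi | P (- a)) F (- a).
Proof.
rewrite -(big_map -%R P F); apply: perm_big; rewrite perm_sym; apply: uniq_perm.
- by rewrite map_inj_uniq ?fset_uniq //; exact: oppr_inj.
- exact: fset_uniq.
- move=> a; apply/mapP/idP => [[b bP ->]|aP]; first exact: (root_opp rs).
  by exists (- a); rewrite ?opprK //; exact: (root_opp rs).
Qed.

Lemma big_Phi_Pos (F : V -> S) : \big[op/idx]_(a <- Phi) F a =
  op (\big[op/idx]_(a <- Pos) F a) (\big[op/idx]_(a <- Pos) F (- a)).
Proof.
case: Pos_positive => v vP ->; rewrite (bigID (fun a => 0 < dotv a v)) /=; congr (op _ _).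
  by rewrite big_fset_condE.
rewrite big_Phi_opp -big_fset_condE.
rewrite [LHS]big_seq_cond [RHS]big_seq_cond; apply: eq_bigl => a.
case: (boolP (a \in Phi)) => //= aP; rewrite dotvNl oppr_gt0 -leNgt.
by rewrite le_eqVlt eq_sym (negPf (vP _ aP)).
Qed.

End BigLaw.

Lemma sum_Phi_Pos (F : V -> R) : (forall a, a \in Phi -> F (- a) = F a) ->
  \sum_(a <- Phi) F a = 2 * \sum_(a <- Pos) F a.
Proof.
move=> Fo; rewrite big_Phi_Pos mulr_natl mulr2n; congr (_ + _).
by apply: eq_big_seq => a /Pos_root; exact: Fo.
Qed.

Lemma sum_Pos_weyl w (F : V -> R) : weyl Phi w -> (forall a, a \in Phi -> F (- a) = F a) ->
  \sum_(a <- Pos) F (w a) = \sum_(a <- Pos) F a.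
Proof.
move=> ww Fo; have two : (2 : R) != 0 by [].
apply: (mulfI two); rewrite -(sum_Phi_Pos Fo) -(big_weyl _ F ww) sum_Phi_Pos // => a aP.
by rewrite (weylN _ ww) Fo //; exact: (weyl_root rs).
Qed.

(** W does not preserve [Pos]. The square of the product of an even function over [Pos] is its
    product over [Phi], which W permutes; nonnegativity allows the square to be removed. *)
Lemma prod_Pos_weyl w (F : V -> R) : weyl Phi w -> (forall a, a \in Phi -> F (- a) = F a) ->
  (forall a, 0 <= F a) -> \prod_(a <- Pos) F (w a) = \prod_(a <- Pos) F a.
Proof.
move=> ww Fo F0; apply/eqP; rewrite -(@eqrXn2 _ 2) ?prodr_ge0 //; apply/eqP.
have sq (G : V -> R) : (forall a, a \in Phi -> G (- a) = G a) -> (\prod_(a <- Pos) G a) ^+ 2 =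
    \prod_(a <- Phi) G a.
  by move=> Go; rewrite big_Phi_Pos expr2; congr (_ * _); apply: eq_big_seq => a /Pos_root/Go.
rewrite !sq //; first exact: big_weyl.
by move=> a aP; rewrite (weylN _ ww) Fo //; exact: (weyl_root rs).
Qed.

Variable k : V -> R.
Hypothesis k_invariant : forall w a, weyl Phi w -> a \in Phi -> k (w a) = k a.
Hypothesis k_ge2 : forall a, a \in Phi -> 2 <= k a.
Local Notation T := (torus Phi).
Local Notation tpi := (@torus_pi R n Phi).

Definition Delta_lift (x : V) : R := \prod_(a <- Pos) `|sin (dotv a x / 2)| `^ k a.
Definition potential_lift (x : V) : R :=
  \sum_(a <- Pos) k a * (k a - 1) * dotv a a * ((4 * sin (dotv a x / 2) ^+ 2)^-1 - 12^-1).

Lemma Delta_funE (t : T) : Delta Pos k t = Delta_lift (repr t). Proof. by []. Qed.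
Lemma potential_funE (t : T) : potential Pos k t = potential_lift (repr t). Proof. by []. Qed.

Lemma Delta_periodic : torus_periodic Phi Delta_lift.
Proof.
move=> x q qL; apply: eq_big_seq => a /Pos_root aP; congr (_ `^ _).
exact: (periodic_norm_sin (root_weight rs aP) x qL).
Qed.

Lemma potential_periodic : torus_periodic Phi potential_lift.
Proof.
move=> x q qL; apply: eq_big_seq => a /Pos_root aP.
have := periodic_norm_sin (root_weight rs aP) x qL => /(congr1 (fun z => z ^+ 2)).
by rewrite !real_normK ?num_real // => ->.
Qed.

Lemma Delta_weyl w x : weyl Phi w -> Delta_lift (w x) = Delta_lift x.
Proof.
move=> ww; have [w' [ww' c1 c2]] := weyl_inv rs ww.
pose F (a : V) := `|sin (dotv a x / 2)| `^ k a.
rewrite -[RHS](prod_Pos_weyl (w := w') (F := F)) //.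
- apply: eq_big_seq => a /Pos_root aP; rewrite /F k_invariant //.
  by rewrite -(weyl_dotv rs (w' a) _ ww) c2.
- by move=> a aP; rewrite /F (k_opp rs k_invariant aP) dotvNl mulNr sinN normrN.
- by move=> a; exact: powR_ge0.
Qed.

Lemma potential_weyl w x : weyl Phi w -> potential_lift (w x) = potential_lift x.
Proof.
move=> ww; have [w' [ww' c1 c2]] := weyl_inv rs ww.
rewrite -[RHS](sum_Pos_weyl (w := w') ) //.
- apply: eq_big_seq => a /Pos_root aP; rewrite k_invariant //.
  by rewrite (weyl_dotv rs _ _ ww') -(weyl_dotv rs (w' a) _ ww) c2.
- move=> a aP; rewrite (k_opp rs k_invariant aP) dotvNl dotvNr opprK [dotv (- a) x]dotvNl mulNr sinN
    sqrrN //.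
Qed.

Lemma Delta_act w (t : T) : weyl Phi w -> Delta Pos k (torus_act w t) = Delta Pos k t.
Proof.
by move=> ww; rewrite !Delta_funE /torus_act (periodic_repr _ Delta_periodic) Delta_weyl.
Qed.

Lemma potential_act w (t : T) : weyl Phi w -> potential Pos k (torus_act w t) = potential Pos k t.
Proof.
by move=> ww; rewrite !potential_funE /torus_act (periodic_repr _ potential_periodic) potential_weyl.
Qed.

Definition regular (x : V) : Prop := forall a, a \in Phi -> sin (dotv a x / 2) != 0.

Lemma regular_weyl w x : weyl Phi w -> regular x -> regular (w x).
Proof.
move=> ww rx a aP; have [w' [ww' c1 c2]] := weyl_inv rs ww.
by rewrite -(c2 a) (weyl_dotv rs) //; apply: rx; exact: (weyl_root rs).
Qed.

Lemma Delta_fun01 x : 0 <= Delta_lift x <= 1.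
Proof.
rewrite prodr_ge0 => [|a _]; last exact: powR_ge0.
rewrite /Delta_lift big_seq; apply: prodr_ile1 => a /Pos_root/k_ge2 k2.
rewrite powR_ge0 /=.
by rewrite norm_sin_powR_le1 //; lra.
Qed.

Lemma Delta_fun_neq0 x : regular x -> Delta_lift x != 0.
Proof.
move=> rx; rewrite prodf_seq_neq0; apply/allP => a /Pos_root/rx; rewrite /= powR_eq0 normr_eq0.
by move=> /negPf ->.
Qed.

Lemma Delta_jet : exists F1 F2, jet2 Delta_lift F1 F2 /\
  forall x, regular x ->
    let l v := \sum_(a <- Pos) k a / 2 * (cos (dotv a x / 2) / sin (dotv a x / 2)) * dotv a v in
    (forall v, F1 v x = Delta_lift x * l v) /\
    (forall v u, F2 v u x = Delta_lift x * (l v * l u - \sum_(a <- Pos) k a / 4 / sin (dotv a x / 2)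
        ^+ 2 * dotv a v * dotv a u)).
Proof.
have [F1 [F2 [J E]]] := jet2_sin_product (r := Pos) (fun a aP => k_ge2 (Pos_root aP)).
exists F1, F2; split=> // x rx; apply: E => a /Pos_root; exact: rx.
Qed.

Lemma Delta_continuous : continuous Delta_lift.
Proof. by have [F1 [F2 [J _]]] := Delta_jet; exact: jet_c0 J. Qed.

Lemma Delta_measurable : measurable_fun setT (Delta Pos k : T -> R).
Proof. exact: torus_measurable Delta_periodic Delta_continuous. Qed.

(** Induction over products of reflections: precomposing with one reflection permutes the terms of
    the average. *)
Lemma weyl_average : exists (I : finType) (w_ : I -> V -> V),
  [/\ (0 < #|I|)%N, forall i, weyl Phi (w_ i) & forall g : T -> R[i],
    W_invariant (fun t => \sum_i (#|I|%:R^-1)%:C * g (torus_act (w_ i) t))].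
Proof.
have [I [w_ [I0 ww_ wrefl]]] := weyl_enum rs.
exists I, w_; split=> // g; set avg := fun t => _.
move=> w ww; elim: ww => [t|a {}w aP ww IH t]; first by rewrite /torus_act torus_piK.
have -> : torus_act (reflection a \o w) t = torus_act (reflection a) (torus_act w t).
  by rewrite [torus_act w t]/torus_act (torus_act_tpi rs) //; exact: weyl_refl.
transitivity (avg (torus_act w t)); last exact: IH.
move: (torus_act w t) => t'.
have [s sI sE] := wrefl a aP; rewrite /avg [RHS](reindex_inj sI); apply: eq_bigr => i _.
congr (_ * g _); rewrite -sE.
exact: (torus_act_tpi rs (reflection a (repr t')) (ww_ i)).
Qed.

Variable mu : probability T R.
Hypothesis mu_Haar : normalized_Haar mu.
Local Notation ip := (L2_inner mu).

Lemma ae_regular : {ae mu, forall t : T, regular (repr t)}.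
Proof.
have h : forall s : seq V, {subset s <= Phi} ->
    {ae mu, forall t : T, forall a, a \in s -> sin (dotv a (repr t) / 2) != 0}.
  elim=> [_|a s IH sub]; first exact: aeW.
  have aP : a \in Phi by apply: sub; rewrite mem_head.
  have h1 : {ae mu, forall t : T, sin (dotv a (repr t) / 2) != 0}.
    exists [set t : T | sin (dotv a (repr t) / 2) = 0]; split.
    - exact: (hyperplane_measurable rs aP).
    - exact: (hyperplane_null mu_Haar rs aP).
    - by move=> t /= /negP; rewrite negbK => /eqP.
  have h2 := IH (fun b bs => sub b (mem_behead (s := a :: s) bs)).
  by apply: filterS2 h1 h2 => t e1 e2 b; rewrite in_cons => /orP[/eqP ->|/e2].
exact: h.
Qed.

Lemma calP_L2 g : trig_poly Phi g -> L2 mu (fun t => g t * (Delta Pos k t)%:C).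
Proof.
move=> gT; have dm := Delta_measurable.
have db (t : T) : `|Delta Pos k t| <= 1 by have /andP[? ?] := Delta_fun01 (repr t); rewrite ger0_norm.
split.
  rewrite (_ : (fun t => _) = fun t => Delta Pos k t * complex.Re (g t)).
    by apply: L2r_mul_bounded db => //; apply: L2r_rtp => //; exact: trig_poly_Re.
  by apply/funext => t; case: (g t) => a b /=; ring.
rewrite (_ : (fun t => _) = fun t => Delta Pos k t * complex.Im (g t)).
  by apply: L2r_mul_bounded db => //; apply: L2r_rtp => //; exact: trig_poly_Im.
by apply/funext => t; case: (g t) => a b /=; ring.
Qed.

Lemma calP_L2_W : calP Phi Pos k `<=` L2_W mu.
Proof.
move=> _ [g [gT gW] ->]; split=> [|w ww]; first exact: calP_L2.
by apply: aeW => t; rewrite Delta_act // gW.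
Qed.

Lemma trig_poly_dense u (e : R) : L2 mu u -> 0 < e ->
  exists2 g, trig_poly Phi g & hnorm ip (u - (fun t => g t * (Delta Pos k t)%:C)) < e.
Proof.
move=> Lu e0; have dm := Delta_measurable.
have d01 (t : T) : 0 <= Delta Pos k t <= 1 by exact: Delta_fun01.
have d0 : {ae mu, forall t : T, Delta Pos k t != 0}.
  by apply: filterS ae_regular => t; exact: Delta_fun_neq0.
have e2 : 0 < e ^+ 2 / 2 by rewrite divr_gt0 ?exprn_gt0.
have [p pT pe] := weighted_trig_poly_dense rs dm d01 d0 Lu.1 e2.
have [q qT qe] := weighted_trig_poly_dense rs dm d01 d0 Lu.2 e2.
have gT : trig_poly Phi (fun t => (p t)%:C + (0 +i* 1) * (q t)%:C).
  by apply: trig_polyD => //; apply: trig_polyM => //; exact: trig_poly_cst.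
exists (fun t => (p t)%:C + (0 +i* 1) * (q t)%:C) => //.
rewrite (hnorm_subE Lu (calP_L2 gT)).
rewrite -[e]gtr0_norm // -sqrtr_sqr ltr_sqrt ?exprn_gt0 //.
have -> : (fun t => complex.Re (((p t)%:C + (0 +i* 1) * (q t)%:C) * (Delta Pos k t)%:C)) = fun t =>
    p t * Delta Pos k t.
  by apply/funext => t /=; ring.
have -> : (fun t => complex.Im (((p t)%:C + (0 +i* 1) * (q t)%:C) * (Delta Pos k t)%:C)) = fun t =>
    q t * Delta Pos k t.
  by apply/funext => t /=; ring.
lra.
Qed.

(** As [u] and [Delta] are W-invariant, averaging [u - g Delta] over W gives [u] minus [Delta] times
    the average of [g], almost everywhere. Averaging does not increase the norm because W preserves
    [mu]. *)
Lemma calP_dense : densely_contained ip (L2_W mu) (calP Phi Pos k).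
Proof.
split=> [|u Wu e e0]; first exact: calP_L2_W.
have Lu := Wu.1; have [g gT ge] := trig_poly_dense Lu e0.
have [I [w_ [I0 ww_ wavg]]] := weyl_average.
pose avg := fun t => \sum_i (#|I|%:R^-1)%:C * g (torus_act (w_ i) t).
have avgW : W_invariant avg := wavg g.
pose D (h : T -> R[i]) (t : T) := h t * (Delta Pos k t)%:C.
exists (D avg).
  exists avg => //; split=> //; apply: trig_poly_sum => i; apply: trig_polyM; first exact:
      trig_poly_cst.
  exact: trig_poly_act.
have ph := L2_pre_hilbert rs mu.
pose r (i : I) (t : T) := (u - D g) (torus_act (w_ i) t).
have LDg : L2 mu (D g) by exact: calP_L2.
have Lr i : L2 mu (r i) /\ hnorm ip (r i) = hnorm ip (u - D g).
  by apply: (L2_act rs mu_Haar (ww_ i)); exact: (phB ph).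
have cI : \sum_(i : I) (#|I|%:R^-1 : R) = 1 by rewrite sumr_const -[LHS]mulr_natl mulfV //
    pnatr_eq0 -lt0n.
pose F i (t : T) := (#|I|%:R^-1)%:C * r i t.
have LF i : L2 mu (F i) /\ hnorm ip (F i) <= #|I|%:R^-1 * hnorm ip (u - D g).
  split; first exact: (phZ ph _ (Lr i).1).
  rewrite -(Lr i).2 (nrmZ ph _ (Lr i).1) /Normc.normc /= expr0n addr0 sqrtr_sqr.
  by rewrite ger0_norm ?invr_ge0 ?ler0n.
have LS := L2_sum rs (enum I) LF.
pose S (t : T) := \sum_(i <- enum I) F i t.
have LDavg : L2 mu (D avg).
  apply: calP_L2; apply: trig_poly_sum => i; apply: trig_polyM; first exact: trig_poly_cst.
  exact: trig_poly_act.
rewrite (@hnorm_ae_eq _ _ _ mu (u - D avg) S) //.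
- apply: le_lt_trans ge; apply: le_trans LS.2 _.
  by rewrite -big_distrl /= big_enum cI mul1r.
- exact: (phB ph).
- exact: LS.1.
- have inv : {ae mu, forall t, forall i, i \in enum I -> u (torus_act (w_ i) t) = u t}.
    elim: (enum I) => [|i s IH]; first exact: aeW.
    apply: filterS2 (Wu.2 _ (ww_ i)) IH => t e1 e2 j.
    by rewrite in_cons => /orP[/eqP ->|/e2].
  apply: filterS inv => t inv; rewrite /S big_enum /= /F.
  have E i : (#|I|%:R^-1)%:C * r i t =
      (#|I|%:R^-1)%:C * u t - (#|I|%:R^-1)%:C * g (torus_act (w_ i) t) * (Delta Pos k t)%:C.
    by rewrite /r !fctE inv ?mem_enum // /D Delta_act // mulrBr mulrA.
  rewrite (eq_bigr _ (fun i _ => E i)) sumrB -!mulr_suml -rmorph_sum cI mul1r.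
  by [].
Qed.

End PositiveRoots.

(** * The Hamiltonian on C[P]^W Delta *)

Section TrigJets.
Variables (R : realType) (n : nat).
Local Notation V := 'rV[R]_n.

Lemma jet2_ext (F G : V -> R) F1 G1 F2 G2 : jet2 F F1 F2 -> (forall x, F x = G x) ->
  (forall v x, F1 v x = G1 v x) -> (forall v u x, F2 v u x = G2 v u x) -> jet2 G G1 G2.
Proof.
move=> J e e1 e2; rewrite -(_ : F = G); last exact/funext.
rewrite -(_ : F1 = G1); last by apply/funext => v; exact/funext.
by rewrite -(_ : F2 = G2) //; apply/funext => v; apply/funext => u; exact/funext.
Qed.

(** Derivatives are taken of real functions, so a complex trigonometric sum is carried as two such
    real sums, one for each part. *)
Definition trig_fun (s : seq V) (u v : V -> R) (x : V) : R :=
  \sum_(l <- s) (u l * cos (dotv l x) + v l * sin (dotv l x)).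
Definition trig_fun1 (s : seq V) (u v : V -> R) (b x : V) : R :=
  \sum_(l <- s) dotv l b * (v l * cos (dotv l x) - u l * sin (dotv l x)).
Definition trig_fun2 (s : seq V) (u v : V -> R) (b c x : V) : R :=
  - \sum_(l <- s) dotv l b * dotv l c * (u l * cos (dotv l x) + v l * sin (dotv l x)).

Lemma jet2_trig_fun s u v : jet2 (trig_fun s u v) (trig_fun1 s u v) (trig_fun2 s u v).
Proof.
elim: s => [|l s IH].
  apply: (jet2_ext (@jet2_cst R n 0)) => *; by rewrite /trig_fun /trig_fun1 /trig_fun2 big_nil ?oppr0.
have J := jet2D (jet2D (jet2_scale (u l) (jet2_cos l)) (jet2_scale (v l) (jet2_sin l))) IH.
apply: (jet2_ext J) => [x|b x|b c x].
- by rewrite /trig_fun big_cons.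
- by rewrite /trig_fun1 big_cons; ring.
- by rewrite /trig_fun2 big_cons; ring.
Qed.

Lemma derive_act (w : V -> V) (F G : V -> R) v x : linear w -> (forall y, F (w y) = G y) ->
  'D_(w v) F (w x) = 'D_v G x.
Proof.
move=> lw FG; rewrite /derive.
suff -> : (fun h : R => h^-1 *: (((F \o shift (w x)) (h *: w v)) - F (w x))) =
          (fun h : R => h^-1 *: (((G \o shift x) (h *: v)) - G x)) by [].
by apply/funext => h /=; rewrite -!FG lw.
Qed.

Lemma jet2_act (w : V -> V) (F : V -> R) F1 F2 : linear w -> (forall x, F (w x) = F x) -> jet2 F F1
    F2 ->
  (forall v x, F1 (w v) (w x) = F1 v x) /\ (forall v u x, F2 (w v) (w u) (w x) = F2 v u x).
Proof.
move=> lw FG J.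
have h1 v x : F1 (w v) (w x) = F1 v x.
  have [_ <-] := jet_d1 J (w v) (w x); have [_ <-] := jet_d1 J v x.
  exact: derive_act.
split=> // v u x; have [_ <-] := jet_d2 J (w v) (w u) (w x); have [_ <-] := jet_d2 J v u x.
exact: derive_act.
Qed.

Lemma bilinear_expand (B : V -> V -> R) x y :
  (forall c v v' u, B (c *: v + v') u = c * B v u + B v' u) ->
  (forall c v u u', B v (c *: u + u') = c * B v u + B v u') ->
  B x y = \sum_i \sum_j x 0 i * y 0 j * B (delta_mx 0 i) (delta_mx 0 j).
Proof.
move=> Bl Br.
have lin (L : V -> R) z : (forall c v v', L (c *: v + v') = c * L v + L v') ->
    L z = \sum_i z 0 i * L (delta_mx 0 i).
  move=> Ll; have L0 : L 0 = 0 by have := Ll (-1) 0 0; rewrite scaler0 addr0; lra.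
  rewrite {1}(row_sum_delta z); elim/big_rec2: _ => [//|i a b _ <-].
  exact: Ll.
rewrite (lin (fun v => B v y)); last by move=> *; exact: Bl.
apply: eq_bigr => i _; rewrite (lin (B _)); last by move=> *; exact: Br.
by rewrite mulr_sumr; apply: eq_bigr => j _; rewrite mulrA.
Qed.

Lemma dotv_delta (x : V) i : dotv x (delta_mx 0 i) = x 0 i.
Proof.
rewrite /dotv (bigD1 i) //= mxE !eqxx mulr1 big1 ?addr0 // => j /negPf ji.
by rewrite mxE ji andbF mulr0.
Qed.

Lemma sum_dotv_delta (x y : V) : \sum_i dotv x (delta_mx 0 i) * dotv y (delta_mx 0 i) = dotv x y.
Proof. by apply: eq_bigr => i _; rewrite !dotv_delta. Qed.

End TrigJets.

(** * Conjugation of the Hamiltonian by Delta *)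

Section CalPJets.
Variables (R : realType) (n : nat) (Phi Pos : {fset 'rV[R]_n}).
Local Notation V := 'rV[R]_n.
Local Notation T := (torus Phi).
Local Notation tpi := (@torus_pi R n Phi).
Hypothesis rs : reduced_crystallographic_root_system Phi.
Hypothesis Pos_positive : positive_roots Phi Pos.
Variable k : V -> R.
Hypothesis k_invariant : forall w a, weyl Phi w -> a \in Phi -> k (w a) = k a.
Hypothesis k_ge2 : forall a, a \in Phi -> 2 <= k a.
Local Notation Delta_fun := (Delta_lift Pos k).
Local Notation potential_fun := (potential_lift Pos k).
Local Notation regular := (regular Phi).

(** W acts by orthogonal maps, so the trace of the bilinear form [F2] at [w x] may be computed in
    the orthonormal basis of the [w e_i], where invariance of [F] compares it with the trace at
    [x]. *)
Lemma jet2_laplacian_weyl w (F : V -> R) F1 F2 x : weyl Phi w -> (forall x, F (w x) = F x) -> jet2 F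
    F1 F2 ->
  \sum_(i < n) F2 (delta_mx 0 i) (delta_mx 0 i) (w x) = \sum_(i < n) F2 (delta_mx 0 i) (delta_mx 0 i) x.
Proof.
move=> ww Fw J; have [_ h2] := jet2_act (weyl_linear ww) Fw J.
have [w' [ww' c1 c2]] := weyl_inv rs ww.
rewrite -[RHS](eq_bigr _ (fun i _ => h2 _ _ x)).
have wi i j : (w (delta_mx 0 i)) 0 j = w' (delta_mx 0 j) 0 i.
  by rewrite -!dotv_delta -(weyl_dotv rs _ _ ww') c1 dotvC.
under [RHS]eq_bigr => i _.
  rewrite (@bilinear_expand _ _ (fun v u => F2 v u (w x))); first last.
  - by move=> *; rewrite (jet_lin2r J).
  - by move=> *; rewrite (jet_lin2 J).
  over.
rewrite exchange_big /=; apply: eq_bigr => i _.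
rewrite exchange_big /= (bigD1 i) //= [X in _ = _ + X]big1 => [|j ji].
  rewrite -mulr_suml (_ : \sum_j _ = dotv (w' (delta_mx 0 i)) (w' (delta_mx 0 i))).
    by rewrite (weyl_dotv rs _ _ ww') dotv_delta mxE !eqxx mul1r addr0.
  by apply: eq_bigr => j _; rewrite !wi.
rewrite -mulr_suml (_ : \sum_j _ = dotv (w' (delta_mx 0 i)) (w' (delta_mx 0 j))).
  by rewrite (weyl_dotv rs _ _ ww') dotv_delta mxE (negPf ji) andbF mul0r.
by apply: eq_bigr => l _; rewrite !wi.
Qed.

Definition cot_root (x a : V) : R := cos (dotv a x / 2) / sin (dotv a x / 2).

Lemma cot_root_opp x a : cot_root x (- a) = - cot_root x a.
Proof. by rewrite /cot_root dotvNl mulNr sinN cosN invrN mulrN. Qed.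

Lemma cot_root_add x a b : regular x -> a \in Phi -> b \in Phi -> a + b \in Phi ->
  cot_root x a * cot_root x b - 1 = cot_root x (a + b) * (cot_root x a + cot_root x b).
Proof.
move=> rx /rx sa /rx sb /rx; rewrite /cot_root dotvDl mulrDl sinD cosD => sab.
by field; rewrite sa sb.
Qed.

(** The left side is the squared length of the gradient of [log Delta]. Its diagonal terms are the
    squared cotangents, and [sum_root_pairs] shows that the mixed terms add up to a constant. *)
Lemma sum_squares_log_derivative : exists K : R, forall x, regular x ->
  \sum_(i < n) (\sum_(a <- Pos) k a / 2 * cot_root x a * dotv a (delta_mx 0 i)) ^+ 2 =
  \sum_(a <- Pos) k a ^+ 2 / 4 * dotv a a * cot_root x a ^+ 2 + K.
Proof.
(* [16] is the square of [4]: the sum over [Pos] is half of the sum over [Phi], which turns [k / 2]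
   into [k / 4]. *)
exists (16^-1 * (- 2 / 3 * (\sum_(x <- pairsof Phi 1) pair_weight k x)
  - 2 * (\sum_(x <- pairsof Phi 2) pair_weight k x) - 8 / 3 * (\sum_(x <- pairsof Phi 3) pair_weight
      k x))).
move=> x rx.
rewrite -(@sum_root_pairs _ _ _ k rs k_invariant (cot_root x)); first last.
- by move=> a b *; exact: cot_root_add.
- by move=> a _; exact: cot_root_opp.
pose f a b := k a * k b * dotv a b * (cot_root x a * cot_root x b).
have half i : \sum_(a <- Pos) k a / 2 * cot_root x a * dotv a (delta_mx 0 i) =
    \sum_(a <- Phi) k a / 4 * cot_root x a * dotv a (delta_mx 0 i).
  rewrite (sum_Phi_Pos rs Pos_positive) => [|a aP]; last first.
    by rewrite (k_opp rs k_invariant aP) cot_root_opp dotvNl; ring.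
  by rewrite mulr_sumr; apply: eq_bigr => a _; field.
under eq_bigr => i _ do rewrite half expr2 mulr_suml.
rewrite exchange_big /=.
have -> : \sum_(a <- Phi) \sum_(i < n) k a / 4 * cot_root x a * dotv a (delta_mx 0 i) *
      (\sum_(b <- Phi) k b / 4 * cot_root x b * dotv b (delta_mx 0 i)) =
    16^-1 * \sum_(a <- Phi) \sum_(b <- Phi) f a b.
  rewrite mulr_sumr; apply: eq_bigr => a _.
  under eq_bigr do rewrite mulr_sumr.
  rewrite exchange_big mulr_sumr; apply: eq_bigr => b _ /=.
  rewrite /f -sum_dotv_delta !mulr_sumr mulr_suml mulr_sumr; apply: eq_bigr => i _.
  by field.
(* [b = a] and [b = - a] contribute equally, since [k] is even while the cotangent and the pairing
   are both odd. *)
have split_inner a : a \in Phi -> \sum_(b <- Phi) f a b = 2 * f a a + \sum_(b <- Phi | (b != a) &&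
    (b != - a)) f a b.
  move=> aP; have aNa : - a != a.
    apply/eqP => h; have := root_neq0 rs aP; rewrite -dotv_eq0.
    by have := dotvNl a a; rewrite h => ?; rewrite (_ : dotv a a = 0) ?eqxx //; lra.
  rewrite (bigD1_seq a) ?fset_uniq //= (bigID (fun b => b == - a)) /=.
  rewrite (_ : \sum_(b <- Phi | (b != a) && (b == - a)) f a b = f a a); first by ring.
  under eq_bigl => b.
    rewrite (_ : _ && _ = (b == - a)); first over.
    by case: (eqVneq b (- a)) => [->|_]; rewrite ?andbF ?andbT ?aNa.
  rewrite -big_filter filter_pred1_uniq ?fset_uniq ?(root_opp rs) // big_seq1.
  by rewrite /f (k_opp rs k_invariant aP) cot_root_opp dotvNr; ring.
rewrite (eq_big_seq _ split_inner) big_split /= mulrDr; congr (_ + _).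
rewrite -mulr_sumr (sum_Phi_Pos rs Pos_positive) => [|a aP]; last first.
  by rewrite /f (k_opp rs k_invariant aP) cot_root_opp dotvNl dotvNr; ring.
by rewrite !mulr_sumr; apply: eq_bigr => a _; rewrite /f; field.
Qed.

Lemma hamiltonian_regular : exists C : R, forall P P1 P2, jet2 P P1 P2 -> forall x, regular x ->
  - laplacian (fun y => P y * Delta_fun y) x + potential_fun x * (P x * Delta_fun x) =
  Delta_fun x * (C * P x - \sum_(i < n) P2 (delta_mx 0 i) (delta_mx 0 i) x
                 - \sum_(a <- Pos) k a * cot_root x a * P1 a x).
Proof.
have [K KE] := sum_squares_log_derivative.
(* The constant that appears when [k ^ 2 / (4 sin ^ 2)] is written as [k ^ 2 / 4 * (1 + cot ^ 2)] in
   the potential, together with its shift by [1/12]. The rest of the potential cancels the second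
   derivatives of [Delta] up to the constant [K]. *)
pose C0 := \sum_(a <- Pos) dotv a a * (k a ^+ 2 / 4 - k a * (k a - 1) / 12).
exists (C0 - K) => P P1 P2 J x rx.
have [D1 [D2 [JD DE]]] := Delta_jet Pos_positive k_ge2.
pose l v := \sum_(a <- Pos) k a / 2 * cot_root x a * dotv a v.
have e1 v : D1 v x = Delta_fun x * l v by exact: (DE x rx).1.
have e2 v u : D2 v u x = Delta_fun x * (l v * l u - \sum_(a <- Pos) k a / 4 / sin (dotv a x / 2) ^+
    2 * dotv a v * dotv a u).
  exact: (DE x rx).2.
have [_ ->] := jet2_C2 (jet2M J JD).
under eq_bigr => i _ do rewrite !e1 e2.
have P1lin : \sum_(i < n) P1 (delta_mx 0 i) x * l (delta_mx 0 i) = \sum_(a <- Pos) k a / 2 *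
    cot_root x a * P1 a x.
  under eq_bigr do rewrite mulr_sumr.
  rewrite exchange_big /=; apply: eq_bigr => a _.
  have h : P1 a x = \sum_i a 0 i * P1 (delta_mx 0 i) x.
    rewrite {1}(row_sum_delta a); have L0 : P1 0 x = 0.
      by have := jet_lin1 J (-1) 0 0 x; rewrite scaler0 addr0; lra.
    by elim/big_rec2: _ => [//|i y1 y2 _ <-]; rewrite (jet_lin1 J).
  rewrite h mulr_sumr; apply: eq_bigr => i _; rewrite dotv_delta /cot_root; ring.
have KEx := KE x rx.
have sq : \sum_(i < n) l (delta_mx 0 i) * l (delta_mx 0 i) = \sum_(a <- Pos) k a ^+ 2 / 4 * dotv a
    a * cot_root x a ^+ 2 + K.
  by rewrite -KEx; apply: eq_bigr => i _; rewrite -expr2.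
have dd : \sum_(i < n) \sum_(a <- Pos) k a / 4 / sin (dotv a x / 2) ^+ 2 * dotv a (delta_mx 0 i) *
    dotv a (delta_mx 0 i) =
    \sum_(a <- Pos) k a / 4 / sin (dotv a x / 2) ^+ 2 * dotv a a.
  rewrite exchange_big; apply: eq_bigr => a _ /=; rewrite -(sum_dotv_delta a a) mulr_sumr.
  by apply: eq_bigr => i _; ring.
have -> : \sum_(i < n) (P2 (delta_mx 0 i) (delta_mx 0 i) x * Delta_fun x +
      P1 (delta_mx 0 i) x * (Delta_fun x * l (delta_mx 0 i)) +
      (P1 (delta_mx 0 i) x * (Delta_fun x * l (delta_mx 0 i)) +
       P x * (Delta_fun x * (l (delta_mx 0 i) * l (delta_mx 0 i) -
         \sum_(a <- Pos) k a / 4 / sin (dotv a x / 2) ^+ 2 * dotv a (delta_mx 0 i) * dotv a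
             (delta_mx 0 i))))) =
   Delta_fun x * (\sum_(i < n) P2 (delta_mx 0 i) (delta_mx 0 i) x + 2 * (\sum_(i < n) P1 (delta_mx 0
       i) x * l (delta_mx 0 i))
     + P x * (\sum_(i < n) l (delta_mx 0 i) * l (delta_mx 0 i) -
     \sum_(i < n) \sum_(a <- Pos) k a / 4 / sin (dotv a x / 2) ^+ 2 * dotv a (delta_mx 0 i) * dotv a
         (delta_mx 0 i))).
  rewrite -sumrB !mulr_sumr -!big_split mulr_sumr /=; apply: eq_bigr => i _; ring.
rewrite P1lin sq dd.
have -> : potential_fun x = C0 - \sum_(a <- Pos) k a / 4 / sin (dotv a x / 2) ^+ 2 * dotv a a +
    \sum_(a <- Pos) k a ^+ 2 / 4 * dotv a a * cot_root x a ^+ 2.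
  rewrite /potential_lift /C0 -sumrB -big_split; apply: eq_big_seq => a /(Pos_root Pos_positive)/rx
      sa /=.
  have -> : cot_root x a ^+ 2 = (1 - sin (dotv a x / 2) ^+ 2) / sin (dotv a x / 2) ^+ 2.
    by rewrite /cot_root expr_div_n cos2sin2.
  by field.
have -> : \sum_(a <- Pos) k a * cot_root x a * P1 a x = 2 * \sum_(a <- Pos) k a / 2 * cot_root x a *
    P1 a x.
  by rewrite mulr_sumr; apply: eq_bigr => a _; field.
by ring.
Qed.

End CalPJets.

Section Characters.
Variables (R : realType) (n : nat).
Local Notation V := 'rV[R]_n.

Definition character (l x : V) : R[i] := cos (dotv l x) +i* sin (dotv l x).

Lemma characterD l m x : character (l + m) x = character l x * character m x.
Proof.
rewrite /character dotvDl cosD sinD.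
by apply/eqP; rewrite eq_complex /=; apply/andP; split; apply/eqP; ring.
Qed.

Lemma complex_sum I (r : seq I) (u v : I -> R) :
  \sum_(i <- r) (u i +i* v i) = (\sum_(i <- r) u i) +i* (\sum_(i <- r) v i).
Proof.
elim: r => [|i r IH]; first by rewrite !big_nil.
by rewrite !big_cons IH.
Qed.

(** Differentiating [e^l] along [a] multiplies it by [i <l, a>], and the Laplacian by [- |l| ^ 2].
    The pairs [u], [v] and [u'], [v'] are the cosine and sine coefficients of the real and of the
    imaginary part. *)
Lemma trig_funE (s : seq V) (c : V -> R[i]) (u v u' v' : V -> R) x :
  (forall l, u l = complex.Re (c l)) -> (forall l, v l = - complex.Im (c l)) ->
  (forall l, u' l = complex.Im (c l)) -> (forall l, v' l = complex.Re (c l)) ->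
  [/\ trig_fun s u v x +i* trig_fun s u' v' x = \sum_(l <- s) c l * character l x,
   (forall a, trig_fun1 s u v a x +i* trig_fun1 s u' v' a x =
      \sum_(l <- s) c l * (0 +i* dotv l a) * character l x) &
   (\sum_(i < n) trig_fun2 s u v (delta_mx 0 i) (delta_mx 0 i) x) +i*
   (\sum_(i < n) trig_fun2 s u' v' (delta_mx 0 i) (delta_mx 0 i) x) =
      - \sum_(l <- s) c l * (dotv l l)%:C * character l x].
Proof.
move=> uE vE u'E v'E; split=> [|a|].
- rewrite /trig_fun -complex_sum; apply: eq_bigr => l _.
  rewrite uE vE u'E v'E; case: (c l) => p q.
  by apply/eqP; rewrite eq_complex /=; apply/andP; split; apply/eqP; ring.
- rewrite /trig_fun1 -complex_sum; apply: eq_bigr => l _.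
  rewrite uE vE u'E v'E; case: (c l) => p q.
  by apply/eqP; rewrite eq_complex /=; apply/andP; split; apply/eqP; ring.
- have lapE (p q : V -> R) : \sum_(i < n) trig_fun2 s p q (delta_mx 0 i) (delta_mx 0 i) x =
      \sum_(l <- s) - (dotv l l * (p l * cos (dotv l x) + q l * sin (dotv l x))).
    rewrite /trig_fun2 sumrN sumrN; congr (- _); rewrite exchange_big; apply: eq_bigr => l _ /=.
    by rewrite -mulr_suml sum_dotv_delta.
  rewrite !lapE -complex_sum -[RHS]sumrN; apply: eq_bigr => l _.
  rewrite uE vE u'E v'E; case: (c l) => p q.
  by apply/eqP; rewrite eq_complex /=; apply/andP; split; apply/eqP; ring.
Qed.

End Characters.

(** * The action on invariant polynomials with exponents in a ball *)

Section HamiltonianOnCalP.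
Variables (R : realType) (n : nat) (Phi Pos : {fset 'rV[R]_n}).
Local Notation V := 'rV[R]_n.
Local Notation T := (torus Phi).
Local Notation tpi := (@torus_pi R n Phi).
Hypothesis rs : reduced_crystallographic_root_system Phi.
Hypothesis Pos_positive : positive_roots Phi Pos.
Variable k : V -> R.
Hypothesis k_invariant : forall w a, weyl Phi w -> a \in Phi -> k (w a) = k a.
Hypothesis k_ge2 : forall a, a \in Phi -> 2 <= k a.
Local Notation Delta_fun := (Delta_lift Pos k).
Local Notation potential_fun := (potential_lift Pos k).
Local Notation regular := (regular Phi).

Definition trig_sum (s : seq V) (c : V -> R[i]) (t : T) : R[i] := \sum_(l <- s) c l * expo l t.

Definition times_Delta (g : T -> R[i]) (t : T) : R[i] := g t * (Delta Pos k t)%:C.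

Lemma pullbackE (f : T -> R[i]) x : f (tpi x) = re_pullback f x +i* im_pullback f x.
Proof. by rewrite /re_pullback /im_pullback; case: (f _). Qed.

Lemma re_pullback_periodic (f : T -> R[i]) : torus_periodic Phi (re_pullback f).
Proof. exact: (periodic_tpi (fun t => complex.Re (f t))). Qed.

Lemma im_pullback_periodic (f : T -> R[i]) : torus_periodic Phi (im_pullback f).
Proof. exact: (periodic_tpi (fun t => complex.Im (f t))). Qed.

Lemma calP_pullback (s : seq V) c : (forall l, l \in s -> weight_lattice Phi l) ->
  let re l := complex.Re (c l) in let im l := complex.Im (c l) in
  re_pullback (times_Delta (trig_sum s c)) = (fun x => trig_fun s re (fun l => - im l) x * Delta_fun
      x) /\
  im_pullback (times_Delta (trig_sum s c)) = (fun x => trig_fun s im re x * Delta_fun x).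
Proof.
move=> sP re im.
have E x : times_Delta (trig_sum s c) (tpi x) =
    (trig_fun s re (fun l => - im l) x +i* trig_fun s im re x) * (Delta_fun x)%:C.
  have [-> _ _] := @trig_funE _ _ s c re (fun l => - im l) im re x
    (fun=> erefl) (fun=> erefl) (fun=> erefl) (fun=> erefl).
  rewrite /times_Delta Delta_funE (periodic_repr _ (Delta_periodic rs Pos_positive k)); congr (_ * _).
  by apply: eq_big_seq => l ls; rewrite (expo_tpi _ (sP l ls)).
by split; apply/funext => x; rewrite /re_pullback /im_pullback E /=; ring.
Qed.

Definition torus_jet (f : T -> R[i]) := exists F1 F2 G1 G2,
  jet2 (re_pullback f) F1 F2 /\ jet2 (im_pullback f) G1 G2.

Lemma calP_jet g : trig_poly Phi g -> torus_jet (times_Delta g).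
Proof.
move=> [s [c [sP ->]]]; have [eR eI] := @calP_pullback s c sP.
have [D1 [D2 [JD _]]] := Delta_jet Pos_positive k_ge2.
have J u v := jet2M (jet2_trig_fun s u v) JD.
by do 4 eexists; rewrite eR eI; split; exact: J.
Qed.

Lemma torus_jet_C2 f : torus_jet f -> torus_C2 f.
Proof. by move=> [F1 [F2 [G1 [G2 [J1 J2]]]]]; split; [exact: (jet2_C2 J1).1|exact: (jet2_C2 J2).1]. Qed.

Lemma hamiltonian_calP : exists C : R, forall (s : seq V) c, (forall l, l \in s -> weight_lattice
    Phi l) ->
  forall x, regular x -> hamiltonian Pos k (times_Delta (trig_sum s c)) (tpi x) =
    (Delta_fun x)%:C * (\sum_(l <- s) c l * (C + dotv l l)%:C * character l x -
      \sum_(a <- Pos) (k a)%:C * ((cot_root x a)%:C * \sum_(l <- s) c l * (0 +i* dotv l a) *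
          character l x)).
Proof.
have [C CE] := hamiltonian_regular rs Pos_positive k_invariant k_ge2.
exists C => s c sP x rx; have [eR eI] := @calP_pullback s c sP.
set re := (fun l => complex.Re (c l)) in eR eI; set im := (fun l => complex.Im (c l)) in eR eI.
have [g0 g1 g2] := @trig_funE _ _ s c re (fun l => - im l) im re x
    (fun=> erefl) (fun=> erefl) (fun=> erefl) (fun=> erefl).
have lapE F (pF : torus_periodic Phi F) := periodic_repr x (periodic_laplacian pF).
rewrite /hamiltonian /torus_laplacian !lapE; [|exact: im_pullback_periodic|exact: re_pullback_periodic].
rewrite pullbackE potential_funE (periodic_repr _ (potential_periodic rs Pos_positive k)) eR eI.
have -> : - (laplacian (fun x => trig_fun s re (fun l => - im l) x * Delta_fun x) x +i*
      laplacian (fun x => trig_fun s im re x * Delta_fun x) x) +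
    (potential_fun x)%:C * ((trig_fun s re (fun l => - im l) x * Delta_fun x) +i* (trig_fun s im re
        x * Delta_fun x)) =
    (- laplacian (fun x => trig_fun s re (fun l => - im l) x * Delta_fun x) x +
      potential_fun x * (trig_fun s re (fun l => - im l) x * Delta_fun x)) +i*
    (- laplacian (fun x => trig_fun s im re x * Delta_fun x) x +
      potential_fun x * (trig_fun s im re x * Delta_fun x)).
  by apply/eqP; rewrite eq_complex /=; apply/andP; split; apply/eqP; ring.
have h1 := CE _ _ _ (jet2_trig_fun s re (fun l => - im l)) x rx.
have h2 := CE _ _ _ (jet2_trig_fun s im re) x rx.
apply: (etrans (congr2 (@complex.Complex R) h1 h2)).
have -> : \sum_(l <- s) c l * (C + dotv l l)%:C * character l x =
    C%:C * (\sum_(l <- s) c l * character l x) - - \sum_(l <- s) c l * (dotv l l)%:C * character l x.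
  rewrite opprK mulr_sumr -big_split; apply: eq_bigr => l _ /=.
  by rewrite rmorphD /= mulrDr mulrDl; congr (_ + _); ring.
rewrite -g0 -g2.
have -> : \sum_(a <- Pos) (k a)%:C * ((cot_root x a)%:C * \sum_(l <- s) c l * (0 +i* dotv l a) *
    character l x) =
    (\sum_(a <- Pos) k a * cot_root x a * trig_fun1 s re (fun l => - im l) a x) +i*
    (\sum_(a <- Pos) k a * cot_root x a * trig_fun1 s im re a x).
  rewrite -complex_sum; apply: eq_bigr => a _; rewrite -g1.
  by apply/eqP; rewrite eq_complex /=; apply/andP; split; apply/eqP; ring.
by apply/eqP; rewrite eq_complex /=; apply/andP; split; apply/eqP; ring.
Qed.

(** Equality is asked on [D] only: where the sine vanishes the cotangent takes the default value of
    a division by zero, and the identities may fail. *)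
Definition spanned_on (D : V -> Prop) (s : seq V) (f : V -> R[i]) := exists d : V -> R[i],
  forall x, D x -> f x = \sum_(l <- s) d l * character l x.
Local Notation spanned := (spanned_on regular).

Lemma spannedD D s f g : spanned_on D s f -> spanned_on D s g -> spanned_on D s (fun x => f x + g x).
Proof.
move=> [c cE] [d dE]; exists (fun l => c l + d l) => x rx; rewrite cE // dE // -big_split.
by apply: eq_bigr => l _; rewrite mulrDl.
Qed.

Lemma spannedZ D s a f : spanned_on D s f -> spanned_on D s (fun x => a * f x).
Proof.
move=> [c cE]; exists (fun l => a * c l) => x rx; rewrite cE // mulr_sumr.
by apply: eq_bigr => l _; rewrite mulrA.
Qed.

Lemma spanned_ext D s f g : (forall x, D x -> f x = g x) -> spanned_on D s f -> spanned_on D s g.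
Proof. by move=> e [c cE]; exists c => x rx; rewrite -e // cE. Qed.

Lemma spanned_sum D s (I : eqType) (r : seq I) (F : I -> V -> R[i]) :
  (forall i, i \in r -> spanned_on D s (F i)) -> spanned_on D s (fun x => \sum_(i <- r) F i x).
Proof.
elim: r => [_|i r IH sub].
  exists (fun=> 0) => x _; rewrite big_nil big1 // => l _; exact: mul0r.
have [] : spanned_on D s (F i) /\ spanned_on D s (fun x => \sum_(i <- r) F i x).
  by split; [apply: sub; rewrite mem_head|apply: IH => j jr; apply: sub; rewrite in_cons jr orbT].
move=> h1 h2; apply: spanned_ext (spannedD h1 h2) => x _; by rewrite big_cons.
Qed.

Lemma spanned_character D s l : uniq s -> l \in s -> spanned_on D s (character l).
Proof.
move=> us ls; exists (fun m => (m == l)%:R) => x _.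
rewrite (bigD1_seq l) //= eqxx mul1r big1 ?addr0 // => m /negPf ->; exact: mul0r.
Qed.

Section Ball.
Variables (N : R) (s : {fset V}).
Hypothesis sP : forall l, l \in s <-> weight_lattice Phi l /\ dotv l l <= N.

(* Multiplying by [cot (<a, x> / 2) = i (e^a + 1) / (e^a - 1)] turns each step
   [e^(l - j a) - e^(l - (j + 1) a)] of the string from [l] to its reflection into a sum. *)
Lemma spanned_string a l (m : nat) : a \in Phi -> l \in s -> dotv l (coroot a) = m%:R ->
  spanned s (fun x => (cot_root x a)%:C * (character l x - character (reflection a l) x)).
Proof.
move=> aP ls lm; have a0 := root_neq0 rs aP; have aa : dotv a a != 0 by rewrite dotv_eq0.
have la : 2 * dotv l a = m%:R * dotv a a by rewrite -lm dotv_coroot; field.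
(* The points [l - j a] lie between [l] and its reflection: [|l - j a| ^ 2 = |l| ^ 2 - j (m - j) |a|
   ^ 2]. *)
have inball (j : nat) : (j <= m)%N -> l - j%:R *: a \in s.
  have [lP lN] := (sP l).1 ls; move=> jm; apply/sP; split.
    rewrite scaler_nat; elim: (j) => [|i IH]; first by rewrite mulr0n subr0.
    by rewrite mulrS opprD addrCA; apply: weightD => //; apply: weightN; exact: root_weight.
  apply: le_trans lN; rewrite dotvBl !dotvBr !dotvZl !dotvZr (dotvC a l).
  have -> : dotv l l - j%:R * dotv l a - (j%:R * dotv l a - j%:R * (j%:R * dotv a a)) =
      dotv l l - j%:R * (m%:R - j%:R) * dotv a a.
    have -> : dotv l a = m%:R * dotv a a / 2 by rewrite -la; field.
    by field.
  by rewrite gerBl mulr_ge0 ?dotv_ge0 // mulr_ge0 // subr_ge0 ler_nat.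
pose S x := (0 +i* 1) * \sum_(j <- iota 0 m) (character (l - j%:R *: a) x + character (l -
    j.+1%:R *: a) x).
apply: (@spanned_ext _ _ S); last first.
  apply: spannedZ; apply: spanned_sum => j; rewrite mem_iota add0n => /= jm.
  by apply: spannedD; apply: spanned_character; rewrite ?fset_uniq // inball // ltnW.
move=> x rx; rewrite /reflection lm.
have step j : (0 +i* 1) * (character (l - j%:R *: a) x + character (l - j.+1%:R *: a) x) =
    (cot_root x a)%:C * (character (l - j%:R *: a) x - character (l - j.+1%:R *: a) x).
  set l' := l - j.+1%:R *: a.
  have -> : l - j%:R *: a = l' + a by rewrite /l' -natr1 scalerDl scale1r opprD addrA subrK.
  rewrite characterD; move: (character l' x) => z.
  have -> : (0 +i* 1) * (z * character a x + z) = z * ((0 +i* 1) * (character a x + 1)) by ring.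
  have -> : (cot_root x a)%:C * (z * character a x - z) = z * ((cot_root x a)%:C * (character a x -
      1)) by ring.
  congr (_ * _); rewrite /character /cot_root; have := rx a aP.
  have -> : dotv a x = dotv a x / 2 + dotv a x / 2 by field.
  set y := dotv a x / 2; have -> : (y + y) / 2 = y by field.
  rewrite sinD cosD => sy; have c2 : cos y * cos y = 1 - sin y * sin y by rewrite -!expr2 cos2sin2.
  have s2 : sin y * sin y = 1 - cos y * cos y by rewrite c2; ring.
  apply/eqP; rewrite eq_complex /=; apply/andP; split; apply/eqP; first by rewrite c2; field.
  by rewrite s2; field.
rewrite /S mulr_sumr (eq_bigr _ (fun j _ => step j)) -mulr_sumr; congr (_ * _).
have tele (F : nat -> R[i]) : \sum_(j <- iota 0 m) (F j - F j.+1) = F 0%N - F m.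
  rewrite -[X in iota 0 X]subn0 -/(index_iota 0 m) (@telescope_sumr_eq _ 0 m (fun j => - F j)) //.
    by rewrite opprK addrC.
  by move=> j _; rewrite opprK addrC.
by rewrite (tele (fun j => character (l - j%:R *: a) x)) scale0r subr0.
Qed.

Lemma reflection_ball a l : a \in Phi -> l \in s -> reflection a l \in s.
Proof.
move=> aP /sP[lP lN]; apply/sP; rewrite dotv_reflection ?(root_neq0 rs) //; split=> //.
exact: (weyl_weight rs (weyl_refl aP)).
Qed.

(** A negative pairing becomes positive when [l] and its reflection are exchanged, which only
    changes the sign of the difference. *)
Lemma spanned_reflection_difference a l : a \in Phi -> l \in s ->
  spanned s (fun x => (cot_root x a)%:C * (character l x - character (reflection a l) x)).
Proof.
move=> aP ls; have a0 := root_neq0 rs aP.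
have /intrP[[m|m] lm] := ((sP l).1 ls).1 a aP; first exact: (spanned_string aP ls lm).
have l'm : dotv (reflection a l) (coroot a) = m.+1%:R.
  have aa : dotv a a != 0 by rewrite dotv_eq0.
  have two : dotv a (coroot a) = 2 by rewrite dotv_coroot; field.
  by rewrite /reflection dotvBl dotvZl two lm NegzE mulrNz; ring.
have h := spannedZ (-1) (spanned_string aP (reflection_ball aP ls) l'm).
by apply: spanned_ext h => x _; rewrite reflectionK //; ring.
Qed.

Lemma hamiltonian_spanned c : W_invariant (trig_sum s c) -> exists d, forall x, regular x ->
  hamiltonian Pos k (times_Delta (trig_sum s c)) (tpi x) = times_Delta (trig_sum s d) (tpi x).
Proof.
move=> cW; have sw l : l \in s -> weight_lattice Phi l by move=> /sP[].
have [C CE] := hamiltonian_calP.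
have tE d x : trig_sum s d (tpi x) = \sum_(l <- s) d l * character l x.
  by apply: eq_big_seq => l ls; rewrite (expo_tpi _ (sw l ls)).
set re := (fun l => complex.Re (c l)); set im := (fun l => complex.Im (c l)).
(* The invariance of the polynomial makes its derivative along [a] odd under the reflection, since
   [reflection a a = - a]; the derivative therefore equals half of its difference with its
   reflection. *)
have anti a x : a \in Phi -> \sum_(l <- s) c l * (0 +i* dotv l a) * character l x =
    \sum_(l <- s) (c l * (0 +i* dotv l a) / 2) * (character l x - character (reflection a l) x).
  move=> aP; have a0 := root_neq0 rs aP; have ra := weyl_refl aP.
  have inv y : trig_fun s re (fun l => - im l) (reflection a y) +i* trig_fun s im re (reflection a y) =
      trig_fun s re (fun l => - im l) y +i* trig_fun s im re y.
    have [-> _ _] := @trig_funE _ _ s c re (fun l => - im l) im re (reflection a y)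
      (fun=> erefl) (fun=> erefl) (fun=> erefl) (fun=> erefl).
    have [-> _ _] := @trig_funE _ _ s c re (fun l => - im l) im re y
      (fun=> erefl) (fun=> erefl) (fun=> erefl) (fun=> erefl).
    by rewrite -!tE -(torus_act_tpi rs _ ra) cW.
  have [i1 _] := jet2_act (weyl_linear ra) (fun y => (congr1 (@complex.Re R) (inv y)))
      (jet2_trig_fun s re (fun l => - im l)).
  have [i2 _] := jet2_act (weyl_linear ra) (fun y => (congr1 (@complex.Im R) (inv y)))
      (jet2_trig_fun s im re).
  have opp u v y : trig_fun1 s u v (- a) y = - trig_fun1 s u v a y.
    by rewrite /trig_fun1 -sumrN; apply: eq_bigr => l _; rewrite dotvNr mulNr.
  have [_ g1 _] := @trig_funE _ _ s c re (fun l => - im l) im re x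
    (fun=> erefl) (fun=> erefl) (fun=> erefl) (fun=> erefl).
  have [_ g1' _] := @trig_funE _ _ s c re (fun l => - im l) im re (reflection a x)
    (fun=> erefl) (fun=> erefl) (fun=> erefl) (fun=> erefl).
  have e : \sum_(l <- s) c l * (0 +i* dotv l a) * character l x =
      - \sum_(l <- s) c l * (0 +i* dotv l a) * character (reflection a l) x.
    under [in RHS]eq_bigr => l _.
      rewrite (_ : character (reflection a l) x = character l (reflection a x)); last first.
        by rewrite /character !(dotv_reflectionl _ _ a0).
      over.
    rewrite -g1 -g1' -i1 -i2 reflection_self // !opp.
    by apply/eqP; rewrite eq_complex /= !eqxx.
  have two : (2 : R[i]) != 0 by rewrite pnatr_eq0.
  apply: (mulfI two); rewrite mulr_sumr [in RHS]mulr_sumr.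
  transitivity (\sum_(l <- s) (c l * (0 +i* dotv l a) * character l x - c l * (0 +i* dotv l a) *
      character (reflection a l) x)).
    by rewrite sumrB -e -mulr_sumr mulr_natl mulr2n.
  by apply: eq_bigr => l _; field.
have [d dE] : spanned s (fun x => \sum_(l <- s) c l * (C + dotv l l)%:C * character l x -
      \sum_(a <- Pos) (k a)%:C * ((cot_root x a)%:C * \sum_(l <- s) c l * (0 +i* dotv l a) *
          character l x)).
  apply: spannedD; first by exists (fun l => c l * (C + dotv l l)%:C).
  apply: spanned_ext (fun x _ => mulN1r _) _; apply: spannedZ; apply: spanned_sum => a /(Pos_root
      Pos_positive) aP.
  apply: spannedZ.
  pose S x := \sum_(l <- s) (c l * (0 +i* dotv l a) / 2) * ((cot_root x a)%:C * (character l x -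
      character (reflection a l) x)).
  apply: (@spanned_ext _ _ S).
    by move=> x _; rewrite anti // mulr_sumr; apply: eq_bigr => l _; ring.
  by apply: spanned_sum => l ls; apply: spannedZ; exact: spanned_reflection_difference.
exists d => x rx; rewrite CE // dE // /times_Delta tE Delta_funE (periodic_repr _ (Delta_periodic rs
    Pos_positive k)).
by rewrite mulrC.
Qed.

End Ball.
End HamiltonianOnCalP.

(** * Domain, invariance and linearity of the Hamiltonian *)

Section HamiltonianOperator.
Variables (R : realType) (n : nat) (Phi Pos : {fset 'rV[R]_n}).
Local Notation V := 'rV[R]_n.
Local Notation T := (torus Phi).
Local Notation tpi := (@torus_pi R n Phi).
Hypothesis rs : reduced_crystallographic_root_system Phi.
Hypothesis Pos_positive : positive_roots Phi Pos.
Variable k : V -> R.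
Hypothesis k_invariant : forall w a, weyl Phi w -> a \in Phi -> k (w a) = k a.
Hypothesis k_ge2 : forall a, a \in Phi -> 2 <= k a.
Variable mu : probability T R.
Hypothesis mu_Haar : normalized_Haar mu.
Local Notation Delta_fun := (Delta_lift Pos k).
Local Notation potential_fun := (potential_lift Pos k).
Local Notation L2r := (Lfun mu 2%:E).
Local Notation ip := (L2_inner mu).
Local Notation H := (hamiltonian Pos k).

(** Since [2 <= k a], the factor of [Delta] at [a] contains [sin ^ 2], which absorbs the
    singularity, and all other factors are at most [1]. Where the sine vanishes the inverse is [0]
    by convention. *)
Lemma inv_sin_Delta_le1 a x : a \in Pos -> 0 <= (4 * sin (dotv a x / 2) ^+ 2)^-1 * Delta_fun x <= 1.
Proof.
move=> aP; have k2 := k_ge2 (Pos_root Pos_positive aP).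
have /andP[D0 _] := Delta_fun01 Pos_positive k_ge2 x.
have i0 : 0 <= (4 * sin (dotv a x / 2) ^+ 2)^-1 by rewrite invr_ge0 (mulr_ge0 _ (sqr_ge0 _)).
rewrite (mulr_ge0 i0 D0) /=.
have [s0|s0] := eqVneq (sin (dotv a x / 2)) 0; first by rewrite s0 expr0n mulr0 invr0 mul0r ler01.
have s2 : 0 < sin (dotv a x / 2) ^+ 2 by rewrite exprn_even_gt0.
have p0 : 0 < 4 * sin (dotv a x / 2) ^+ 2 by rewrite (mulr_gt0 _ s2).
rewrite (ler_pdivrMl _ _ p0) mulr1.
apply: le_trans (_ : sin (dotv a x / 2) ^+ 2 <= _); last by rewrite ler_peMl ?sqr_ge0 // ler1n.
rewrite /Delta_lift (bigD1_seq a) ?fset_uniq //= -(norm_powR_mul2 _ s0).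
set q := _ `^ (k a - 2); set r := \prod_(_ <- _ | _) _.
have -> : q * sin (dotv a x / 2) * sin (dotv a x / 2) * r = sin (dotv a x / 2) ^+ 2 * (q * r) by ring.
rewrite ler_piMr ?sqr_ge0 // mulr_ile1 ?powR_ge0 ?prodr_ge0 //; try by move=> b _; exact: powR_ge0.
  by apply: norm_sin_powR_le1; lra.
rewrite /r big_seq_cond; apply: prodr_ile1 => b /andP[/(Pos_root Pos_positive)/k_ge2 kb _].
by rewrite powR_ge0 norm_sin_powR_le1 //; lra.
Qed.

Lemma potential_measurable : measurable_fun setT (potential Pos k : T -> R).
Proof.
(* [measurable_sum] asks for measurability of the term at every [a], hence the test [a \in Phi]. The
   inverse is written as a power with exponent [-1], a measurable function, and the sine by its
   periodic absolute value. *)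
rewrite (_ : potential Pos k = fun t : T => \sum_(a <- Pos) if a \in Phi then k a * (k a - 1) * dotv
    a a *
    ((4 * `|sin (dotv a (repr t) / 2)| ^+ 2) `^ (-1) - 12^-1) else 0); last first.
  apply/funext => t; apply: eq_big_seq => a /(Pos_root Pos_positive) ->.
  by rewrite powR_inv1 ?mulr_ge0 ?sqr_ge0 // real_normK ?num_real.
apply: measurable_sum => a; case: (boolP (a \in Phi)) => aP; last exact: measurable_cst.
apply: measurable_funM; first exact: measurable_cst.
apply: measurable_funB; last exact: measurable_cst.
suff h : measurable_fun setT (fun t : T => 4 * `|sin (dotv a (repr t) / 2)| ^+ 2).
  exact: (measurableT_comp (measurable_powR (-1)) h).
apply: measurable_funM; first exact: measurable_cst.
apply: measurable_funX; apply: (torus_measurable (periodic_norm_sin (root_weight rs aP))).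
exact: continuous_norm_sin.
Qed.

Lemma potential_Delta_bounded : exists M : R, forall t : T, `|potential Pos k t * Delta Pos k t| <= M.
Proof.
exists (\sum_(a <- Pos) `|k a * (k a - 1) * dotv a a| * 2) => t.
rewrite potential_funE Delta_funE mulr_suml; apply: le_trans (ler_norm_sum _ _ _) _.
rewrite big_seq [X in _ <= X]big_seq; apply: ler_sum => a aP.
rewrite -mulrA normrM ler_wpM2l // mulrBl.
have /andP[h1 h2] := inv_sin_Delta_le1 (repr t) aP.
have /andP[h3 h4] := Delta_fun01 Pos_positive k_ge2 (repr t).
by rewrite ler_norml; apply/andP; split; lra.
Qed.

Lemma potential_calP_L2 g : trig_poly Phi g -> L2 mu (fun t => (potential Pos k t)%:C * times_Delta
    Pos k g t).
Proof.
move=> gT; have [M bM] := potential_Delta_bounded.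
have mVD : measurable_fun setT (fun t : T => potential Pos k t * Delta Pos k t).
  apply: measurable_funM; first exact: potential_measurable.
  exact: (Delta_measurable rs Pos_positive k_ge2).
split.
  rewrite (_ : (fun t => _) = fun t => (potential Pos k t * Delta Pos k t) * complex.Re (g t)).
    by apply: L2r_mul_bounded bM => //; apply: L2r_rtp => //; exact: trig_poly_Re.
  by apply/funext => t; rewrite /times_Delta; case: (g t) => a b /=; ring.
rewrite (_ : (fun t => _) = fun t => (potential Pos k t * Delta Pos k t) * complex.Im (g t)).
  by apply: L2r_mul_bounded bM => //; apply: L2r_rtp => //; exact: trig_poly_Im.
by apply/funext => t; rewrite /times_Delta; case: (g t) => a b /=; ring.
Qed.

Lemma calP_domain : calP Phi Pos k `<=` hamiltonian_domain mu Pos k.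
Proof.
move=> _ [g [gT gW] ->]; split.
- by move=> w ww t; rewrite (gW w ww) (Delta_act rs Pos_positive k_invariant _ ww).
- by apply: torus_jet_C2; exact: (calP_jet rs Pos_positive k_ge2).
- exact: (calP_L2 rs Pos_positive k_ge2).
- exact: potential_calP_L2.
Qed.

Lemma torus_jet_laplacian (f : T -> R[i]) : torus_jet f -> L2 mu (torus_laplacian f).
Proof.
move=> [F1 [F2 [G1 [G2 [J1 J2]]]]].
have h (F : V -> R) F1' F2' : jet2 F F1' F2' -> torus_periodic Phi F -> (fun t : T => laplacian F
    (repr t)) \in L2r.
  move=> J pF; have [_ lapE] := jet2_C2 J.
  have pL := periodic_laplacian pF.
  have cL : continuous (laplacian F).
    rewrite (_ : laplacian F = fun x => \sum_i F2' (delta_mx 0 i) (delta_mx 0 i) x); last exact/funext.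
    by apply: continuous_sum_fun => i; exact: (jet_c2 J).
  have [M bM] := periodic_bounded rs pL cL.
  by apply: (@bounded_Lfun2 _ _ _ _ _ M) => //; exact: torus_measurable.
by split; [exact: (h _ _ _ J1 (@re_pullback_periodic _ _ _ _))|exact: (h _ _ _ J2
    (@im_pullback_periodic _ _ _ _))].
Qed.

Lemma hamiltonian_calP_L2 g : trig_poly Phi g -> L2 mu (H (times_Delta Pos k g)).
Proof.
move=> gT; have l := torus_jet_laplacian (calP_jet rs Pos_positive k_ge2 gT).
have v := potential_calP_L2 gT.
exact: (phD (L2_pre_hilbert rs mu) (phN (L2_pre_hilbert rs mu) l) v).
Qed.

Lemma W_invariant_pullback (f : T -> R[i]) w x : W_invariant f -> weyl Phi w -> f (tpi (w x)) = f
    (tpi x).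
Proof. by move=> fW ww; rewrite -(torus_act_tpi rs _ ww) fW. Qed.

Lemma hamiltonian_W_invariant (f : T -> R[i]) : torus_jet f -> W_invariant f -> W_invariant (H f).
Proof.
move=> [F1 [F2 [G1 [G2 [J1 J2]]]]] fW w ww t.
suff lapE : torus_laplacian f (torus_act w t) = torus_laplacian f t.
  have e1 := potential_act rs Pos_positive k_invariant t ww; have e2 := fW w ww t.
  by rewrite /hamiltonian e1 e2 lapE.
have inv (F : V -> R) F1' F2' : torus_periodic Phi F -> jet2 F F1' F2' -> (forall x, F (w x) = F x) ->
    laplacian F (repr (torus_act w t)) = laplacian F (repr t).
  move=> pF J Fw; have pL := periodic_laplacian pF.
  rewrite /torus_act (periodic_repr _ pL) !(jet2_C2 J).2.
  exact: (jet2_laplacian_weyl rs _ ww Fw J).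
have eR := inv _ _ _ (@re_pullback_periodic _ _ _ f) J1
  (fun x => congr1 (@complex.Re R) (W_invariant_pullback x fW ww)).
have eI := inv _ _ _ (@im_pullback_periodic _ _ _ f) J2
  (fun x => congr1 (@complex.Im R) (W_invariant_pullback x fW ww)).
exact: (congr2 (@complex.Complex R) eR eI).
Qed.

Lemma torus_jet_lin (a : R[i]) (f g : T -> R[i]) : torus_jet f -> torus_jet g ->
  torus_jet (a *: f + g) /\ torus_laplacian (a *: f + g) = a *: torus_laplacian f + torus_laplacian g.
Proof.
case: a => p q [F1 [F2 [F1' [F2' [J1 J2]]]]] [G1 [G2 [G1' [G2' [K1 K2]]]]].
have JR := jet2D (jet2D (jet2_scale p J1) (jet2_scale (- q) J2)) K1.
have JI := jet2D (jet2D (jet2_scale p J2) (jet2_scale q J1)) K2.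
have eR x : p * re_pullback f x + - q * im_pullback f x + re_pullback g x = re_pullback ((p +i*
    q) *: f + g) x.
  by rewrite /re_pullback /im_pullback !fctE; case: (f _) => ? ?; case: (g _) => ? ? /=; ring.
have eI x : p * im_pullback f x + q * re_pullback f x + im_pullback g x = im_pullback ((p +i* q) *:
    f + g) x.
  by rewrite /re_pullback /im_pullback !fctE; case: (f _) => ? ?; case: (g _) => ? ? /=; ring.
have JR' := jet2_ext JR eR (fun _ _ => erefl) (fun _ _ _ => erefl).
have JI' := jet2_ext JI eI (fun _ _ => erefl) (fun _ _ _ => erefl).
split; first by do 4 eexists; split; [exact: JR'|exact: JI'].
apply/funext => t; rewrite /torus_laplacian !fctE (jet2_C2 JR').2 (jet2_C2 JI').2.
rewrite (jet2_C2 J1).2 (jet2_C2 J2).2 (jet2_C2 K1).2 (jet2_C2 K2).2.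
rewrite !big_split -!mulr_sumr /=.
by apply/eqP; rewrite eq_complex /=; apply/andP; split; apply/eqP; ring.
Qed.

Lemma calP_lin (a : R[i]) f g : calP Phi Pos k f -> calP Phi Pos k g -> calP Phi Pos k (a *: f + g).
Proof.
move=> [p [pT pW] ->] [q [qT qW] ->]; exists (fun t => a * p t + q t).
  split; first by apply: trig_polyD => //; apply: trig_polyM => //; exact: trig_poly_cst.
  by move=> w ww t; rewrite pW ?qW.
apply/funext => t; change (a * (p t * (Delta Pos k t)%:C) + q t * (Delta Pos k t)%:C =
  (a * p t + q t) * (Delta Pos k t)%:C).
by rewrite mulrDl mulrA.
Qed.

Lemma calP_torus_jet f : calP Phi Pos k f -> torus_jet f.
Proof. by move=> [g [gT _] ->]; exact: (calP_jet rs Pos_positive k_ge2). Qed.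

Lemma hamiltonian_linear_operator : linear_operator_in (L2_W mu) (calP Phi Pos k) H.
Proof.
split.
- exists (fun=> 0); first by split; [exact: trig_poly0|].
  by apply/funext => t; rewrite mul0r.
- exact: calP_lin.
- move=> a f g Df Dg.
  have [_ e] := torus_jet_lin a (calP_torus_jet Df) (calP_torus_jet Dg).
  apply/funext => t; rewrite /hamiltonian e.
  change (- (a * torus_laplacian f t + torus_laplacian g t) + (potential Pos k t)%:C * (a * f t + g t) =
    a * (- torus_laplacian f t + (potential Pos k t)%:C * f t) +
    (- torus_laplacian g t + (potential Pos k t)%:C * g t)).
  move: (torus_laplacian f t) (torus_laplacian g t) (f t) (g t) ((potential Pos k t)%:C) => x y z u v.
  ring.
- move=> f Df; split; first exact: (calP_L2_W rs Pos_positive k_invariant k_ge2 mu Df).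
  have [fW _ _ _] := calP_domain Df; have Jf := calP_torus_jet Df.
  have [g [gT _] e] := Df; split; first by rewrite e; exact: hamiltonian_calP_L2.
  by move=> w ww; apply: aeW => t; exact: hamiltonian_W_invariant.
Qed.

End HamiltonianOperator.

(** * Finite-dimensional invariant subspaces *)

Section MatrixRange.
Variables (R : realType) (E : lmodType R[i]) (ip : E -> E -> R[i]) (H : set E).
Hypothesis ph : pre_hilbert ip H.
Variables (D : set E) (A : E -> E).
Hypotheses (linA : linear_operator_in H D A) (denseD : densely_contained ip H D) (symA :
    symmetric_on ip D A).
(** [phi] parametrises an invariant subspace and may have a kernel; [M] represents [A] in these
    coordinates up to null vectors. *)
Variables (m : nat) (phi : 'rV[R[i]]_m.+1 -> E) (M : 'M[R[i]]_m.+1).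
Hypotheses (phi_lin : forall a c d, phi (a *: c + d) = a *: phi c + phi d)
  (phiD : forall c, D (phi c))
  (phiM : forall c, hnorm ip (A (phi c) - phi (c *m M)) = 0).
Local Notation nrm := (hnorm ip).

Let DH f : D f -> H f. Proof. by move=> Df; have [_ _ _ /(_ f Df)[]] := linA. Qed.
Let AH f : D f -> H (A f). Proof. by move=> Df; have [_ _ _ /(_ f Df)[]] := linA. Qed.

Let phi0 : phi 0 = 0.
Proof. by have := phi_lin (-1) 0 0; rewrite !scaleN1r !addNr. Qed.

Let nrm_eq0_le f g : H f -> H g -> nrm (f - g) = 0 -> nrm f <= nrm g.
Proof.
by move=> Hf Hg h; rewrite -[f](subrK g) (le_trans (nrmD ph (phB ph Hf Hg) Hg)) // h add0r.
Qed.

(* If [q (M)] annihilates [c], then [X + t i] either divides [q], and can be removed as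
   [A + t i] is injective, or can be inverted modulo [q]. *)
Lemma shifted_range (t : R) : t ^+ 2 = 1 -> forall c, exists c',
  nrm (A (phi c') + (t *i) *: phi c' - phi c) = 0.
Proof.
move=> t1; pose tau : R[i] := t *i.
pose B c := A (phi c) + tau *: phi c.
have BH c : H (B c) by apply: (phD ph); [exact: AH|apply: (phZ ph); exact: DH].
have pH c : H (phi c) by exact: DH.
have BE c : nrm (B c - phi (c *m (M + tau%:M))) = 0.
  have e : phi (c *m (M + tau%:M)) = phi (c *m M) + tau *: phi c.
    by rewrite mulmxDr mul_mx_scalar addrC phi_lin addrC.
  by rewrite e /B opprD addrACA subrr addr0.
(* Induction on the degree of a polynomial that annihilates the single vector [c] up to a null
   vector; the characteristic polynomial starts it. *)
suff ind sz (q : {poly R[i]}) c : (size q <= sz)%N -> q != 0 ->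
    nrm (phi (c *m horner_mx M q)) = 0 -> exists c', nrm (B c' - phi c) = 0.
  move=> c; apply: (ind _ (char_poly M) c (leqnn _)); first exact: monic_neq0 (char_poly_monic M).
  by rewrite Cayley_Hamilton mulmx0 phi0 -[X in nrm X](scale0r (0 : E)) (nrmZ ph _ (ph_0 ph))
      Normc.normc0 mul0r.
elim: sz q c => [|sz IH] q c; first by rewrite leqn0 size_poly_eq0 => /eqP ->; rewrite eqxx.
move=> szq q0 h; pose a := - tau; pose b := q.[a].
have /factor_theorem[q' qE] : root (q - b%:P) a by rewrite rootE !hornerE subrr.
have fact : horner_mx M q = horner_mx M q' *m (M + tau%:M) + b%:M.
  rewrite -[q](subrK b%:P) qE rmorphD rmorphM /= rmorphB /= horner_mx_X !horner_mx_C.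
  by rewrite /a (raddfN (@scalar_mx _ _)) opprK mulmxE.
have [b0|b0] := eqVneq b 0; last first.
  (* Solve for [c] in [c *m q (M) = c *m q' (M) *m (M + tau) + b *: c], whose left side is sent to a
     null vector by [phi]. *)
  exists ((- b^-1) *: (c *m horner_mx M q')); set c' := _ *: _.
  have e : phi (c' *m (M + tau%:M)) = phi c - b^-1 *: phi (c *m horner_mx M q).
    have -> : c' *m (M + tau%:M) = - b^-1 *: (c *m horner_mx M q) + c.
      rewrite fact mulmxDr scalerDr mul_mx_scalar scalerA mulNr mulVf // scaleN1r subrK.
      by rewrite /c' -scalemxAl mulmxA.
    by rewrite phi_lin scaleNr addrC.
  have Hz : H (b^-1 *: phi (c *m horner_mx M q)) by exact: (phZ ph).
  apply/eqP; rewrite eq_le nrm_ge0 andbT.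
  apply: le_trans (nrm_triangle ph (BH c') (pH (c' *m (M + tau%:M))) (pH c)) _.
  rewrite BE add0r e addrAC subrr add0r (nrmN ph) // (nrmZ ph) // h mulr0 //.
have q'0 : q' != 0.
  by apply: contraNneq q0 => q'0; rewrite -[q](subrK b%:P) qE q'0 mul0r b0 polyC0 addr0.
apply: (IH q' c _ q'0 _).
  by move: szq; rewrite -[q](subrK b%:P) qE b0 polyC0 addr0 size_Mmonic ?monicXsubC // size_XsubC addn2.
apply/eqP; rewrite eq_le nrm_ge0 andbT.
apply: le_trans (shift_ge ph linA denseD symA (phiD _) t1) _.
apply: le_trans (nrm_eq0_le (BH _) (pH _) (BE _)) _.
by rewrite -mulmxA -h fact b0 raddf0 addr0.
Qed.

End MatrixRange.

(** * Symmetry, invariant subspaces and conclusion *)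

Section EssentialSelfAdjointness.
Variables (R : realType) (n : nat) (Phi Pos : {fset 'rV[R]_n}).
Local Notation V := 'rV[R]_n.
Local Notation T := (torus Phi).
Local Notation tpi := (@torus_pi R n Phi).
Hypothesis rs : reduced_crystallographic_root_system Phi.
Hypothesis Pos_positive : positive_roots Phi Pos.
Variable k : V -> R.
Hypothesis k_invariant : forall w a, weyl Phi w -> a \in Phi -> k (w a) = k a.
Hypothesis k_ge2 : forall a, a \in Phi -> 2 <= k a.
Variable mu : probability T R.
Hypothesis mu_Haar : normalized_Haar mu.
Local Notation L2r := (Lfun mu 2%:E).
Local Notation ip := (L2_inner mu).
Local Notation H := (hamiltonian Pos k).

(** The integrand is the divergence of [F1 G - F G1], and each partial derivative of a periodic
    function integrates to zero. *)
Lemma Green_identity (F G : V -> R) F1 F2 G1 G2 : jet2 F F1 F2 -> jet2 G G1 G2 ->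
  torus_periodic Phi F -> torus_periodic Phi G ->
  (\int[mu]_t (laplacian F (repr t) * G (repr t) - F (repr t) * laplacian G (repr t)) = 0)%R.
Proof.
move=> JF JG pF pG; have [_ lF] := jet2_C2 JF; have [_ lG] := jet2_C2 JG.
have per (K : V -> R) K1 K2 v : jet2 K K1 K2 -> torus_periodic Phi K -> torus_periodic Phi (K1 v).
  move=> J pK; rewrite (_ : K1 v = 'D_v K); first exact: periodic_derive.
  by apply/funext => x; have [_ <-] := jet_d1 J v x.
pose K i x := F1 (delta_mx 0 i) x * G x - F x * G1 (delta_mx 0 i) x.
pose K' i x := F2 (delta_mx 0 i) (delta_mx 0 i) x * G x - F x * G2 (delta_mx 0 i) (delta_mx 0 i) x.
have dK i x : is_derive x (delta_mx 0 i) (K i) (K' i x).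
  have D := @is_deriveB _ _ _ _ _ _ _ _ _ (is_derive_mul_fun (jet_d2 JF (delta_mx 0 i) (delta_mx 0
      i) x) (jet_d1 JG (delta_mx 0 i) x))
    (is_derive_mul_fun (jet_d1 JF (delta_mx 0 i) x) (jet_d2 JG (delta_mx 0 i) (delta_mx 0 i) x)).
  by apply: (is_derive_eq D); rewrite /K'; ring.
have cK' i : continuous (K' i).
  apply: continuous_add_fun.
    by apply: continuous_mul_fun; [exact: jet_c2 JF _ _|exact: jet_c0 JG].
  by apply: continuous_opp_fun; apply: continuous_mul_fun; [exact: jet_c0 JF|exact: jet_c2 JG _ _].
have cK i : continuous (K i).
  apply: continuous_add_fun.
    by apply: continuous_mul_fun; [exact: jet_c1 JF _|exact: jet_c0 JG].
  by apply: continuous_opp_fun; apply: continuous_mul_fun; [exact: jet_c0 JF|exact: jet_c1 JG _].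
have pK i : torus_periodic Phi (K i).
  move=> x q qL; rewrite /K pF // pG // (per _ _ _ (delta_mx 0 i) JF pF x q qL).
  by rewrite (per _ _ _ (delta_mx 0 i) JG pG x q qL).
have DK i : 'D_(delta_mx 0 i) (K i) = K' i.
  by apply/funext => x; have [_ <-] := dK i x.
have pK' i : torus_periodic Phi (K' i) by rewrite -DK; exact: periodic_derive.
have iK' i : mu.-integrable setT (EFin \o (fun t : T => K' i (repr t))) by exact: periodic_integrable.
have [_ sumE] := Rintegral_sum (fun (i : 'I_n) (_ : i \in index_enum _) => iK' i).
transitivity (\int[mu]_t (\sum_i K' i (repr t)))%R.
  apply: eq_Rintegral => t _; rewrite lF lG mulr_suml mulr_sumr -sumrB.
  by [].
rewrite sumE big1 // => i _; rewrite -DK; apply: (integral_derive0 mu_Haar rs) => //.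
by rewrite DK; exact: cK'.
Qed.

Lemma real_symmetric (F G : V -> R) F1 F2 G1 G2 : jet2 F F1 F2 -> jet2 G G1 G2 ->
  torus_periodic Phi F -> torus_periodic Phi G ->
  let op (K : V -> R) (t : T) := - laplacian K (repr t) + potential Pos k t * K (repr t) in
  (fun t : T => F (repr t)) \in L2r -> (fun t : T => G (repr t)) \in L2r ->
  op F \in L2r -> op G \in L2r ->
  real_ip mu (fun t => F (repr t)) (op G) = real_ip mu (op F) (fun t => G (repr t)).
Proof.
move=> JF JG pF pG op LF LG LoF LoG; rewrite /real_ip; apply/eqP; rewrite -subr_eq0; apply/eqP.
rewrite -RintegralB //; [|exact: Lfun2_mul_integrable..].
rewrite -(Green_identity JF JG pF pG); apply: eq_Rintegral => t _.
have alg (a b x y v : R) : a * (- y + v * b) - (- x + v * a) * b = x * b - a * y by ring.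
exact: alg.
Qed.

(** The potential is real, so the parts of [H f] are the real operator applied to the parts of [f],
    and the four real pairings are treated separately. *)
Lemma hamiltonian_symmetric : symmetric_on ip (calP Phi Pos k) H.
Proof.
move=> f g Df Dg.
have [_ _ _ hL] := hamiltonian_linear_operator rs Pos_positive k_invariant k_ge2 mu.
have [[Lf _] [LHf _]] := hL f Df; have [[Lg _] [LHg _]] := hL g Dg.
have [F1 [F2 [F1' [F2' [J1 J2]]]]] := calP_torus_jet rs Pos_positive k_ge2 Df.
have [G1 [G2 [G1' [G2' [K1 K2]]]]] := calP_torus_jet rs Pos_positive k_ge2 Dg.
rewrite !L2_innerE //.
have eR (h : T -> R[i]) : (fun t => complex.Re (h t)) = (fun t => re_pullback h (repr t)).
  by apply/funext => t; rewrite /re_pullback torus_piK.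
have eI (h : T -> R[i]) : (fun t => complex.Im (h t)) = (fun t => im_pullback h (repr t)).
  by apply/funext => t; rewrite /im_pullback torus_piK.
have hR (h : T -> R[i]) : (fun t => complex.Re (H h t)) =
    (fun t => - laplacian (re_pullback h) (repr t) + potential Pos k t * re_pullback h (repr t)).
  apply/funext => t; rewrite /hamiltonian /torus_laplacian /re_pullback torus_piK.
  by case: (h t) => p q /=; ring.
have hI (h : T -> R[i]) : (fun t => complex.Im (H h t)) =
    (fun t => - laplacian (im_pullback h) (repr t) + potential Pos k t * im_pullback h (repr t)).
  apply/funext => t; rewrite /hamiltonian /torus_laplacian /im_pullback torus_piK.
  by case: (h t) => p q /=; ring.
case: Lf Lg LHf LHg => fr fi [gr gi] [hfr hfi] [hgr hgi].
rewrite (eR f) in fr; rewrite (eR g) in gr; rewrite (eI f) in fi; rewrite (eI g) in gi.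
rewrite (hR f) in hfr; rewrite (hR g) in hgr; rewrite (hI f) in hfi; rewrite (hI g) in hgi.
have pR (h : T -> R[i]) := @re_pullback_periodic _ _ _ h; have pI (h : T -> R[i]) :=
    @im_pullback_periodic _ _ _ h.
have s1 := etrans (congr2 (real_ip mu) (eR f) (hR g)) (etrans (real_symmetric J1 K1 (pR f) (pR g) fr
    gr hfr hgr)
  (esym (congr2 (real_ip mu) (hR f) (eR g)))).
have s2 := etrans (congr2 (real_ip mu) (eI f) (hI g)) (etrans (real_symmetric J2 K2 (pI f) (pI g) fi
    gi hfi hgi)
  (esym (congr2 (real_ip mu) (hI f) (eI g)))).
have s3 := etrans (congr2 (real_ip mu) (eR f) (hI g)) (etrans (real_symmetric J1 K2 (pR f) (pI g) fr
    gi hfr hgi)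
  (esym (congr2 (real_ip mu) (hR f) (eI g)))).
have s4 := etrans (congr2 (real_ip mu) (eI f) (hR g)) (etrans (real_symmetric J2 K1 (pI f) (pR g) fi
    gr hfi hgr)
  (esym (congr2 (real_ip mu) (hI f) (eR g)))).
exact: (congr2 (@complex.Complex R) (congr2 +%R s1 s2) (congr2 (fun x y => x - y) s3 s4)).
Qed.

Lemma trig_sum_tpi (s : seq V) d x : (forall l, l \in s -> weight_lattice Phi l) ->
  trig_sum s d (tpi x) = \sum_(l <- s) d l * character l x :> R[i].
Proof. by move=> sP; apply: eq_big_seq => l ls; rewrite (expo_tpi _ (sP l ls)). Qed.

(** [phi c] is [Delta] times the average over W of the polynomial with coefficients [c] on the
    weights of a ball that contains the exponents of [u]. *)
Lemma calP_invariant_space (u : T -> R[i]) : calP Phi Pos k u ->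
  exists (m : nat) (phi : 'rV[R[i]]_m.+1 -> T -> R[i]) (M : 'M[R[i]]_m.+1),
  [/\ forall a c d, phi (a *: c + d) = a *: phi c + phi d, forall c, calP Phi Pos k (phi c),
      forall c, hnorm ip (H (phi c) - phi (c *m M)) = 0 & exists c, u = phi c].
Proof.
move=> [g [[s0 [c0 [s0P gE]]] gW] uE].
(* An upper bound of the squared lengths of all exponents, nonnegative even when [s0] is empty. *)
pose N := \sum_(l <- s0) dotv l l.
have [s sP] := weight_ball_finite rs N.
have sw l : l \in s -> weight_lattice Phi l by move=> /sP[].
have N0 : 0 <= N by apply: sumr_ge0 => l _; exact: dotv_ge0.
have z_s : 0 \in s by apply/sP; split; [exact: weight0|rewrite dotv0l].
have s0s l : l \in s0 -> l \in s.
  move=> ls; apply/sP; split; first exact: s0P.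
  by rewrite /N (big_fsetD1 l) //= lerDl sumr_ge0 // => j _; exact: dotv_ge0.
(* Size [m.+1] makes the square matrices a nontrivial ring, as polynomials in [M] require. The extra
   index [m] runs past the end of [s], where [nth] returns the weight [0], which lies in [s]; [conv]
   gives it the coefficient [0]. *)
pose m := size s; pose l_ (i : 'I_m.+1) := s`_i.
have l_s i : l_ i \in s.
  rewrite /l_; have := ltn_ord i; rewrite ltnS leq_eqVlt => /orP[/eqP e|lt]; last exact: mem_nth.
  by rewrite nth_default // e.
pose tr (c : 'rV[R[i]]_m.+1) (t : T) := \sum_i c 0 i * expo (l_ i) t.
have trT c : trig_poly Phi (tr c).
  by apply: trig_poly_sum => i; apply: trig_poly_expo; exact: sw.
have tr_lin a c d t : tr (a *: c + d) t = a * tr c t + tr d t.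
  rewrite /tr mulr_sumr -big_split; apply: eq_bigr => i _ /=.
  by rewrite !mxE mulrDl mulrA.
have conv (d : V -> R[i]) : exists c, forall t, tr c t = trig_sum s d t.
  exists (\row_i (if (i < m)%N then d (s`_i) else 0)) => t.
  rewrite /tr /trig_sum big_ord_recr /= mxE ltnn mul0r addr0 (big_nth 0) big_mkord.
  by apply: eq_bigr => i _; rewrite mxE /= ltn_ord.
have [I [w_ [I0 ww_ wavg]]] := weyl_average rs.
pose avg (h : T -> R[i]) (t : T) := \sum_i (#|I|%:R^-1)%:C * h (torus_act (w_ i) t).
have avg_lin a h h' t : avg (fun t => a * h t + h' t) t = a * avg h t + avg h' t.
  rewrite /avg mulr_sumr -big_split; apply: eq_bigr => i _ /=.
  by rewrite mulrDr mulrCA.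
have cI : \sum_(i : I) (#|I|%:R^-1 : R) = 1.
  by rewrite sumr_const -[LHS]mulr_natl mulfV // pnatr_eq0 -lt0n.
have avg_inv h t : (forall i, h (torus_act (w_ i) t) = h t) -> avg h t = h t.
  move=> hi; rewrite /avg (eq_bigr _ (fun i _ => congr1 (fun z => _ * z) (hi i))).
  by rewrite -mulr_suml -rmorph_sum cI mul1r.
have avgT h : trig_poly Phi h -> trig_poly Phi (avg h).
  move=> hT; apply: trig_poly_sum => i; apply: trig_polyM; first exact: trig_poly_cst.
  exact: trig_poly_act.
pose phi c := times_Delta Pos k (avg (tr c)).
have phiP c : calP Phi Pos k (phi c).
  by exists (avg (tr c)) => //; split; [exact: avgT|exact: wavg].
have phi_lin a c d : phi (a *: c + d) = a *: phi c + phi d.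
  apply/funext => t; change (avg (tr (a *: c + d)) t * (Delta Pos k t)%:C =
    a * (avg (tr c) t * (Delta Pos k t)%:C) + avg (tr d) t * (Delta Pos k t)%:C).
  rewrite (_ : tr (a *: c + d) = fun t => a * tr c t + tr d t); last exact/funext.
  by rewrite avg_lin mulrDl mulrA.
have [_ _ linH inL] := hamiltonian_linear_operator rs Pos_positive k_invariant k_ge2 mu.
have hM i : exists c, forall x, regular Phi x ->
    H (phi (delta_mx 0 i)) (tpi x) = times_Delta Pos k (tr c) (tpi x).
  (* W preserves lengths, so averaging keeps the exponents in the ball and yields an invariant sum
     over [s], as [hamiltonian_spanned] requires. *)
  have [e eE] : exists e, avg (tr (delta_mx 0 i)) = trig_sum s e.
    have [e eE] : spanned_on (fun=> True) s (fun x => avg (tr (delta_mx 0 i)) (tpi x)).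
      apply: spanned_sum => j _; apply: spannedZ.
      have [w' [ww' c1 c2]] := weyl_inv rs (ww_ j).
      have w's : w' (l_ i) \in s.
        have [h1 h2] := (sP _).1 (l_s i); apply/sP; split; first exact: (weyl_weight rs ww').
        by rewrite (weyl_dotv rs).
      apply: (spanned_ext _ (spanned_character (fun=> True) (fset_uniq s) w's)) => x _.
      rewrite /tr (bigD1 i) //= mxE !eqxx mul1r big1 => [|j' /negPf ji]; last by rewrite mxE ji
          andbF mul0r.
      by rewrite addr0 (expo_act rs _ (ww_ j) ww' c2 (sw _ (l_s i))) (expo_tpi _ (sw _ w's)).
    exists e; apply/funext => t; rewrite -(torus_piK t) eE //.
    by rewrite (trig_sum_tpi _ _ sw).
  have [|d dE] := hamiltonian_spanned rs Pos_positive k_invariant k_ge2 sP (c := e).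
    by rewrite -eE; exact: wavg.
  have [c cE] := conv d; exists c => x rx; rewrite /phi eE dE // /times_Delta cE.
  by [].
pose M : 'M[R[i]]_m.+1 := \matrix_(i, j) (projT1 (cid (hM i))) 0 j.
have HphiE c x : regular Phi x -> H (phi c) (tpi x) = times_Delta Pos k (tr (c *m M)) (tpi x).
  move=> rx; have lin (L : 'rV[R[i]]_m.+1 -> R[i]) : (forall a c d, L (a *: c + d) = a * L c + L d) ->
      forall c, L c = \sum_i c 0 i * L (delta_mx 0 i).
    move=> Ll c'; have L0 : L 0 = 0.
      by have := Ll (-1) 0 0; rewrite scaler0 addr0 mulN1r addNr.
    rewrite {1}(row_sum_delta c'); elim/big_rec2: _ => [//|i a b _ <-].
    exact: Ll.
  rewrite (lin (fun c => H (phi c) (tpi x))); last first.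
    by move=> a c1 c2; rewrite phi_lin linH.
  rewrite [RHS](lin (fun c => times_Delta Pos k (tr (c *m M)) (tpi x))); last first.
    by move=> a c1 c2; rewrite mulmxDl -scalemxAl /times_Delta tr_lin mulrDl mulrA.
  apply: eq_bigr => i _; congr (_ * _); rewrite -rowE.
  rewrite (_ : row i M = projT1 (cid (hM i))); first by case: cid => c' /= ->.
  by apply/rowP => j; rewrite !mxE.
exists m, phi, M; split=> //; last first.
  have [c cE] := conv (fun l => if l \in s0 then c0 l else 0); exists c; rewrite uE.
  apply/funext => t; rewrite /phi /times_Delta; congr (_ * _).
  have tg : tr c = g.
    apply/funext => t'; rewrite cE gE /trig_sum.
    have sub : (s0 `<=` s)%fset by apply/fsubsetP.
    rewrite -(big_fset_incl _ sub) => [|l _ /negPf ->]; last by rewrite mul0r.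
    by apply: eq_big_seq => l ->.
  by rewrite tg avg_inv // => i; exact: gW.
move=> c; have [[LH _] _] := inL _ (phiP c).
have [_ [LHp _]] := inL _ (phiP c); have [[Lp _] _] := inL _ (phiP (c *m M)).
apply: (hnorm_ae0 rs); first exact: (phB (L2_pre_hilbert rs mu)).
have HW : W_invariant (H (phi c)).
  apply: (hamiltonian_W_invariant rs Pos_positive k_invariant).
    exact: (calP_torus_jet rs Pos_positive k_ge2).
  by have [g' [_ gW'] ->] := phiP c => w ww t; rewrite (gW' w ww) (Delta_act rs Pos_positive
      k_invariant _ ww).
apply: filterS (ae_regular rs mu_Haar) => t rt.
change (H (phi c) t - phi (c *m M) t = 0); apply/eqP; rewrite subr_eq0; apply/eqP.
(* [hM] gives [H (phi c)] as [Delta] times [tr (c *m M)], not averaged, and only at regular points.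
   The invariant function [H (phi c)] is therefore replaced by its own average; the Weyl images of a
   regular point are regular. *)
rewrite -(avg_inv (H (phi c)) t); last by move=> i; exact: HW.
rewrite /phi /times_Delta /avg mulr_suml; apply: eq_bigr => i _; rewrite -mulrA; congr (_ * _).
rewrite -/(phi c) /torus_act HphiE; last exact: regular_weyl.
by rewrite /times_Delta -/(torus_act (w_ i) t) (Delta_act rs Pos_positive k_invariant _ (ww_ i)).
Qed.

Lemma calP_essentially_self_adjoint :
  essentially_self_adjoint_on (E := T -> R[i]) ip (L2_W mu) (calP Phi Pos k) H.
Proof.
have ph := L2_W_pre_hilbert rs mu.
have linA := hamiltonian_linear_operator rs Pos_positive k_invariant k_ge2 mu.
have denseD := calP_dense rs Pos_positive k_invariant k_ge2 mu_Haar.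
apply: (essentially_self_adjoint_of_range ph linA denseD hamiltonian_symmetric) => t t1 u Du.
have [m [phi [M [phi_lin phiD phiM [c ->]]]]] := calP_invariant_space Du.
have [c' c'E] := shifted_range ph linA denseD hamiltonian_symmetric phi_lin phiD phiM t1 c.
by exists (phi c').
Qed.

End EssentialSelfAdjointness.

Theorem theorem2p3 (R : realType) (n : nat) (Phi Pos : {fset 'rV[R]_n})
    (k : 'rV[R]_n -> R) (mu : probability (torus Phi) R)
    (Phi_root_system : reduced_crystallographic_root_system Phi)
    (Pos_positive : positive_roots Phi Pos)
    (k_invariant : forall w a, weyl Phi w -> a \in Phi -> k (w a) = k a)
    (mu_Haar : normalized_Haar mu)
    (k_ge2 : forall a, a \in Phi -> 2 <= k a) :
  calP Phi Pos k `<=` hamiltonian_domain mu Pos k /\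
  essentially_self_adjoint_on (E := torus Phi -> R[i]) (L2_inner mu) (L2_W mu)
    (calP Phi Pos k) (hamiltonian Pos k).
Proof.
split; first exact: (calP_domain Phi_root_system Pos_positive k_invariant k_ge2).
exact: calP_essentially_self_adjoint.
Qed.
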